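(* Let $\mathbf{k}$ be an algebraically closed field of characteristic $0$ and let $$F=x_1x_2x_4-x_1x_5^2+x_2x_3^2+x_3x_5x_6+x_4x_6^2\in\mathbf{k}[x_1,\dots,x_6].$$ Let $S=\mathbf{k}[\alpha_1,\dots,\alpha_6]$ and $I=F^\perp+S_{\ge3}\subseteq S$. Then $[I]$ is a non-reduced point of $\mathcal{H}=\mathrm{Hilb}^{13}_{\mathbb{A}^6/\mathbf{k}}$, i.e. the local ring $\mathcal{O}_{\mathcal{H},[I]}$ is not reduced.
   Context: $S=\mathbf{k}[\alpha_1,\dots,\alpha_6]$ acts on $\mathbf{k}[x_1,\dots,x_6]$ with $\alpha_i$ acting as $\frac{\partial}{\partial x_i}$, and $F^\perp=\{f\in S: f \text{ applied to } F \text{ is } 0\}$. $S_{\ge3}$ is the ideal of polynomials all of whose terms have degree $\ge3$. $\mathrm{Hilb}^{13}_{\mathbb{A}^6/\mathbf{k}}$ is the Hilbert scheme of $13$ points on $\mathbb{A}^6=\mathrm{Spec}\,S$: its $A$-points, for a $\mathbf{k}$-algebra $A$, are the ideals $J\subseteq A[\alpha_1,\dots,\alpha_6]$ such that the quotient is a finite flat $A$-module of rank $13$. $[I]$ denotes the $\mathbf{k}$-point corresponding to $I$. *)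

(* Defs.v *)
From HB Require Import structures.
From mathcomp Require Import all_boot all_order all_algebra.
From mathcomp Require Export mpoly.

Set Implicit Arguments.
Unset Strict Implicit.
Unset Printing Implicit Defensive.

Import GRing.Theory.
Local Open Scope ring_scope.

Definition finite_module (A : comNzRingType) (M : lmodType A) : Prop :=
  exists s : seq M, forall m : M, exists c : 'I_(size s) -> A,
    m = \sum_i c i *: s`_i.

(* An element of M (x)_A N is represented by a list of pairs, read as the sum
   of the pure tensors m (x) n.  By the universal property of the tensor
   product it is zero iff every bilinear map kills it. *)
Definition tensor_eq0 (A : comNzRingType) (M N : lmodType A)
    (t : seq (M * N)) : Prop :=
  forall (P : lmodType A) (phi : {bilinear M -> N -> P}),
    \sum_(x <- t) phi x.1 x.2 = 0.

(* M is flat iff M (x) N' -> M (x) N is injective for every injective linear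
   map N' -> N. *)
Definition flat_module (A : comNzRingType) (M : lmodType A) : Prop :=
  forall (N' N : lmodType A) (u : {linear N' -> N}), injective u ->
  forall t : seq (M * N'),
    tensor_eq0 [seq (x.1, u x.2) | x <- t] -> tensor_eq0 t.

(* chi : A -> K is, up to isomorphism, the canonical map A -> Frac (A / p) to
   the residue field of the prime p = ker chi. *)
Definition residue_map (A : comNzRingType) (K : fieldType)
    (chi : {rmorphism A -> K}) : Prop :=
  forall z : K, exists a b : A, chi b != 0 /\ z = chi a / chi b.

(* The K-vector space M (x)_A K, given by its universal property, has
   dimension d. *)
Definition fibre_dim (A : comNzRingType) (M : lmodType A) (K : fieldType)
    (chi : {rmorphism A -> K}) (d : nat) : Prop :=
  exists (V : vectType K) (iota : {linear M -> V | chi \; *:%R}),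
    (forall (W : lmodType K) (g : {linear M -> W | chi \; *:%R}),
       exists h : {linear V -> W}, (forall m, h (iota m) = g m) /\
         forall h' : {linear V -> W}, (forall m, h' (iota m) = g m) -> h' =1 h)
    /\ \dim {: V} = d.

Definition module_rank (A : comNzRingType) (M : lmodType A) (d : nat) : Prop :=
  forall (K : fieldType) (chi : {rmorphism A -> K}),
    residue_map chi -> fibre_dim M chi d.

(* Subsets and ideals are Prop-valued predicates, compared extensionally. *)

Definition same_set (T : Type) (X Y : T -> Prop) : Prop :=
  forall x, X x <-> Y x.

Definition is_ideal (R : comNzRingType) (J : R -> Prop) : Prop :=
  [/\ J 0, forall p q, J p -> J q -> J (p + q) & forall c p, J p -> J (c * p)].

Definition ideal_gen (R : comNzRingType) (G : R -> Prop) : R -> Prop :=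
  fun p => exists s : seq (R * R),
    (forall x, x \in s -> G x.2) /\ p = \sum_(x <- s) x.1 * x.2.

Definition ideal_ext (R S : comNzRingType) (f : R -> S) (J : R -> Prop) :
    S -> Prop :=
  ideal_gen (fun q => exists2 p, J p & q = f p).

(* The Hilbert scheme of d points on affine n-space over k, as a functor of
   points on commutative k-algebras.  The types comAlgType k contain the
   nonzero algebras only; this is harmless, since Hilb (0) is a single point
   and every condition below is trivial over the zero ring. *)

Section HilbertScheme.

Variables (k : fieldType) (n d : nat).

Definition hilb_point (A : comAlgType k) (J : {mpoly A[n]} -> Prop) : Prop :=
  is_ideal J /\
  exists (M : lmodType A) (pi : {linear {mpoly A[n]} -> M}),
    [/\ forall m, exists p, pi p = m,
        forall p, pi p = 0 <-> J p,
        finite_module M,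
        flat_module M
      & module_rank M d].

Definition base_change (A B : comAlgType k) (f : {lrmorphism A -> B})
    (J : {mpoly A[n]} -> Prop) : {mpoly B[n]} -> Prop :=
  ideal_ext (map_mpoly f) J.

(* Open subschemes of Hilb, as open subfunctors: for every A-point J, the
   preimage of U in Spec A is the complement of V(a) for some ideal a of A,
   i.e. a morphism Spec B -> Spec A sends J into U iff a B = B.  Stability of U
   under base change follows (take f to be the identity first). *)
Definition open_subfunctor
    (U : forall A : comAlgType k, ({mpoly A[n]} -> Prop) -> Prop) : Prop :=
  (forall (A : comAlgType k) (J : {mpoly A[n]} -> Prop),
     U A J -> hilb_point J) /\
  (forall (A : comAlgType k) (J : {mpoly A[n]} -> Prop), hilb_point J ->
     exists a : A -> Prop, is_ideal a /\
       forall (B : comAlgType k) (f : {lrmorphism A -> B})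
              (J' : {mpoly B[n]} -> Prop),
         same_set J' (base_change f J) -> (U B J' <-> ideal_ext f a 1)).

(* A regular function on U is a natural transformation from U to the affine
   line A |-> A.  It is encoded by a function defined on all predicates, whose
   values outside of U are irrelevant. *)
Definition regular_function
    (U : forall A : comAlgType k, ({mpoly A[n]} -> Prop) -> Prop)
    (s : forall A : comAlgType k, ({mpoly A[n]} -> Prop) -> A) : Prop :=
  forall (A B : comAlgType k) (f : {lrmorphism A -> B})
         (J : {mpoly A[n]} -> Prop) (J' : {mpoly B[n]} -> Prop),
    U A J -> same_set J' (base_change f J) -> s B J' = f (s A J).

Variable I : {mpoly k[n]} -> Prop.

Definition open_nbhd
    (U : forall A : comAlgType k, ({mpoly A[n]} -> Prop) -> Prop) : Prop :=
  open_subfunctor U /\ U k^o I.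

(* The local ring of Hilb at [I] is the stalk of the structure sheaf: its
   elements are germs at [I], represented by regular functions on open
   neighbourhoods of [I].  Two germs are identified when they agree on some
   smaller neighbourhood.  (All these germs do not form a small type, so they
   are not packaged as a comNzRingType.) *)
Record germ := Germ {
  germ_dom : forall A : comAlgType k, ({mpoly A[n]} -> Prop) -> Prop;
  germ_fun : forall A : comAlgType k, ({mpoly A[n]} -> Prop) -> A;
  germ_open : open_nbhd germ_dom;
  germ_regular : regular_function germ_dom germ_fun
}.

Lemma germ_exp_regular (g : germ) (m : nat) :
  regular_function (@germ_dom g) (fun A J => germ_fun g J ^+ m).
Proof.
move=> A B f J J' UJ eJ.
by rewrite (germ_regular UJ eJ) rmorphXn.
Qed.

Definition germ_exp (g : germ) (m : nat) : germ :=
  Germ (germ_open g) (@germ_exp_regular g m).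

Definition germ_eq0 (g : germ) : Prop :=
  exists W : forall A : comAlgType k, ({mpoly A[n]} -> Prop) -> Prop,
    open_nbhd W /\
    forall (A : comAlgType k) (J : {mpoly A[n]} -> Prop),
      W A J -> germ_dom g J /\ germ_fun g J = 0.

Definition local_ring_reduced : Prop :=
  forall (g : germ) (m : nat), germ_eq0 (germ_exp g m) -> germ_eq0 g.

Definition nonreduced_point : Prop :=
  @hilb_point k^o I /\ ~ local_ring_reduced.

End HilbertScheme.

(* alpha_i acts as d/dx_i: a monomial with exponents m acts as the iterated
   partial derivative mderivm m.  Both S and k[x_1, .., x_n] are {mpoly R[n]}. *)
Definition diff_act (R : comNzRingType) (n : nat) (f F : {mpoly R[n]}) :
    {mpoly R[n]} :=
  \sum_(m <- msupp f) f@_m *: mderivm m F.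

Definition apolar (R : comNzRingType) (n : nat) (F : {mpoly R[n]}) :
    {mpoly R[n]} -> Prop :=
  fun f => diff_act f F = 0.

Definition degree_ge (R : comNzRingType) (n r : nat) : {mpoly R[n]} -> Prop :=
  fun f => forall m, m \in msupp f -> (r <= mdeg m)%N.

Definition ideal_sum (R : comNzRingType) (J1 J2 : R -> Prop) : R -> Prop :=
  fun f => exists g h : R, [/\ J1 g, J2 h & f = g + h].

Definition cubicF (R : comNzRingType) : {mpoly R[6]} :=
  let x (i : nat) : {mpoly R[6]} := 'X_(inord i.-1) in
  x 1%N * x 2%N * x 4%N - x 1%N * x 5%N ^+ 2 + x 2%N * x 3%N ^+ 2
  + x 3%N * x 5%N * x 6%N + x 4%N * x 6%N ^+ 2.

Definition idealI (R : comNzRingType) : {mpoly R[6]} -> Prop :=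
  ideal_sum (apolar (cubicF R)) (@degree_ge R 6 3).

(* Main.v *)
From Stdlib Require Import ZArith QArith_base Qreduction.
From HB Require Import structures.
Require Import Defs.
From mathcomp Require Import all_boot all_order all_algebra.
From mathcomp Require Import ssrZ ring.
From mathcomp Require Import generic_quotient ring_quotient fraction boolp.
From mathcomp.multinomials Require Import ssrcomplements.
From mathcomp Require classical_sets.

Set Implicit Arguments.
Unset Strict Implicit.
Unset Printing Implicit Defensive.

Import GRing.Theory.
Local Close Scope Q_scope.
Local Open Scope ring_scope.

(** Number the variables x_0, .., x_5, and let q_0, .., q_5 be the products of
two variables such that q_l, acting on the cubic F, yields x_l.  The chart is
the functor of the ideals J over a k-algebra A such that 1, the x_i and the q_l
form a basis of A[x] / J.  It is an open neighbourhood of [I] (chart_open).  A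
function G on the chart shows that [I] is non-reduced as soon as a power of G
vanishes on some neighbourhood of [I], while G does not vanish at a point J over
the dual numbers that specialises to I: an open neighbourhood of [I] contains J,
hence G is not zero near [I] (nonreduced_criterion).

The functions are the entries of the multiplication matrices of the x_i.  They
are normalised first: a translation makes all traces zero, and the basis is
replaced by the corresponding monomials in the translated variables.  (Without
this, translating a subscheme would move entries freely, and these entries are
not nilpotent.)  Give the basis the degrees 0, 1, 2, and the entry (a, b) of a
matrix the weight deg a + 1 - deg b.  As I is homogeneous, the entries of
positive weight belong to the ideal m of the functions that vanish at [I],
and those of weight zero have known values there.  Let L1 be the ideal generated
by the entries of weight 1, L2 = L1 L1 + (entries of weight 2),
L3 = L1 L2 + (entries of weight 3) and L4 = L1 L3.  In a commutation relation
of weight w, every product that involves an entry of weight zero becomes,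
modulo m L_w, a constant multiple of an entry of weight w; so the relations are
linear equations with rational coefficients between the generators of L_w.
Solving them shows that six entries t_j generate L1 modulo m L1, that six
entries v_l generate L2 modulo m L2, and that one entry c generates L3 modulo
m L3.  Now t_j v_l is a rational multiple of c modulo m L3, and
t_i (t_j v_l) = t_j (t_i v_l) becomes a linear equation between the t_j c, with
the only solution t_j c = 0 modulo m L4.  Hence L4 = m L4, and the lemma of
Nakayama yields h with h([I]) = 1 and h L4 = 0; in particular h g^4 = 0 for
every entry g of weight 1 (weight1_nilpotent).  The equations are solved by
computation (solved_checks), with an elimination that is proved sound modulo
any subspace (solve_sound).

The point over the dual numbers has the same multiplication table as I, except
that x_i q_i = eps q_0 for each i.  Its matrices commute, because the product
x_i x_j x_l becomes eps T_ijl q_0, where T_ijl is the third derivative of F,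
which is symmetric.  The entry of x_2 at (q_2, q_0) has weight 1, and after
normalisation it equals eps (deformed_entry).  That I itself has the
undeformed table follows from the action on F: modulo constants, p |-> p . F
identifies S / I with the span of F, its first derivatives and the variables
(idealI_model). *)

(** * Linear maps and quotient modules *)

Lemma linear_of (A : comNzRingType) (M N : lmodType A) (f : M -> N) :
  linear f -> exists g : {linear M -> N}, g =1 f.
Proof.
move=> lf.
pose L := GRing.isLinear.Build A M N *:%R f lf.
pose F : {linear M -> N} := HB.pack f L.
by exists F.
Qed.

Lemma bilinear_of (A : comNzRingType) (M N P : lmodType A) (f : M -> N -> P) :
  (forall y, linear (f^~ y)) -> (forall x, linear (f x)) ->
  exists g : {bilinear M -> N -> P}, forall x y, g x y = f x y.
Proof.
move=> lf lf'.
pose L := @bilinear_isBilinear.Build A M N P *:%R *:%R f (lf, lf').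
pose F : {bilinear M -> N -> P} := HB.pack f L.
by exists F.
Qed.

(** Quotients by subsets with values in Prop are obtained from the boolean ones
by deciding membership classically. *)
Section QuotientModule.

Variables (A : comNzRingType) (V : lmodType A) (P : V -> Prop).
Hypotheses (P0 : P 0) (PL : forall a u v, P u -> P v -> P (a *: u + v)).

Let S : {pred V} := fun v => `[< P v >].

Let S_closed : submod_closed S.
Proof.
split; first exact/asboolP.
by move=> a u v /asboolP Pu /asboolP Pv; apply/asboolP/PL.
Qed.

HB.instance Definition _ := GRing.isSubmodClosed.Build A V S S_closed.

Local Notation Q := (Quotient.quot S).
Local Open Scope quotient_scope.

Let qscale (a : A) (x : Q) : Q := \pi_Q (a *: repr x).

Let qscale_pi a v : qscale a (\pi_Q v) = \pi_Q (a *: v).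
Proof.
apply/eqP; rewrite -Quotient.idealrBE -scalerBr.
by apply: rpredZ; rewrite Quotient.idealrBE reprK.
Qed.

Let qscaleA a b x : qscale a (qscale b x) = qscale (a * b) x.
Proof.
by elim/quotW: x => v; rewrite [qscale b _]qscale_pi !qscale_pi scalerA.
Qed.

Let qscale1 : left_id 1 qscale.
Proof. by elim/quotW=> v; rewrite qscale_pi scale1r. Qed.

Let qscaleDr : right_distributive qscale +%R.
Proof.
move=> a; elim/quotW=> u; elim/quotW=> v.
by rewrite -raddfD !qscale_pi scalerDr raddfD.
Qed.

Let qscaleDl x : {morph qscale^~ x : a b / a + b}.
Proof.
by elim/quotW: x => v a b; rewrite /= !qscale_pi scalerDl raddfD.
Qed.

HB.instance Definition _ :=
  GRing.Zmodule_isLmodule.Build A Q qscaleA qscale1 qscaleDr qscaleDl.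

Lemma quotient_module :
  exists (W : lmodType A) (p : {linear V -> W}),
    (forall w, exists v, p v = w) /\ forall v, p v = 0 <-> P v.
Proof.
have pL : linear (\pi_Q : V -> Q).
  by move=> a u v; rewrite raddfD /= -qscale_pi.
have [p pE] := linear_of pL.
exists Q, p; split=> [w|v]; first by exists (repr w); rewrite pE reprK.
have -> : p v = 0 <-> (v - 0 \in S).
  by rewrite Quotient.idealrBE pE -[0 in X in X <-> _](raddf0 \pi_Q); split=> /eqP.
by rewrite subr0; split=> [/asboolP|?]; last exact/asboolP.
Qed.

End QuotientModule.

(** * The equational criterion of flatness *)

(** The vector a defines a linear form on A^r, which induces an injective map u
on the quotient N' of A^r by its kernel.  The tensor of the m_i with the basis
vectors of N' is sent by u to the sum of the a_i m_i, tensored with 1, which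
is 0; by flatness, the tensor is 0.  It is tested against the bilinear map
with values in M^r / S, where S consists of the families of the desired
form. *)
Lemma flat_relation (A : comNzRingType) (M : lmodType A) (r : nat)
    (a : 'rV[A]_r) (m : 'I_r -> M) :
  flat_module M -> \sum_i a 0 i *: m i = 0 ->
  exists s : seq ('rV[A]_r * M),
    (forall x, x \in s -> \sum_i a 0 i * x.1 0 i = 0) /\
    forall i, m i = \sum_(x <- s) x.1 0 i *: x.2.
Proof.
move=> flatM rel.
pose lin (b : 'rV[A]_r) : A^o := \sum_i a 0 i * b 0 i.
have lin_lin : linear lin.
  move=> c u v; rewrite /lin scaler_sumr -big_split; apply: eq_bigr => i _.
  by rewrite !mxE mulrDr; congr (_ + _); rewrite mulrCA.
pose V : lmodType A := {ffun 'I_r -> M}.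
pose S (f : V) := exists s : seq ('rV[A]_r * M),
  (forall x, x \in s -> lin x.1 = 0) /\
  forall i, f i = \sum_(x <- s) x.1 0 i *: x.2.
have [||N' [p [p_onto p0]]] :=
  @quotient_module A 'rV[A]_r (fun b => lin b = 0).
- by rewrite /lin big1 // => i _; rewrite mxE mulr0.
- by move=> c u v lu lv; rewrite lin_lin lu lv scaler0 addr0.
have [||P [q [q_onto q0]]] := @quotient_module A V S.
- by exists [::]; split=> // i; rewrite big_nil ffunE.
- move=> c f g [s [s0 sE]] [t [t0 tE]].
  exists ([seq (x.1, c *: x.2) | x <- s] ++ t); split=> [x|i].
    by rewrite mem_cat => /orP[/mapP[y /s0 ? ->]|/t0].
  rewrite !ffunE sE tE big_cat big_map scaler_sumr; congr (_ + _).
  by apply: eq_bigr => x _; rewrite /= !scalerA mulrC.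
have eq_p b b' : p b = p b' -> lin b = lin b'.
  move=> /eqP; rewrite -subr_eq0 -raddfB => /eqP /p0.
  rewrite -[b - b']addrC -scaleN1r lin_lin scaleN1r addrC => /eqP.
  by rewrite subr_eq0 => /eqP.
pose sec w := sval (cid (p_onto w)).
have secK w : p (sec w) = w by rewrite /sec; case: cid.
have [|u uE] := @linear_of A N' A^o (fun w => lin (sec w)).
  by move=> c v w; rewrite -lin_lin; apply: eq_p; rewrite linearP !secK.
have u_inj : injective u.
  move=> v w; rewrite !uE => e; apply/eqP; rewrite -subr_eq0 -(secK v) -(secK w).
  rewrite -raddfB; apply/eqP/p0; rewrite -[_ - _]addrC -scaleN1r lin_lin e.
  by rewrite scaleN1r addNr.
pose ten (y : M) (b : 'rV[A]_r) : V := [ffun i => b 0 i *: y].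
have tenL y : linear (ten y).
  by move=> c b b'; apply/ffunP=> i; rewrite !ffunE !mxE scalerDl scalerA.
have eq_ten y b b' : p b = p b' -> q (ten y b) = q (ten y b').
  move=> e; apply/eqP; rewrite -subr_eq0 -raddfB; apply/eqP/q0.
  exists [:: (b - b', y)]; split=> [x|i].
    rewrite inE => /eqP->/=; have := eq_p _ _ e.
    rewrite -[b - b']addrC -scaleN1r lin_lin scaleN1r => ->; exact: addNr.
  by rewrite big_seq1 !ffunE !mxE scalerBl.
have [||phi phiE] := @bilinear_of A M N' P (fun y w => q (ten y (sec w))).
- move=> w c y z; rewrite -linearP; congr (q _); apply/ffunP=> i.
  by rewrite !ffunE scalerDr !scalerA mulrC.
- move=> y c v w; rewrite -linearP -tenL.
  by apply: eq_ten; rewrite linearP !secK.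
pose t := [seq (m i, p (delta_mx 0 i)) | i <- index_enum (ordinal r)].
have lin_delta i : lin (delta_mx 0 i) = a 0 i.
  rewrite /lin (bigD1 i) //= mxE !eqxx mulr1 big1 ?addr0 // => j ji.
  by rewrite mxE (negbTE ji) andbF mulr0.
have := flatM _ _ u u_inj t _ P phi.
have t_eq0 : tensor_eq0 [seq (x.1, u x.2) | x <- t].
  move=> P' psi; rewrite !big_map /=.
  have psiE y c : psi y c = psi (c *: y) (1 : A^o).
    by rewrite linearZl_LR -linearZr_LR /= /GRing.scale /= mulr1.
  under eq_bigr => i _ do rewrite uE (eq_p _ _ (secK _)) lin_delta psiE.
  have -> : \sum_i psi (a 0 i *: m i) (1 : A^o) =
            psi (\sum_i a 0 i *: m i) 1 by rewrite linear_sumlz.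
  by rewrite rel linear0l.
move=> /(_ t_eq0); rewrite big_map /= => t0.
have /q0 [s [s0 sE]] : q [ffun i => m i] = 0.
  rewrite -t0; transitivity (q (\sum_i ten (m i) (delta_mx 0 i))).
    congr (q _); apply/ffunP=> i; rewrite sum_ffunE ffunE (bigD1 i) //=.
    rewrite ffunE mxE !eqxx scale1r big1 ?addr0 // => j ji.
    by rewrite ffunE mxE eq_sym (negbTE ji) andbF scale0r.
  rewrite linear_sum; apply: eq_bigr => i _.
  by rewrite phiE; apply: eq_ten; rewrite secK.
by exists s; split=> // i; rewrite -sE ffunE.
Qed.

(** * Residue fields at primes avoiding an element *)

Local Open Scope quotient_scope.

Lemma fractionE (D : idomainType) (z : {fraction D}) :
  z = FracField.tofrac (frac (repr z)).1 / FracField.tofrac (frac (repr z)).2.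
Proof.
set x := repr z; have -> : z = \pi_({fraction D}) x by rewrite reprK.
unlock FracField.tofrac.
rewrite -[X in _ * X]FracField.pi_inv -[RHS]FracField.pi_mul.
congr (\pi _); case: x => -[n d] /= d0.
rewrite /FracField.mulf /FracField.invf !numden_Ratio ?oner_neq0 //.
by rewrite mulr1 mul1r /Ratio /insubd insubT.
Qed.

Section PrimeQuotient.

Variables (A : comNzRingType) (P : A -> Prop).
Hypotheses (idealP : is_ideal P) (P1 : ~ P 1).
Hypothesis primeP : forall u v, P (u * v) -> P u \/ P v.

Let S : {pred A} := fun v => `[< P v >].

Let S_idealr : idealr_closed S.
Proof.
have [P0 PD PM] := idealP; split; first exact/asboolP.
  by apply/negP => /asboolP.
by move=> a u v /asboolP Pu /asboolP Pv; apply/asboolP/PD/Pv/PM.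
Qed.

Let S_prime : prime_idealr_closed S.
Proof.
by move=> u v /asboolP/primeP[] ?; apply/orP; [left | right]; apply/asboolP.
Qed.

HB.instance Definition _ := isIdealr.Build A S S_idealr.
HB.instance Definition _ := isPrimeIdealrClosed.Build A S S_prime.

Local Notation D := (Quotient.quot S).

(* Integral domains of the hierarchy come with an inversion, which is chosen
   here among the inverses of each invertible element. *)
Let D_unit : {pred D} := fun x => `[< exists y, y * x = 1 >].
Let D_inv (x : D) : D :=
  if pselect (exists y, y * x = 1) is left e then sval (cid e) else x.

Let D_mulVr : {in D_unit, left_inverse 1 D_inv *%R}.
Proof.
by move=> x /asboolP e; rewrite /D_inv; case: pselect => // e'; case: cid.
Qed.

Let D_unitPl : forall x y : D, y * x = 1 -> D_unit x.
Proof. by move=> x y e; apply/asboolP; exists y. Qed.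

Let D_inv_out : {in [predC D_unit], D_inv =1 id}.
Proof.
by move=> x /asboolP e; rewrite /D_inv; case: pselect.
Qed.

HB.instance Definition _ :=
  GRing.ComNzRing_hasMulInverse.Build D D_mulVr D_unitPl D_inv_out.
HB.instance Definition _ :=
  GRing.ComUnitRing_isIntegral.Build D (@Quotient.rquot_IdomainAxiom A S).

Lemma prime_residue_field :
  exists (K : fieldType) (chi : {rmorphism A -> K}),
    residue_map chi /\ forall y, chi y = 0 <-> P y.
Proof.
pose f (y : A) : {fraction D} :=
  FracField.tofrac (\pi_D y).
have f_add : zmod_morphism f by move=> x y; rewrite /f !rmorphB.
have f_mul : monoid_morphism f.
  by split=> [|x y]; rewrite /f ?rmorph1 ?rmorphM.
pose FA := GRing.isZmodMorphism.Build A {fraction D} f f_add.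
pose FM := GRing.isMonoidMorphism.Build A {fraction D} f f_mul.
pose chi : {rmorphism A -> {fraction D}} := HB.pack f FA FM.
have chi0 y : chi y = 0 <-> P y.
  have -> : chi y = 0 <-> y - 0 \in (S : pred A).
    rewrite Quotient.idealrBE /= /f; split=> [/eqP|/eqP e].
      by rewrite tofrac_eq0 -(rmorph0 \pi_D).
    by rewrite e rmorph0 tofrac0.
  by rewrite subr0; split=> [/asboolP|?]; last exact/asboolP.
exists {fraction D}, chi; split=> // z.
exists (repr (frac (repr z)).1), (repr (frac (repr z)).2).
rewrite /= /f !reprK; split; first by rewrite tofrac_eq0; case: (repr z).
by rewrite -fractionE.
Qed.

End PrimeQuotient.

(** An ideal that is maximal among those that contain a and no power of x is
prime. *)
Lemma prime_avoiding (A : comNzRingType) (a : A -> Prop) (x : A) :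
  is_ideal a -> (forall N, ~ a (x ^+ N)) ->
  exists (K : fieldType) (chi : {rmorphism A -> K}),
    [/\ residue_map chi, forall y, a y -> chi y = 0 & chi x != 0].
Proof.
move=> ida ax.
pose good (P : A -> Prop) :=
  [/\ is_ideal P, forall y, a y -> P y & forall N, ~ P (x ^+ N)].
pose T := {P : A -> Prop | good P}.
pose R : rel T := fun P Q => `[< forall y, sval P y -> sval Q y >].
have Rrefl P : R P P by apply/asboolP.
have Rtrans P Q O : R P Q -> R Q O -> R P O.
  by move=> /asboolP PQ /asboolP QO; apply/asboolP => y /PQ/QO.
have good_a : good a by [].
have Rchain (C : classical_sets.set T) : classical_sets.total_on C R ->
    exists t, forall s, C s -> R s t.
  move=> totC; have [[c0 Cc0]|C0] := pselect (exists c, C c); last first.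
    by exists (exist _ a good_a) => s Cs; case: C0; exists s.
  pose U y := exists2 c, C c & sval c y.
  have goodU : good U.
    split.
    - split.
      + by exists c0 => //; case: (svalP c0) => -[].
      + move=> p q [c Cc cp] [d Cd dq].
        have [/asboolP cd|/asboolP dc] := totC c d Cc Cd.
          by exists d => //; case: (svalP d) => -[_ D _] _ _; apply: D; auto.
        by exists c => //; case: (svalP c) => -[_ D _] _ _; apply: D; auto.
      + move=> c p [d Cd dp]; exists d => //.
        by case: (svalP d) => -[_ _ M] _ _; apply: M.
    - by move=> y ay; exists c0 => //; case: (svalP c0) => _ + _; apply.
    - by move=> N [c _]; case: (svalP c) => _ _; apply.
  by exists (exist _ U goodU) => s Cs; apply/asboolP => y sy; exists s.
have [[P goodP] maxP] :=
  @classical_sets.ZL_preorder T (exist _ a good_a) R Rrefl Rtrans Rchain.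
have [idP aP xP] := goodP; have [P0 PD PM] := idP.
have enlarge u : ~ P u -> exists N p c, P p /\ x ^+ N = p + c * u.
  move=> Pu; pose Q y := exists p c, P p /\ y = p + c * u.
  have [//|nQ] := pselect (exists N, Q (x ^+ N)); case: Pu.
  have goodQ : good Q.
    split.
    - split; first by exists 0, 0; split=> //; rewrite mul0r addr0.
      + move=> y z [p [c [Pp ->]]] [q [d [Pq ->]]].
        by exists (p + q), (c + d); split; [exact: PD | rewrite mulrDl addrACA].
      + move=> d y [p [c [Pp ->]]].
        by exists (d * p), (d * c); split; [exact: PM | rewrite mulrDr mulrA].
    - by move=> y /aP Py; exists y, 0; split=> //; rewrite mul0r addr0.
    - by move=> N QN; apply: nQ; exists N.
  have /asboolP/= : R (exist _ Q goodQ) (exist _ P goodP).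
    apply: maxP; apply/asboolP => y /= Py; exists y, 0; split=> //.
    by rewrite mul0r addr0.
  by apply; exists 0, 1; split=> //; rewrite mul1r add0r.
have primeP u v : P (u * v) -> P u \/ P v.
  move=> Puv; have [|nu] := pselect (P u); first by left.
  have [|nv] := pselect (P v); first by right.
  have [N [p [c [Pp eN]]]] := enlarge u nu.
  have [M [q [d [Pq eM]]]] := enlarge v nv.
  case: (xP (N + M)); rewrite exprD eN eM mulrDl.
  apply/PD; first by rewrite mulrC; apply/PM.
  by rewrite mulrDr; apply/PD; [apply/PM | rewrite mulrACA; apply/PM].
have [|K [chi [res chi0]]] := prime_residue_field idP _ primeP.
  by move: (xP 0%N); rewrite expr0.
exists K, chi; split=> // [y /aP/chi0 //|].
by apply/eqP => /chi0; move: (xP 1%N); rewrite expr1.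
Qed.

(** * Ideals *)

Section Ideals.

Variables (R : comNzRingType) (J : R -> Prop).
Hypothesis idJ : is_ideal J.

Lemma ideal0 : J 0. Proof. by case: idJ. Qed.

Lemma idealD p q : J p -> J q -> J (p + q).
Proof. by case: idJ => _ + _; apply. Qed.

Lemma idealM c p : J p -> J (c * p).
Proof. by case: idJ => _ _; apply. Qed.

Lemma idealMl c p : J p -> J (p * c).
Proof. by move=> Jp; rewrite mulrC; apply: idealM. Qed.

Lemma idealN p : J p -> J (- p).
Proof. by rewrite -mulN1r; apply: idealM. Qed.

Lemma idealB p q : J p -> J q -> J (p - q).
Proof. by move=> Jp /idealN; apply: idealD. Qed.

Lemma ideal_sumr (T : Type) (s : seq T) (P : pred T) (F : T -> R) :
  (forall i, P i -> J (F i)) -> J (\sum_(i <- s | P i) F i).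
Proof. by move=> JF; elim/big_ind: _ => //; [exact: ideal0 | exact: idealD]. Qed.

Lemma ideal_sumr_seq (T : eqType) (s : seq T) (F : T -> R) :
  (forall i, i \in s -> J (F i)) -> J (\sum_(i <- s) F i).
Proof.
move=> JF; rewrite big_seq_cond; apply: ideal_sumr => i; rewrite andbT.
exact: JF.
Qed.

Lemma ideal_sub_trans p q : J (p - q) -> J q -> J p.
Proof. by move=> Jpq Jq; rewrite -(subrK q p); apply: idealD. Qed.

(** An ideal contains 1 as soon as it contains powers of elements that generate the
unit ideal; this glues what holds after the inversion of each of them. *)
Lemma ideal_radical : is_ideal (fun y => exists N, J (y ^+ N)).
Proof.
split; first by exists 1%N; rewrite expr0n; apply: ideal0.
  move=> y z [N JN] [M JM]; exists (N + M)%N; rewrite exprDn.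
  apply: ideal_sumr => i _; rewrite -mulr_natl; apply: idealM.
  have [leMi|ltiM] := leqP M i.
    by rewrite -(subnK leMi) exprD; do 2!apply: idealM.
  apply: idealMl; have leN : (N <= N + M - i)%N.
    by rewrite -addnBA ?leq_addr // ltnW.
  by rewrite -(subnK leN) exprD; apply: idealM.
move=> c y [N JN]; exists N; rewrite exprMn; exact: idealM.
Qed.

End Ideals.

Lemma ideal_gen_ideal (R : comNzRingType) (G : R -> Prop) :
  is_ideal (ideal_gen G).
Proof.
split; first by exists [::]; split=> //; rewrite big_nil.
  move=> p q [s [sG ->]] [t [tG ->]]; exists (s ++ t); rewrite big_cat.
  by split=> // x; rewrite mem_cat => /orP[/sG|/tG].
move=> c p [s [sG ->]]; exists [seq (c * x.1, x.2) | x <- s]; split.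
  by move=> x /mapP[y ys ->]; apply: sG ys.
by rewrite big_map mulr_sumr; apply: eq_bigr => x _; rewrite mulrA.
Qed.

Lemma ideal_gen_min (R : comNzRingType) (G J : R -> Prop) :
  is_ideal J -> (forall x, G x -> J x) -> forall x, ideal_gen G x -> J x.
Proof.
move=> idJ GJ x [s [sG ->]]; apply: ideal_sumr_seq => // i /sG/GJ.
exact: idealM.
Qed.

Lemma ideal_gen_sub (R : comNzRingType) (G : R -> Prop) x :
  G x -> ideal_gen G x.
Proof.
move=> Gx; exists [:: (1, x)]; split; last by rewrite big_seq1 mul1r.
by move=> y; rewrite inE => /eqP->.
Qed.

Lemma annihilator_ideal (R : comNzRingType) (b : R) :
  is_ideal (fun y => y * b = 0).
Proof.
split; first by rewrite mul0r.
  by move=> p q p0 q0; rewrite mulrDl p0 q0 addr0.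
by move=> c p p0; rewrite -mulrA p0 mulr0.
Qed.

(** * Linear maps out of a polynomial ring *)

Section LinearExtension.

Variables (n : nat) (B : comNzRingType) (W : lmodType B).
Variable v : 'X_{1..n} -> W.

Definition mlin (q : {mpoly B[n]}) : W := \sum_(m <- msupp q) q@_m *: v m.

Lemma mlinE q d : (msize q <= d)%N ->
  mlin q = \sum_(m : 'X_{1..n < d}) q@_m *: v m.
Proof.
move=> le_qd; set I : subFinType _ := 'X_{1..n < d}.
rewrite /mlin (big_mksub I) ?msupp_uniq //=; first last.
  by move=> x /msize_mdeg_lt /leq_trans; apply.
rewrite big_rmcond //= => j /memN_msupp_eq0 ->.
by rewrite scale0r.
Qed.

Lemma mlin_linear : linear mlin.
Proof.
move=> c p q; set d := maxn (msize (c *: p + q)) (maxn (msize p) (msize q)).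
rewrite (@mlinE (c *: p + q) d) ?leq_maxl //.
rewrite (@mlinE p d) ?(leq_trans (leq_maxl _ _) (leq_maxr _ _)) //.
rewrite (@mlinE q d) ?(leq_trans (leq_maxr _ _) (leq_maxr _ _)) //.
rewrite scaler_sumr -big_split; apply: eq_bigr => m _.
by rewrite mcoeffD mcoeffZ scalerDl scalerA.
Qed.

HB.instance Definition _ := GRing.isLinear.Build B {mpoly B[n]} W *:%R mlin
  mlin_linear.

Lemma mlinX m : mlin 'X_[m] = v m.
Proof. by rewrite /mlin msuppX big_seq1 mcoeffX eqxx scale1r. Qed.

End LinearExtension.

Lemma mpoly_ring_ind (n : nat) (A : comNzRingType) (V : {mpoly A[n]} -> Prop) :
  (forall c, V c%:MP) -> (forall i, V 'X_i) ->
  (forall p q, V p -> V q -> V (p + q)) ->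
  (forall p q, V p -> V q -> V (p * q)) -> forall p, V p.
Proof.
move=> VC VX VD VM p; rewrite [p]mpolyE.
elim/big_ind: _ => [||m _]; first by rewrite -mpolyC0; apply: VC.
  exact: VD.
rewrite -mul_mpolyC; apply/VM; first exact: VC.
rewrite mpolyXE_id; elim/big_ind: _ => [||t _]; first by rewrite -mpolyC1; apply: VC.
  exact: VM.
elim: (m t) => [|d IHd]; first by rewrite expr0 -mpolyC1; apply: VC.
by rewrite exprS; apply/VM.
Qed.

(** * The chart of a set of monomials *)

Section Charts.

Variables (k : fieldType) (n r : nat) (lam : 'I_r -> 'X_{1..n}).

Definition lcomb (A : comNzRingType) (c : 'rV[A]_r) : {mpoly A[n]} :=
  \sum_i c 0 i *: 'X_[lam i].

Lemma lcomb_linear (A : comNzRingType) : linear (@lcomb A).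
Proof.
move=> a c d; rewrite /lcomb scaler_sumr -big_split; apply: eq_bigr => i _.
by rewrite !mxE scalerDl scalerA.
Qed.

HB.instance Definition _ (A : comNzRingType) :=
  GRing.isLinear.Build A 'rV[A]_r {mpoly A[n]} *:%R (@lcomb A)
    (@lcomb_linear A).

Lemma lcomb_delta (A : comNzRingType) i :
  lcomb (delta_mx 0 i) = 'X_[lam i] :> {mpoly A[n]}.
Proof.
rewrite /lcomb (bigD1 i) //= mxE !eqxx scale1r big1 ?addr0 // => j ji.
by rewrite mxE (negbTE ji) andbF scale0r.
Qed.

Lemma map_lcomb (A B : comNzRingType) (f : {rmorphism A -> B}) c :
  map_mpoly f (lcomb c) = lcomb (map_mx f c).
Proof.
rewrite /lcomb rmorph_sum; apply: eq_bigr => i _.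
by rewrite /= map_mpolyZ map_mpolyX mxE.
Qed.

Definition lspan (A : comNzRingType) (J : {mpoly A[n]} -> Prop) p :=
  exists c : 'rV[A]_r, J (p - lcomb c).

Definition chart (A : comNzRingType) (J : {mpoly A[n]} -> Prop) :=
  [/\ is_ideal J, forall p, lspan J p
    & forall c : 'rV[A]_r, J (lcomb c) -> c = 0].

(** The default value 0 is only reached when J lies outside of the chart. *)
Definition lcoord (A : comNzRingType) (J : {mpoly A[n]} -> Prop) p : 'rV[A]_r :=
  if pselect (lspan J p) is left e then sval (cid e) else 0.

Section Coordinates.

Variables (A : comNzRingType) (J : {mpoly A[n]} -> Prop).
Hypothesis chartJ : chart J.

Lemma chart_ideal : is_ideal J. Proof. by case: chartJ. Qed.
Let idJ := chart_ideal.

Lemma lcoordP p : J (p - lcomb (lcoord J p)).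
Proof.
rewrite /lcoord; case: pselect => [e|[]]; first by case: cid.
by case: chartJ.
Qed.

Lemma lcoord_uniq p c : J (p - lcomb c) -> lcoord J p = c.
Proof.
move=> Jc; apply/eqP; rewrite -subr_eq0; apply/eqP.
case: chartJ => _ _; apply; rewrite raddfB /=.
have -> : lcomb (lcoord J p) - lcomb c =
          (p - lcomb c) - (p - lcomb (lcoord J p)).
  by rewrite opprB [RHS]addrC addrA subrK.
by apply: idealB => //; apply: lcoordP.
Qed.

Lemma lcoord_eq0 p : lcoord J p = 0 <-> J p.
Proof.
split=> [e|Jp]; first by have := lcoordP p; rewrite e raddf0 subr0.
by apply: lcoord_uniq; rewrite raddf0 subr0.
Qed.

Lemma lcoord_linear : linear (lcoord J).
Proof.
move=> a p q; apply: lcoord_uniq; rewrite linearP /= opprD addrACA -scalerBr.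
by rewrite -mul_mpolyC; apply: idealD => //; [apply: idealM => //|]; exact: lcoordP.
Qed.

Lemma lcoord_lcomb c : lcoord J (lcomb c) = c.
Proof. by apply: lcoord_uniq; rewrite subrr; apply: ideal0. Qed.

End Coordinates.

End Charts.

(** * Points of the Hilbert scheme in a chart *)

Section FreeModule.

Variables (A : comNzRingType) (r : nat).

Lemma free_finite : finite_module 'rV[A]_r.
Proof.
pose s := [seq (delta_mx 0 i : 'rV[A]_r) | i <- enum 'I_r].
have sz : size s = r by rewrite size_map size_enum_ord.
exists s => m; exists (fun i => m 0 (cast_ord sz i)).
rewrite {1}[m]row_sum_delta.
rewrite (reindex (cast_ord sz)) /=; last first.
  by exists (cast_ord (esym sz)) => i _; rewrite ?cast_ordK ?cast_ordKV.
apply: eq_bigr => i _; congr (_ *: _).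
have lir : (i < r)%N by rewrite -[X in (_ < X)%N]sz.
rewrite (nth_map (cast_ord sz i)) ?size_enum_ord //; congr (delta_mx 0 _).
by apply/val_inj; rewrite /= nth_enum_ord.
Qed.

(** A tensor in A^r (x) N amounts to r elements of N, and an injective map is
injective on each of them. *)
Lemma free_flat : flat_module 'rV[A]_r.
Proof.
move=> N' N u u_inj t t0 P phi.
have coef0 i : \sum_(x <- t) x.1 0 i *: x.2 = 0.
  apply: u_inj; rewrite linear_sum raddf0.
  have [||psi psiE] := @bilinear_of A 'rV[A]_r N N (fun m y => m 0 i *: y).
  - by move=> y c m m'; rewrite !mxE scalerDl scalerA.
  - by move=> m c y y'; rewrite scalerDr !scalerA mulrC.
  rewrite -[RHS](t0 N psi) big_map; apply: eq_bigr => x _.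
  by rewrite psiE linearZ.
transitivity (\sum_i phi (delta_mx 0 i) (\sum_(x <- t) x.1 0 i *: x.2)).
  under [RHS]eq_bigr => i _ do rewrite linear_sumr.
  rewrite exchange_big; apply: eq_bigr => x _ /=.
  rewrite {1}[x.1]row_sum_delta linear_sumlz; apply: eq_bigr => i _.
  by rewrite linearZl_LR linearZr_LR.
by rewrite big1 // => i _; rewrite coef0 linear0r.
Qed.

Lemma free_rank : module_rank 'rV[A]_r r.
Proof.
move=> K chi _.
pose f (m : 'rV[A]_r) : 'rV[K]_r := map_mx chi m.
have f_lin : linear_for (chi \; *:%R) f.
  by move=> c m m'; apply/rowP=> i; rewrite !mxE rmorphD rmorphM.
pose L := GRing.isLinear.Build A 'rV[A]_r 'rV[K]_r (chi \; *:%R) f f_lin.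
pose iota : {linear 'rV[A]_r -> 'rV[K]_r | chi \; *:%R} := HB.pack f L.
exists 'rV[K]_r, iota; split; last by rewrite dimvf /dim /= mul1n.
move=> W g.
have [|h hE] := @linear_of K 'rV[K]_r W (fun v => \sum_i v 0 i *: g (delta_mx 0 i)).
  move=> c v v'; rewrite scaler_sumr -big_split; apply: eq_bigr => i _.
  by rewrite !mxE scalerDl scalerA.
exists h; split=> [m|h' h'E v].
  rewrite hE {2}[m]row_sum_delta linear_sum; apply: eq_bigr => i _.
  by rewrite linearZ !mxE.
rewrite hE {1}[v]row_sum_delta linear_sum; apply: eq_bigr => i _.
rewrite linearZ -h'E; congr (_ *: h' _); apply/rowP=> j.
by rewrite !mxE rmorph_nat.
Qed.

End FreeModule.

Section Openness.

Variables (k : fieldType) (n r : nat) (lam : 'I_r -> 'X_{1..n}).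

(** The coordinates identify A[x] / J with A^r. *)
Lemma chart_hilb_point (A : comAlgType k) (J : {mpoly A[n]} -> Prop) :
  chart lam J -> @hilb_point k n r A J.
Proof.
move=> chJ; split; first exact: chart_ideal chJ.
have [pi piE] := linear_of (lcoord_linear chJ).
exists 'rV[A]_r, pi; split.
- by move=> c; exists (lcomb lam c); rewrite piE lcoord_lcomb.
- by move=> p; rewrite piE; exact: lcoord_eq0.
- exact: free_finite.
- exact: free_flat.
- exact: free_rank.
Qed.

Lemma base_changeP (A B : comNzRingType) (f : {rmorphism A -> B})
    (J : {mpoly A[n]} -> Prop) q : is_ideal J ->
  ideal_ext (map_mpoly f) J q <-> exists s : seq (B * {mpoly A[n]}),
    (forall x, x \in s -> J x.2) /\ q = \sum_(x <- s) x.1 *: map_mpoly f x.2.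
Proof.
move=> idJ; split=> [[s [sJ ->]]|[s [sJ ->]]]; last first.
  have idB := ideal_gen_ideal (fun q => exists2 p, J p & q = map_mpoly f p).
  apply: (ideal_sumr_seq idB) => x xs; rewrite -mul_mpolyC.
  by apply: idealM => //; apply: ideal_gen_sub; exists x.2; first exact: sJ.
elim: s sJ => [|x s IHs] sJ; first by exists [::]; rewrite !big_nil.
have [|t [tJ tE]] := IHs; first by move=> y ys; apply: sJ; rewrite inE ys orbT.
have [p Jp pE] := sJ x (mem_head _ _).
exists ([seq (x.1@_m, 'X_[m] * p) | m <- msupp x.1] ++ t); split.
  move=> y; rewrite mem_cat => /orP[/mapP[m _ ->]|/tJ //]; exact: idealM.
rewrite big_cons big_cat big_map -tE; congr (_ + _).
rewrite {1}[x.1]mpolyE mulr_suml pE; apply: eq_bigr => m _.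
by rewrite rmorphM /= map_mpolyX scalerAl.
Qed.

Section BaseChange.

Variables (A B : comNzRingType) (f : {rmorphism A -> B}).
Variables (J : {mpoly A[n]} -> Prop) (J' : {mpoly B[n]} -> Prop).
Hypothesis eJ' : same_set J' (ideal_ext (map_mpoly f) J).

Lemma base_change_sub p : J p -> J' (map_mpoly f p).
Proof. by move=> Jp; apply/eJ'/ideal_gen_sub; exists p. Qed.

Lemma base_change_ideal : is_ideal J'.
Proof.
have [B0 BD BM] := ideal_gen_ideal (fun q => exists2 p, J p & q = map_mpoly f p).
split; first exact/eJ'.
  by move=> p q /eJ' Jp /eJ' Jq; apply/eJ'/BD.
by move=> c p /eJ' Jp; apply/eJ'/BM.
Qed.

Lemma lspan_base_change : (forall m, lspan lam J' 'X_[m]) ->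
  forall p, lspan lam J' p.
Proof.
have idJ' := base_change_ideal.
move=> spX p; rewrite [p]mpolyE; elim/big_ind: _ => [|q q' [c Jc] [d Jd]|m _].
- by exists 0; rewrite raddf0 subr0; apply: ideal0.
- by exists (c + d); rewrite raddfD opprD addrACA; apply: idealD.
- have [c Jc] := spX m; exists (p@_m *: c).
  by rewrite linearZ -scalerBr -mul_mpolyC; apply: idealM.
Qed.

(** The monomials still span after the extension of scalars.  They remain
independent because the coordinate map of J extends to a B-linear map on B[x]
that kills the extended ideal and returns the coefficients of a combination of
the basis monomials. *)
Lemma chart_base_change : chart lam J -> chart lam J'.
Proof.
move=> chJ; have idJ := chart_ideal chJ; have idJ' := base_change_ideal.
split=> //.
  apply: lspan_base_change => m; exists (map_mx f (lcoord lam J 'X_[m])).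
  rewrite -map_lcomb -(map_mpolyX f m) -rmorphB; apply: base_change_sub.
  exact: lcoordP.
move=> c /eJ' /(base_changeP f _ idJ)[s [sJ e]].
pose v m := map_mx f (lcoord lam J 'X_[m]).
have gf p : mlin v (map_mpoly f p) = map_mx f (lcoord lam J p).
  have [h hE] := linear_of (lcoord_linear chJ).
  have -> : lcoord lam J p = \sum_(m <- msupp p) p@_m *: lcoord lam J 'X_[m].
    rewrite -hE {1}[p]mpolyE linear_sum; apply: eq_bigr => m _.
    by rewrite linearZ hE.
  rewrite {1}[p]mpolyE (raddf_sum (map_mpoly f)) (raddf_sum (mlin v)) raddf_sum /=.
  apply: eq_bigr => m _.
  by rewrite map_mpolyZ map_mpolyX linearZ /= mlinX map_mxZ.
have := congr1 (mlin v) e; rewrite /lcomb !linear_sum /=.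
rewrite [X in _ = X]big_seq [X in _ = X]big1 => [<-|x xs]; last first.
  rewrite linearZ /= gf (_ : lcoord lam J x.2 = 0) ?raddf0 ?scaler0 //.
  by apply/lcoord_eq0 => //; apply: sJ.
rewrite {1}[c]row_sum_delta; apply: eq_bigr => i _.
rewrite linearZ /= mlinX /v -lcomb_delta lcoord_lcomb //; congr (_ *: _).
by apply/rowP => j; rewrite !mxE rmorph_nat.
Qed.

Lemma lcoord_base_change p : chart lam J ->
  lcoord lam J' (map_mpoly f p) = map_mx f (lcoord lam J p).
Proof.
move=> chJ; apply: lcoord_uniq; first exact: chart_base_change.
rewrite -map_lcomb -rmorphB; apply: base_change_sub; exact: lcoordP.
Qed.

End BaseChange.

End Openness.

(** * Relations between generators of a flat module *)

Lemma generators_free (K : fieldType) (V : vectType K) (r : nat) (E : 'I_r -> V) :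
  (fullv <= <<[seq E i | i <- enum 'I_r]>>)%VS -> \dim {: V} = r ->
  forall c : 'I_r -> K, \sum_i c i *: E i = 0 -> forall i, c i = 0.
Proof.
move=> span dimV c rel.
pose X := [tuple E i | i < r].
have XE : X = [seq E i | i <- enum 'I_r] :> seq V by [].
have : basis_of {: V} X by rewrite basisEdim XE span dimV size_map size_enum_ord /=.
move=> /basis_free/freeP; apply; rewrite -[RHS]rel; apply: eq_bigr => i _.
by rewrite -tnth_nth tnth_mktuple.
Qed.

(** After the inversion of x, the module M of rank r is generated by r elements,
so that they should be independent; this is the form it takes without
localising.  If no power of x killed the coefficient c_i, some prime would
avoid x and contain the annihilator of c_i.  At its residue field, the e_j span
a space of dimension r, hence are independent.  The equational criterion
rewrites the relation c as x e = Mx e with c Mx = 0; by independence, Mx becomes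
the scalar x at the residue field.  But det Mx kills c_i, so that it vanishes
there, whereas x does not. *)
Lemma generators_independent (A : comNzRingType) (M : lmodType A) (r : nat)
    (e : 'I_r -> M) (x : A) :
  flat_module M -> module_rank M r ->
  (forall m, exists c : 'rV[A]_r, x *: m = \sum_i c 0 i *: e i) ->
  forall c : 'rV[A]_r, \sum_i c 0 i *: e i = 0 ->
  forall i, exists N, x ^+ N * c 0 i = 0.
Proof.
move=> flatM rankM gen c rel i0.
have [//|nil] := pselect (exists N, x ^+ N * c 0 i0 = 0); exfalso.
have [|K [chi [resK chi0 chix]]] :=
  @prime_avoiding A _ x (annihilator_ideal (c 0 i0)).
  by move=> N xN; apply: nil; exists N.
have [s [s0 sE]] := flat_relation flatM rel.
have [V [iota [univ dimV]]] := rankM K chi resK.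
pose d (m : M) : 'rV[A]_r := sval (cid (gen m)).
have dE m : x *: m = \sum_i d m 0 i *: e i by rewrite /d; case: cid.
pose E i := iota (e i).
have iotaE m : iota m = (chi x)^-1 *: \sum_i chi (d m 0 i) *: E i.
  have -> : \sum_i chi (d m 0 i) *: E i = chi x *: iota m.
    transitivity (iota (x *: m)); last by rewrite linearZ.
    by rewrite dE linear_sum; apply: eq_bigr => i _; rewrite linearZ.
  by rewrite scalerA mulVf // scale1r.
have span : (fullv <= <<[seq E i | i <- enum 'I_r]>>)%VS.
  set U := <<_>>%VS.
  have [h [hE huniq]] := univ V iota.
  have [|id' id'E] := @linear_of K V V id; first by move=> ? ? ?.
  have [|pr prE] := @linear_of K V V (projv U); first by move=> ? ? ?; rewrite linearP.
  have iotaU m : iota m \in U.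
    rewrite iotaE; apply/rpredZ/rpred_sum => i _; apply/rpredZ/memv_span.
    by apply/mapP; exists i; rewrite ?mem_enum.
  have id'h : id' =1 h by apply: huniq => m; rewrite id'E.
  have prh : pr =1 h by apply: huniq => m; rewrite prE projv_id.
  by apply/subvP => v _; rewrite -[v]id'E id'h -prh prE memv_proj.
have free := generators_free span dimV.
pose Mx : 'M[A]_r := \matrix_(i, j) \sum_(t <- s) t.1 0 i * d t.2 0 j.
have cMx : c *m Mx = 0.
  apply/rowP=> j; rewrite !mxE.
  under eq_bigr => i _ do rewrite mxE mulr_sumr.
  rewrite exchange_big big_seq big1 //= => t ts.
  under eq_bigr => i _ do rewrite mulrA.
  by rewrite -mulr_suml s0 // mul0r.
have chiMx : map_mx chi Mx = (chi x)%:M.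
  apply/matrixP=> i j; apply/eqP; rewrite -subr_eq0; apply/eqP.
  pose b l := map_mx chi Mx i l - (chi x)%:M i l.
  have : \sum_l b l *: E l = 0; last by move=> /free/(_ j).
  under eq_bigr => l _ do rewrite /b scalerBl !mxE.
  rewrite sumrB; apply/eqP; rewrite subr_eq0; apply/eqP.
  transitivity (iota (x *: e i)); last first.
    rewrite linearZ (bigD1 i) //= eqxx big1 ?addr0 // => l li.
    by rewrite eq_sym (negbTE li) scale0r.
  rewrite sE scaler_sumr linear_sum.
  under eq_bigr => l _ do rewrite rmorph_sum scaler_suml.
  rewrite exchange_big; apply: eq_bigr => t _ /=.
  rewrite scalerA mulrC -scalerA dE scaler_sumr linear_sum.
  by apply: eq_bigr => l _; rewrite scalerA linearZ.
have detMx : \det Mx * c 0 i0 = 0.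
  have := congr1 (mulmx^~ (\adj Mx)) cMx.
  rewrite mul0mx -mulmxA mul_mx_adj mul_mx_scalar => /rowP/(_ i0).
  by rewrite !mxE.
have := chi0 _ detMx; rewrite -det_map_mx chiMx det_scalar => /eqP.
by rewrite expf_eq0 (negbTE chix) andbF.
Qed.

(** * Torsion vectors and determinants *)

Section Torsion.

Variables (B : comNzRingType) (y : B) (r : nat).

Definition torsion (w : 'rV[B]_r) := exists N, y ^+ N *: w = 0.

Lemma torsion0 : torsion 0. Proof. by exists 0%N; rewrite scaler0. Qed.

Lemma torsionD v w : torsion v -> torsion w -> torsion (v + w).
Proof.
move=> [N v0] [M w0]; exists (N + M)%N; rewrite scalerDr exprD.
by rewrite -[in X in _ + X]scalerA w0 mulrC -scalerA v0 !scaler0 addr0.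
Qed.

Lemma torsionZ b w : torsion w -> torsion (b *: w).
Proof. by move=> [N w0]; exists N; rewrite scalerA mulrC -scalerA w0 scaler0. Qed.

Lemma torsion_sum (T : eqType) (s : seq T) (F : T -> 'rV[B]_r) :
  (forall i, i \in s -> torsion (F i)) -> torsion (\sum_(i <- s) F i).
Proof.
move=> tF; rewrite big_seq; elim/big_ind: _ => //; first exact: torsion0.
exact: torsionD.
Qed.

Lemma torsion_coef (w : 'rV[B]_r) : (forall i, exists N, y ^+ N * w 0 i = 0) -> torsion w.
Proof.
move=> tw; rewrite [w]row_sum_delta; apply: torsion_sum => i _.
by have [N e] := tw i; exists N; rewrite scalerA e scale0r.
Qed.

End Torsion.

Lemma torsion_map (A B : comNzRingType) (f : {rmorphism A -> B}) (x : A) r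
    (w : 'rV[A]_r) : torsion x w -> torsion (f x) (map_mx f w).
Proof. by move=> [N w0]; exists N; rewrite -rmorphXn -map_mxZ w0 raddf0. Qed.

Section DeterminantRows.

Variables (A B : comNzRingType) (f : {rmorphism A -> B}) (q : nat).
Variables (K : 'rV[A]_q -> Prop) (E : B -> Prop).
Hypothesis idE : is_ideal E.
Hypothesis detK : forall V : 'M[A]_q, (forall i, K (row i V)) -> E (f (\det V)).

Definition row_span (w : 'rV[B]_q) := exists s : seq (B * 'rV[A]_q),
  (forall x, x \in s -> K x.2) /\ w = \sum_(x <- s) x.1 *: map_mx f x.2.

Lemma row_spanD v w : row_span v -> row_span w -> row_span (v + w).
Proof.
move=> [s [sK ->]] [t [tK ->]]; exists (s ++ t); rewrite big_cat.
by split=> // x; rewrite mem_cat => /orP[/sK|/tK].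
Qed.

Lemma row_spanZ b v : row_span v -> row_span (b *: v).
Proof.
move=> [s [sK ->]]; exists [seq (b * x.1, x.2) | x <- s]; split.
  by move=> x /mapP[y ys ->]; apply: sK ys.
by rewrite big_map scaler_sumr; apply: eq_bigr => x _; rewrite scalerA.
Qed.

Lemma row_span_map v : K v -> row_span (map_mx f v).
Proof.
move=> Kv; exists [:: (1, v)]; rewrite big_seq1 scale1r; split=> // x.
by rewrite inE => /eqP->.
Qed.

Lemma row_span_sum (T : eqType) (s : seq T) (F : T -> 'rV[B]_q) :
  (forall i, i \in s -> row_span (F i)) -> row_span (\sum_(i <- s) F i).
Proof.
move=> sF; rewrite big_seq; elim/big_ind: _ => //; last exact: row_spanD.
by exists [::]; rewrite big_nil.
Qed.

Let upd (N : 'M[B]_q) l (w : 'rV[B]_q) : 'M[B]_q :=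
  \matrix_(i, j) if i == l then w 0 j else N i j.

Let det_upd N l w : \det (upd N l w) = \sum_j w 0 j * cofactor N l j.
Proof.
rewrite (expand_det_row _ l); apply: eq_bigr => j _; rewrite mxE eqxx.
congr (_ * (_ * \det _)); apply/matrixP=> i i'; rewrite !mxE.
by rewrite eq_sym (negbTE (neq_lift _ _)).
Qed.

(** The determinant is linear in each row: the rows are replaced one after the
other by images of vectors of K. *)
Lemma det_row_span (N : 'M[B]_q) : (forall i, row_span (row i N)) -> E (\det N).
Proof.
have main l : (l <= q)%N -> forall N : 'M[B]_q,
    (forall i : 'I_q, (i < l)%N -> row_span (row i N)) ->
    (forall i : 'I_q, (l <= i)%N -> exists2 v, K v & row i N = map_mx f v) ->
    E (\det N).
  elim: l => [_ M _ MK|l IHl ltlq M Ms MK].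
    pose v i := sval (cid2 (MK i (leq0n _))).
    pose V : 'M[A]_q := \matrix_(i, j) v i 0 j.
    have rV i : row i V = v i by apply/rowP=> j; rewrite !mxE.
    have -> : M = map_mx f V.
      apply/row_matrixP => i; rewrite -map_row rV /v.
      by case: cid2.
    rewrite det_map_mx; apply: detK => i; rewrite rV /v; by case: cid2.
  pose l0 := Ordinal ltlq.
  have [s [sK rowl]] := Ms l0 (ltnSn _).
  have -> : \det M = \sum_(x <- s) x.1 * \det (upd M l0 (map_mx f x.2)).
    rewrite (expand_det_row _ l0).
    under [RHS]eq_bigr => x _ do rewrite det_upd mulr_sumr.
    rewrite exchange_big; apply: eq_bigr => j _ /=.
    have -> : M l0 j = \sum_(x <- s) x.1 * map_mx f x.2 0 j.
      have /rowP/(_ j) := rowl; rewrite mxE summxE => ->.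
      by apply: eq_bigr => x _; rewrite mxE.
    by rewrite mulr_suml; apply: eq_bigr => x _; rewrite mulrA.
  apply: (ideal_sumr_seq idE) => x xs; apply: idealM => //.
  apply: IHl; first exact: ltnW.
    move=> i ltil; have -> : row i (upd M l0 (map_mx f x.2)) = row i M.
      apply/rowP=> j; rewrite !mxE; case: eqP => // eil.
      by rewrite eil ltnn in ltil.
    by apply: Ms; apply: ltnW.
  move=> i; rewrite leq_eqVlt => /orP[/eqP eli|ltli].
    exists x.2; first exact: sK.
    by apply/rowP=> j; rewrite !mxE -val_eqE /= -eli eqxx.
  have [v Kv rowi] := MK i ltli; exists v => //; rewrite -rowi.
  by apply/rowP=> j; rewrite !mxE -val_eqE /= eq_sym (ltn_eqF ltli).
move=> Ns; by apply: (main q) => // i; rewrite leqNgt ltn_ord.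
Qed.

End DeterminantRows.

(** * Openness of a chart *)

Section ChartLocus.

Variables (n r : nat) (lam : 'I_r -> 'X_{1..n}).

Lemma lspanD (A : comNzRingType) (J : {mpoly A[n]} -> Prop) p q : is_ideal J ->
  lspan lam J p -> lspan lam J q -> lspan lam J (p + q).
Proof.
move=> idJ [c Jc] [d Jd]; exists (c + d); rewrite raddfD opprD addrACA.
exact: idealD.
Qed.

Lemma lspanZ (A : comNzRingType) (J : {mpoly A[n]} -> Prop) a p : is_ideal J ->
  lspan lam J p -> lspan lam J (a *: p).
Proof.
move=> idJ [c Jc]; exists (a *: c).
by rewrite linearZ -scalerBr -mul_mpolyC; apply: idealM.
Qed.

Lemma lspan_ideal (A : comNzRingType) (J : {mpoly A[n]} -> Prop) p :
  J p -> lspan lam J p.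
Proof. by exists 0; rewrite raddf0 subr0. Qed.

Lemma lspan_mod (A : comNzRingType) (J : {mpoly A[n]} -> Prop) p q : is_ideal J ->
  J (p - q) -> lspan lam J q -> lspan lam J p.
Proof.
move=> idJ Jpq Jq; rewrite -(subrK q p).
by apply: lspanD => //; apply: lspan_ideal.
Qed.

Lemma lspan_sum (A : comNzRingType) (J : {mpoly A[n]} -> Prop) (T : eqType)
    (s : seq T) (F : T -> {mpoly A[n]}) : is_ideal J ->
  (forall i, i \in s -> lspan lam J (F i)) -> lspan lam J (\sum_(i <- s) F i).
Proof.
move=> idJ sF; rewrite big_seq; elim/big_ind: _ => //; last by move=> p q; apply: lspanD.
by apply: lspan_ideal; apply: ideal0.
Qed.

(** The annihilator of the cokernel of A^r -> A[x] / J.  The chart turns out to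
be the complement of its zero set: where the monomials generate, they form a
basis, because the rank is r. *)
Definition chart_locus (A : comNzRingType) (J : {mpoly A[n]} -> Prop) (x : A) :=
  forall p, lspan lam J (x *: p).

Lemma chart_locus_ideal (A : comNzRingType) (J : {mpoly A[n]} -> Prop) :
  is_ideal J -> is_ideal (chart_locus J).
Proof.
move=> idJ; split=> [p|x y Jx Jy p|c x Jx p].
- by rewrite scale0r; apply: lspan_ideal; apply: ideal0.
- by rewrite scalerDl; apply: lspanD.
- by rewrite -scalerA; apply: lspanZ.
Qed.

Section BaseChange.

Variables (A B : comNzRingType) (f : {rmorphism A -> B}).
Variables (J : {mpoly A[n]} -> Prop) (J' : {mpoly B[n]} -> Prop).
Hypothesis idJ : is_ideal J.
Hypothesis eJ' : same_set J' (ideal_ext (map_mpoly f) J).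

Let idJ' : is_ideal J' := base_change_ideal eJ'.

Lemma lspan_map p : lspan lam J p -> lspan lam J' (map_mpoly f p).
Proof.
move=> [c Jc]; exists (map_mx f c); rewrite -map_lcomb -rmorphB.
exact: (base_change_sub eJ').
Qed.

Section Flat.

Variables (M : lmodType A) (pi : {linear {mpoly A[n]} -> M}).
Hypothesis pi_onto : forall m, exists p, pi p = m.
Hypothesis pi_ker : forall p, pi p = 0 <-> J p.

Let pi_eq p q : pi p = pi q <-> J (p - q).
Proof.
split=> [e|/pi_ker]; first by apply/pi_ker; rewrite raddfB /= e subrr.
by rewrite raddfB => /eqP; rewrite subr_eq0 => /eqP.
Qed.

(** If 1 is a combination of the images of elements x of the locus, the monomials
generate.  For independence, let c be a relation over B; each multiple f x c is
a combination of images of relations over A, and such relations are x-torsion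
by generators_independent.  So c is killed by a power of each f x, hence by 1. *)
Lemma chart_of_locus : flat_module M -> module_rank M r ->
  ideal_ext f (chart_locus J) 1 -> chart lam J'.
Proof.
move=> flatM rankM locus1; split=> //.
  apply: (lspan_base_change eJ') => m; have [s [sL s1]] := locus1.
  rewrite -[X in lspan _ _ X]scale1r s1 scaler_suml; apply: lspan_sum => // x.
  move=> /sL[y Ly ->]; rewrite -scalerA; apply: lspanZ => //.
  have -> : f y *: 'X_[m] = map_mpoly f (y *: 'X_[m]).
    by rewrite map_mpolyZ map_mpolyX.
  exact: lspan_map (Ly _).
move=> c Jc.
have tors x : chart_locus J x -> torsion (f x) (f x *: c).
  move=> Lx; pose e i := pi 'X_[lam i].
  have e_sum (d : 'rV[A]_r) : \sum_i d 0 i *: e i = pi (lcomb lam d).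
    by rewrite /lcomb linear_sum; apply: eq_bigr => i _; rewrite linearZ.
  have tors_rel (d : 'rV[A]_r) : J (lcomb lam d) -> torsion x d.
    move=> /pi_ker; rewrite -e_sum => rel; apply: torsion_coef.
    apply: generators_independent flatM rankM _ _ rel => m.
    have [p <-] := pi_onto m; have [d' Jd'] := Lx p; exists d'.
    by rewrite e_sum -linearZ; apply/pi_eq.
  pose v m := sval (cid (Lx 'X_[m])).
  have Jv p : J (x *: p - lcomb lam (mlin v p)).
    rewrite {1}[p]mpolyE scaler_sumr /mlin.
    rewrite (raddf_sum (@lcomb _ _ lam A)) /= -sumrB.
    apply: ideal_sumr => // m _.
    rewrite [lcomb _ _]linearZ /= scalerA mulrC -scalerA -scalerBr -mul_mpolyC.
    by apply: idealM => //; rewrite /v; case: cid.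
  pose w m := map_mx f (v m).
  have wE p : mlin w (map_mpoly f p) = map_mx f (mlin v p).
    rewrite {1}[p]mpolyE (raddf_sum (map_mpoly f)) (raddf_sum (mlin w)).
    rewrite [in RHS]/mlin raddf_sum /=; apply: eq_bigr => m _.
    by rewrite map_mpolyZ map_mpolyX linearZ /= mlinX map_mxZ.
  have tw : torsion (f x) (mlin w (lcomb lam c)).
    have /eJ' /(base_changeP f _ idJ)[s [sJ ->]] := Jc.
    rewrite (raddf_sum (mlin w)); apply: torsion_sum => y ys.
    rewrite /= linearZ /= wE; apply/torsionZ/torsion_map/tors_rel.
    have Jy := sJ y ys; have := Jv y.2.
    move=> /(idealN idJ); rewrite opprB => /(ideal_sub_trans idJ); apply.
    by rewrite -mul_mpolyC; apply: idealM.
  have -> : f x *: c = mlin w (lcomb lam c) + \sum_i c 0 i *: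
                       map_mx f (x *: delta_mx 0 i - mlin v 'X_[lam i]).
    rewrite /lcomb (raddf_sum (mlin w)) -big_split {1}[c]row_sum_delta.
    rewrite scaler_sumr; apply: eq_bigr => i _.
    rewrite /= [mlin w _]linearZ /= -(map_mpolyX f) wE -scalerDr raddfB /= addrC subrK.
    rewrite map_mxZ scalerA mulrC -scalerA; congr (_ *: (_ *: _)).
    by apply/rowP=> j; rewrite !mxE rmorph_nat.
  apply: torsionD => //; apply: torsion_sum => i _.
  apply/torsionZ/torsion_map/tors_rel.
  by rewrite linearB linearZ /= lcomb_delta; apply: Jv.
apply/rowP=> i; rewrite mxE.
have idT := ideal_radical (annihilator_ideal (c 0 i)).
have : exists N, 1 ^+ N * c 0 i = 0.
  apply: ideal_gen_min idT _ _ locus1 => _ [x /tors[N eN] ->]; exists N.+1.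
  by have /rowP/(_ i) := eN; rewrite !mxE mulrA exprSr.
by move=> [N]; rewrite expr1n mul1r.
Qed.

(** Let q elements generate A[x] / J, and let K be the set of the combinations of
them that the monomials span.  As the monomials span over B, the images of K
span B^q, so that 1, the determinant of the identity, is a combination of
images of determinants of matrices with rows in K (det_row_span).  By Cramer's
rule, such determinants belong to the locus. *)
Lemma locus_of_chart : finite_module M -> chart lam J' ->
  ideal_ext f (chart_locus J) 1.
Proof.
move=> [s gen] chJ'; set q := size s in gen.
pose p (j : 'I_q) := sval (cid (pi_onto s`_j)).
have pE j : pi (p j) = s`_j by rewrite /p; case: cid.
pose psum (v : 'rV[A]_q) := \sum_j v 0 j *: p j.
have psumL : linear psum.
  move=> a v w; rewrite /psum scaler_sumr -big_split; apply: eq_bigr => j _.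
  by rewrite !mxE scalerDl scalerA.
have [ps psE] := linear_of psumL.
have gen' m : exists v, J ('X_[m] - ps v).
  have [c cE] := gen (pi 'X_[m]); exists (\row_j c j); apply/pi_eq.
  rewrite cE psE /psum linear_sum; apply: eq_bigr => j _.
  by rewrite linearZ /= pE mxE.
pose v0 m := sval (cid (gen' m)); pose D := mlin v0.
have JD g : J (g - ps (D g)).
  rewrite {1}[g]mpolyE /D /mlin linear_sum -sumrB; apply: ideal_sumr => // m _.
  rewrite [ps _]linearZ -scalerBr -mul_mpolyC; apply: idealM => //.
  by rewrite /v0; case: cid.
pose K (v : 'rV[A]_q) := lspan lam J (ps v).
have KD g : lspan lam J g -> K (D g).
  apply: lspan_mod => //; rewrite -opprB; apply: idealN => //; exact: JD.
have idE := ideal_gen_ideal (fun y => exists2 x, chart_locus J x & y = f x).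
have spanK (w : 'rV[B]_q) : row_span f K w.
  have ps_delta j : ps (delta_mx 0 j) = p j.
    rewrite psE /psum (bigD1 j) //= mxE !eqxx scale1r big1 ?addr0 // => i ij.
    by rewrite mxE (negbTE ij) andbF scale0r.
  rewrite [w]row_sum_delta; apply: row_span_sum => j _; apply: row_spanZ.
  have -> : delta_mx 0 j = map_mx f (D (p j)) + map_mx f (delta_mx 0 j - D (p j)).
    rewrite -raddfD addrC subrK; apply/rowP=> i.
    by rewrite /= !mxE rmorph_nat.
  apply: row_spanD; last first.
    apply: row_span_map; apply: lspan_ideal; rewrite linearB /= ps_delta.
    exact: JD.
  pose v m := map_mx f (v0 m).
  have vE g : mlin v (map_mpoly f g) = map_mx f (D g).
    rewrite {1}[g]mpolyE (raddf_sum (map_mpoly f)) (raddf_sum (mlin v)).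
    rewrite /D [in RHS]/mlin raddf_sum /=; apply: eq_bigr => m _.
    by rewrite map_mpolyZ map_mpolyX linearZ /= mlinX map_mxZ.
  have [_ /(_ (map_mpoly f (p j)))[c Jc] _] := chJ'.
  rewrite -vE -[map_mpoly f (p j)](subrK (lcomb lam c)) raddfD /=.
  apply: row_spanD.
    have /eJ' /(base_changeP f _ idJ)[t [tJ ->]] := Jc.
    rewrite (raddf_sum (mlin v)); apply: row_span_sum => y yt /=.
    rewrite linearZ /= vE; apply/row_spanZ/row_span_map/KD/lspan_ideal.
    exact: tJ.
  rewrite /lcomb (raddf_sum (mlin v)); apply: row_span_sum => i _ /=.
  rewrite linearZ /= -(map_mpolyX f) vE; apply/row_spanZ/row_span_map/KD.
  by exists (delta_mx 0 i); rewrite lcomb_delta subrr; apply: ideal0.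
rewrite -(det1 B q); apply: (det_row_span idE (K := K)) => // V KV.
apply: ideal_gen_sub; exists (\det V) => // g.
apply: (@lspan_mod _ _ _ (ps (\det V *: D g))) => //.
  rewrite linearZ -scalerBr -mul_mpolyC; apply: idealM => //; exact: JD.
rewrite -mul_mx_scalar -mul_adj_mx mulmxA; set u := _ *m \adj V.
rewrite (_ : u *m V = \sum_i u 0 i *: row i V); last exact: mulmx_sum_row.
rewrite linear_sum; apply: lspan_sum => // i _.
by rewrite linearZ; apply: lspanZ => //; apply: KV.
Qed.

End Flat.
End BaseChange.

Lemma chart_open (k : fieldType) :
  @open_subfunctor k n r (fun A => @chart n r lam A).
Proof.
split=> [A J|A J hJ]; first exact: chart_hilb_point.
have [idJ [M [pi [pi_onto pi_ker finM flatM rankM]]]] := hJ.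
exists (chart_locus J); split; first exact: chart_locus_ideal.
move=> B f J' eJ'; split.
  exact: (locus_of_chart idJ eJ' pi_onto pi_ker).
exact: (chart_of_locus idJ eJ' pi_onto pi_ker).
Qed.

End ChartLocus.

(** * Regular functions on a chart *)

Section ChartFunctions.

Variables (k : fieldType) (n r : nat) (lam : 'I_r -> 'X_{1..n}).

Definition mult_mx (A : comNzRingType) (J : {mpoly A[n]} -> Prop) (i : 'I_n) :
    'M[A]_r :=
  \matrix_(a, b) lcoord lam J ('X_i * 'X_[lam a]) 0 b.

Definition entry : finType := ('I_n * 'I_r * 'I_r)%type.
Definition entry_poly := {mpoly k[#|entry|]}.

Definition entry_var (i : 'I_n) : 'M[entry_poly]_r :=
  \matrix_(a, b) 'X_(enum_rank ((i, a, b) : entry)).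

(** The regular functions in use are the polynomials in the entries of the
multiplication matrices; chart_eval is their evaluation at a point. *)
Definition chart_eval (A : comAlgType k) (J : {mpoly A[n]} -> Prop)
    (P : entry_poly) : A :=
  mmap (in_alg A) (fun t : 'I_#|entry| =>
    let e := enum_val t in mult_mx J e.1.1 e.1.2 e.2) P.

HB.instance Definition _ (A : comAlgType k) (J : {mpoly A[n]} -> Prop) :=
  GRing.RMorphism.copy (chart_eval J) (chart_eval J).

Lemma chart_evalC (A : comAlgType k) (J : {mpoly A[n]} -> Prop) c :
  chart_eval J c%:MP = c%:A.
Proof. by rewrite /chart_eval mmapC. Qed.

Lemma chart_eval_entry (A : comAlgType k) (J : {mpoly A[n]} -> Prop) i :
  map_mx (chart_eval J) (entry_var i) = mult_mx J i.
Proof.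
apply/matrixP=> a b; rewrite !mxE /chart_eval mmapX mmap1U enum_rankK /=.
by rewrite mxE.
Qed.

Lemma entry_poly_ind (D : entry_poly -> Prop) :
  (forall c, D c%:MP) -> (forall i a b, D (entry_var i a b)) ->
  (forall P Q, D P -> D Q -> D (P + Q)) ->
  (forall P Q, D P -> D Q -> D (P * Q)) -> forall P, D P.
Proof.
move=> DC DX DD DM; apply: mpoly_ring_ind => // t.
have := DX (enum_val t).1.1 (enum_val t).1.2 (enum_val t).2.
by rewrite mxE -!surjective_pairing enum_valK.
Qed.

Section BaseChange.

Variables (A B : comAlgType k) (f : {lrmorphism A -> B}).
Variables (J : {mpoly A[n]} -> Prop) (J' : {mpoly B[n]} -> Prop).
Hypothesis eJ' : same_set J' (base_change f J).

Lemma chart_eval_base_change P : chart lam J ->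
  chart_eval J' P = f (chart_eval J P).
Proof.
move=> chJ; elim/entry_poly_ind: P => [c|i a b|P Q eP eQ|P Q eP eQ].
- by rewrite !chart_evalC rmorph_alg.
- have := chart_eval_entry J' i; have := chart_eval_entry J i.
  move=> /matrixP/(_ a b) + /matrixP/(_ a b); rewrite !mxE => -> ->.
  have := lcoord_base_change eJ' ('X_i * 'X_[lam a]) chJ.
  by rewrite rmorphM /= !map_mpolyX => ->; rewrite mxE.
- by rewrite !rmorphD /= eP eQ.
- by rewrite !rmorphM /= eP eQ.
Qed.

End BaseChange.

(** On the locus of x, the product of x and an entry is the image of an element
of A, although the point over A need not lie in the chart; so is the product of
a polynomial in the entries and a high power of x. *)
Lemma chart_eval_clear (A : comAlgType k) (J : {mpoly A[n]} -> Prop) x P :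
  is_ideal J -> chart_locus lam J x ->
  exists y N, forall (B : comAlgType k) (f : {lrmorphism A -> B}) J',
    same_set J' (base_change f J) -> chart lam J' ->
    f y = f x ^+ N * chart_eval J' P.
Proof.
move=> idJ Lx; elim/entry_poly_ind: P => [c|i a b|P Q|P Q].
- by exists c%:A, 0%N => B f J' eJ' chJ'; rewrite mul1r chart_evalC rmorph_alg.
- have [c Jc] := Lx ('X_i * 'X_[lam a]).
  exists (c 0 b), 1%N => B f J' eJ' chJ'.
  have /matrixP/(_ a b) := chart_eval_entry J' i; rewrite mxE => ->.
  rewrite expr1 mxE; have : J' (f x *: ('X_i * 'X_[lam a]) - lcomb lam (map_mx f c)).
    have := base_change_sub eJ' Jc.
    by rewrite rmorphB /= map_mpolyZ rmorphM /= !map_mpolyX map_lcomb.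
  move=> /(lcoord_uniq chJ') e.
  have [h hE] := linear_of (lcoord_linear chJ').
  by move: e; rewrite -!hE linearZ => /rowP/(_ b); rewrite !mxE.
- move=> [y [N yE]] [z [M zE]].
  exists (x ^+ M * y + x ^+ N * z), (N + M)%N => B f J' eJ' chJ'.
  rewrite !rmorphD !rmorphM !rmorphXn /= (yE _ _ _ eJ' chJ') (zE _ _ _ eJ' chJ').
  by rewrite exprD !mulrDr !mulrA [f x ^+ M * _]mulrC.
- move=> [y [N yE]] [z [M zE]].
  exists (y * z), (N + M)%N => B f J' eJ' chJ'.
  rewrite !rmorphM /= (yE _ _ _ eJ' chJ') (zE _ _ _ eJ' chJ').
  by rewrite exprD mulrACA.
Qed.

Variable H : entry_poly.

Definition unit_chart (A : comAlgType k) (J : {mpoly A[n]} -> Prop) :=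
  chart lam J /\ exists u, chart_eval J H * u = 1.

(** The open set is the complement of the zero set of the ideal of the elements of
the chart locus that become multiples of H at every base change; denominators
are cleared to show that it is large enough. *)
Lemma unit_chart_open : @open_subfunctor k n r unit_chart.
Proof.
split=> [A J [chJ _]|A J hJ]; first exact: chart_hilb_point chJ.
have [idJ [M [pi [pi_onto pi_ker finM flatM rankM]]]] := hJ.
have idL := chart_locus_ideal lam idJ.
pose b (z : A) := chart_locus lam J z /\
  forall (B : comAlgType k) (f : {lrmorphism A -> B}) J',
    same_set J' (base_change f J) -> chart lam J' ->
    exists w, f z = w * chart_eval J' H.
have idb : is_ideal b.
  split.
  - split; first exact: ideal0.
    by move=> B f J' _ _; exists 0; rewrite mul0r rmorph0.
  - move=> x y [Lx bx] [Ly by']; split; first exact: (idealD idL).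
    move=> B f J' eJ' chJ'; have [v vE] := bx _ _ _ eJ' chJ'.
    have [w wE] := by' _ _ _ eJ' chJ'.
    by exists (v + w); rewrite rmorphD /= vE wE mulrDl.
  - move=> c x [Lx bx]; split; first exact: (idealM idL).
    move=> B f J' eJ' chJ'; have [v vE] := bx _ _ _ eJ' chJ'.
    by exists (f c * v); rewrite rmorphM /= vE mulrA.
exists b; split=> // B f J' eJ'; split=> [[chJ' [u hu]]|b1].
  have idE := ideal_gen_ideal (fun y => exists2 x, b x & y = f x).
  have L1 := locus_of_chart idJ eJ' pi_onto pi_ker finM chJ'.
  have rad y : ideal_ext f (chart_locus lam J) y ->
      exists N, ideal_ext f b (y ^+ N); last first.
    by have [N] := rad 1 L1; rewrite expr1n.
  move: y; apply: (ideal_gen_min (ideal_radical idE)) => _ [x Lx ->].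
  have [y [N yE]] := chart_eval_clear H idJ Lx.
  exists N.+1; have -> : f x ^+ N.+1 = u * f (x * y).
    rewrite rmorphM /= (yE _ _ _ eJ' chJ') [f x * _]mulrA -exprS mulrCA.
    by rewrite [u * _]mulrC hu mulr1.
  apply: (idealM idE); apply: ideal_gen_sub; exists (x * y) => //.
  split; first exact: (idealMl idL).
  move=> B' f' J'' eJ'' chJ''; exists (f' x ^+ N.+1).
  by rewrite rmorphM /= (yE _ _ _ eJ'' chJ'') exprS mulrA.
have chJ' : chart lam J'.
  apply: (chart_of_locus idJ eJ' pi_onto pi_ker flatM rankM).
  apply: (ideal_gen_min (ideal_gen_ideal _) _ b1).
  by move=> _ [x [Lx _] ->]; apply: ideal_gen_sub; exists x.
split=> //; have idh : is_ideal (fun y : B => exists u, y = u * chart_eval J' H).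
  split; first by exists 0; rewrite mul0r.
    by move=> _ _ [u ->] [v ->]; exists (u + v); rewrite mulrDl.
  by move=> c _ [u ->]; exists (c * u); rewrite mulrA.
have [u uE] : exists u, 1 = u * chart_eval J' H.
  by apply: (ideal_gen_min idh _ b1) => _ [x [_ bx] ->]; apply: bx eJ' chJ'.
by exists u; rewrite uE mulrC.
Qed.

End ChartFunctions.

(** * A criterion for non-reducedness *)

Section Criterion.

Variables (k : fieldType) (n r : nat) (lam : 'I_r -> 'X_{1..n}).
Variables (I : {mpoly k[n]} -> Prop).

Lemma base_change_id (A : comAlgType k) (J : {mpoly A[n]} -> Prop) :
  is_ideal J -> same_set J (base_change (idfun : {lrmorphism A -> A}) J).
Proof.
move=> idJ q; have mapid (p : {mpoly A[n]}) : map_mpoly idfun p = p.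
  by apply/mpolyP=> m; rewrite mcoeff_map_mpoly.
split=> [Jq|]; first by apply: ideal_gen_sub; exists q; rewrite ?mapid.
by apply: ideal_gen_min => // _ [p Jp ->]; rewrite mapid.
Qed.

Variables (D : comAlgType k) (red : {lrmorphism D -> k^o}).
Hypothesis red_nil : forall x, red x = 0 -> exists N, x ^+ N = 0.
Variable J : {mpoly D[n]} -> Prop.
Hypothesis chJ : chart lam J.
Hypothesis redJ : same_set I (base_change red J).

(** The ideal a of D that defines the complement of a neighbourhood becomes the unit
ideal over k.  Lifting 1 gives an element of a that is congruent to 1 modulo
nilpotents, hence a unit. *)
Lemma open_nbhd_thickening
    (W : forall A : comAlgType k, ({mpoly A[n]} -> Prop) -> Prop) :
  @open_nbhd k n r I W -> W D J.
Proof.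
move=> [[_ openW] WI]; have hJ := @chart_hilb_point k n r lam D J chJ.
have [a [ida aP]] := openW D J hJ.
apply/(aP D idfun J (base_change_id (chart_ideal chJ))).
have /(aP _ red I redJ) [s [sa s1]] := WI.
pose y (x : k^o * k^o) : D := (x.1 : k)%:A * (if pselect (exists2 p, a p & x.2 = red p)
  is left e then s2val (cid2 e) else 0).
have idE := ideal_gen_ideal (fun y => exists2 x, a x & y = (idfun : D -> D) x).
have ay x : x \in s -> a (y x) /\ red (y x) = x.1 * x.2.
  move=> xs; rewrite /y; case: pselect => [e|[]]; last exact: sa.
  case: cid2 => p ap /= ->; split; first exact: idealM.
  have redA (c : k) : red c%:A = c by rewrite linearZ /= rmorph1 [LHS]mulr1.
  by rewrite rmorphM /= redA.
pose z := \sum_(x <- s) y x.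
have az : a z by apply: (ideal_sumr_seq ida) => x /ay[].
have redz : red (1 - z) = 0.
  rewrite rmorphB rmorph1 /z rmorph_sum s1; apply/eqP; rewrite subr_eq0; apply/eqP.
  by apply: eq_big_seq => x /ay[].
have [N zN] := red_nil redz.
have: a 1; last by move=> a1; apply: ideal_gen_sub; exists 1.
have : a (1 - (1 - z) ^+ N); last by rewrite zN subr0.
rewrite -[X in a (X - _)](expr1n _ N) subrXX subKr; exact: idealMl.
Qed.

(** The germ of G: its power m vanishes where H is invertible, whereas G itself is
nonzero at J, which belongs to every neighbourhood of I. *)
Lemma nonreduced_criterion (G H : entry_poly k n r) (m : nat) :
  chart_eval lam J G != 0 -> chart_eval (k:=k) (A:=k^o) lam I H = 1 ->
  (forall (A : comAlgType k) (J' : {mpoly A[n]} -> Prop), chart lam J' ->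
     chart_eval lam J' (H * G ^+ m) = 0) ->
  nonreduced_point r I.
Proof.
move=> GJ HI HG; have chI : @chart n r lam k^o I.
  exact: (chart_base_change redJ chJ).
split; first exact: (@chart_hilb_point k n r lam k^o I).
move=> reduced.
have nbhd_chart : @open_nbhd k n r I (fun A => @chart n r lam A).
  by split; first exact: chart_open.
have reg (A B : comAlgType k) (f : {lrmorphism A -> B}) J1 J2 :
    chart lam J1 -> same_set J2 (base_change f J1) ->
    chart_eval lam J2 G = f (chart_eval lam J1 G).
  by move=> ch1 e; apply: chart_eval_base_change.
pose g := @Germ k n r I (fun A => @chart n r lam A)
  (fun A J' => chart_eval lam J' G) nbhd_chart reg.
have [|W [nbhdW Wg]] := reduced g m.
  exists (@unit_chart k n r lam H); split.
    split; first exact: unit_chart_open.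
    by split=> //; exists 1; rewrite HI mul1r.
  move=> A J' [chJ' [u hu]]; split=> //=.
  have := HG _ _ chJ'; rewrite rmorphM rmorphXn /= => e.
  by rewrite -[LHS]mul1r -hu [_ * u]mulrC -mulrA e mulr0.
have [_ G0] := Wg _ _ (open_nbhd_thickening nbhdW).
by move/eqP: GJ; apply.
Qed.

End Criterion.

(** * Gauss-Jordan elimination over the rationals *)

Arguments Qred : simpl never.

Section Solver.

Variable K : eqType.

(** Linear forms with rational coefficients in the unknowns K. *)
Definition form := seq (K * Q).

Fixpoint add_term (k : K) (c : Q) (f : form) : form :=
  match f with
  | [::] => [:: (k, c)]
  | (k', c') :: g =>
    if k == k' then
      let d := Qred (Qplus c c') in
      if Qnum d is Z0 then g else (k', d) :: g
    else (k', c') :: add_term k c g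
  end.

Definition add_form (c : Q) (f g : form) : form :=
  foldr (fun t acc => add_term t.1 (Qred (Qmult c t.2)) acc) g f.

(** A solved system lists the pivots with their expressions in the other unknowns;
an unknown that is not listed is free, and stands for itself. *)
Definition image (s : seq (K * form)) (k : K) : form :=
  (fix look s := match s with
   | [::] => [:: (k, Qmake (Zpos 1) 1%positive)]
   | (k', f) :: s' => if k == k' then f else look s'
   end) s.

Arguments image : simpl never.

Definition reduce (s : seq (K * form)) (f : form) : form :=
  foldr (fun t acc => add_form t.2 (image s t.1) acc) [::] f.

Definition eliminate (p : K) (h e : form) : form :=
  if has (fun t => t.1 == p) e then reduce [:: (p, h)] e else e.

Definition pivot (s : seq (K * form)) (f : form) : seq (K * form) :=
  match reduce s f with
  | [::] => s
  | (p, c) :: g =>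
    if Qnum c is Z0 then s else
    let h := add_form (Qopp (Qinv c)) g [::] in
    (p, h) :: [seq (t.1, eliminate p h t.2) | t <- s]
  end.

Definition solve (rows : seq form) : seq (K * form) := foldl pivot [::] rows.

End Solver.

(** * The linear systems of each weight *)

(** The unknown (i, a, b) is the entry (a, b) of the normalised matrix of x_i,
where the indices 0, 1 + i and 7 + l refer to the basis vectors 1, x_i and
q_l. *)
Definition key : eqType := (nat * nat * nat)%type.

(** The third derivatives of F. *)
Definition cubic_tensor (i j l : nat) : Z :=
  match sort leq [:: i; j; l] with
  | [:: 0; 1; 3]%N => Zpos 1
  | [:: 0; 4; 4]%N => Zneg 2
  | [:: 1; 2; 2]%N => Zpos 2
  | [:: 2; 4; 5]%N => Zpos 1
  | [:: 3; 5; 5]%N => Zpos 2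
  | _ => Z0
  end.

(** The two variables whose product is q_l. *)
Definition factors (l : nat) : nat * nat :=
  nth (0, 0)%N [:: (1, 3); (0, 3); (4, 5); (0, 1); (2, 5); (2, 4)]%N l.

Definition deg (a : nat) : nat :=
  if (a == 0)%N then 0%N else if (a <= 6)%N then 1%N else 2.

(** The matrices of I: x_i x_j is the sum of the T_ijl q_l, since its action on F
yields the second derivative of F. *)
Definition model (i a b : nat) : Z :=
  if (a == 0)%N then if b == i.+1 then Zpos 1 else Z0 else
  if (a <= 6)%N && (7 <= b)%N then cubic_tensor i a.-1 (b - 7) else Z0.

Definition variable_range := iota 0 6.
Definition linear_range := iota 1 6.
Definition quadric_range := iota 7 6.

Section Rows.

Variables (K : eqType) (emb : key -> K) (pr : key -> key -> form K).

Definition const_term (c : Z) (k : key) : form K :=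
  if c is Z0 then [::] else [:: (emb k, Qmake c 1%positive)].

(** The product of the entries (a, m) of x_u and (m, b) of x_v, to first order in
the generators of weight w.  The row m = 0 of x_v is known exactly; when one of
the factors has weight 0, it is replaced by its constant value; the products of
two entries of positive weight are left to pr. *)
Definition prod_form (u v a m b : nat) : form K :=
  if (m == 0)%N then
    if (0 < b <= 6)%N then const_term (model v 0 b) (u, a, 0%N) else [::]
  else if (deg m == (deg a).+1)%N then const_term (model u a m) (v, m, b)
  else if (deg b == (deg m).+1)%N then const_term (model v m b) (u, a, m)
  else pr (u, a, m) (v, m, b).

Definition comm_row (i j a b : nat) : form K :=
  foldr (fun m acc => prod_form i j a m b ++
    [seq (t.1, Qopp t.2) | t <- prod_form j i a m b] ++ acc) [::] (iota 0 13).

Definition comm_rows (rA rB : seq nat) : seq (form K) :=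
  [seq comm_row t.1.1 t.1.2 t.2.1 t.2.2 | t <-
    [seq (p, q) | p <- [seq (i, j) | j <- variable_range, i <- iota 0 j],
                  q <- [seq (a, b) | a <- rA, b <- rB]]].

Definition sym_rows (rB : seq nat) : seq (form K) :=
  [seq [:: (emb (t.1.1, t.1.2.+1, t.2), Qmake (Zpos 1) 1%positive);
           (emb (t.1.2, t.1.1.+1, t.2), Qmake (Zneg 1) 1%positive)] | t <-
   [seq (p, b) | p <- [seq (i, j) | j <- variable_range, i <- iota 0 j], b <- rB]].

Definition basis_rows (rB : seq nat) : seq (form K) :=
  [seq [:: (emb ((factors t.1).1, (factors t.1).2.+1, t.2),
            Qmake (Zpos 1) 1%positive)] | t <-
   [seq (l, b) | l <- variable_range, b <- rB]].

End Rows.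

Definition trace_rows : seq (form key) :=
  [seq [seq ((i, a, a), Qmake (Zpos 1) 1%positive) |
        a <- linear_range ++ quadric_range] | i <- variable_range].

Definition rows1 : seq (form key) :=
  basis_rows id linear_range ++ sym_rows id linear_range ++
  comm_rows id (fun _ _ => [::]) linear_range quadric_range ++ trace_rows.

Definition all_keys : seq key :=
  [seq (p, b) | p <- [seq (i, a) | i <- variable_range, a <- iota 1 12], b <- iota 0 13].

(** The row a = 0 is left out: it is known exactly. *)
Definition weight_keys (w : nat) : seq key :=
  [seq k <- all_keys | (deg k.1.2).+1 == (deg k.2 + w)%N].

Lemma mem_pairs (S T : eqType) (s : seq S) (t : seq T) x y :
  ((x, y) \in [seq (x, y) | x <- s, y <- t]) = (x \in s) && (y \in t).
Proof.
apply/allpairsP/andP => [[p [ps pt [-> ->]]] //|[xs yt]]; by exists (x, y).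
Qed.

Lemma mem_all_keys i a b : ((i, a, b) \in all_keys) =
  [&& (i < 6)%N, (0 < a < 13)%N & (b < 13)%N].
Proof. by rewrite /all_keys !mem_pairs !mem_iota -andbA. Qed.

Lemma mem_weight_keys w i a b : ((i, a, b) \in weight_keys w) =
  [&& (deg a).+1 == (deg b + w)%N, (i < 6)%N, (0 < a < 13)%N & (b < 13)%N].
Proof. by rewrite mem_filter mem_all_keys. Qed.

Definition keys_in (K : eqType) (S : seq K) (f : form K) : bool :=
  all (fun t => t.1 \in S) f.

Definition table (T : Type) := seq (seq (seq T)).

Definition tabulate (T : Type) (f : key -> T) : table T :=
  [seq [seq [seq f (i, a, b) | b <- iota 0 13] | a <- iota 0 13] | i <- variable_range].

Definition lookup (T : Type) (x : T) (t : table T) (k : key) : T :=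
  nth x (nth [::] (nth [::] t k.1.1) k.1.2) k.2.

Lemma lookup_tabulate (T : Type) (x : T) (f : key -> T) i a b :
  (i < 6)%N -> (a < 13)%N -> (b < 13)%N -> lookup x (tabulate f) (i, a, b) = f (i, a, b).
Proof.
move=> i6 a13 b13; rewrite /lookup /tabulate.
rewrite (nth_map 0%N) ?size_iota // nth_iota //.
rewrite (nth_map 0%N) ?size_iota // nth_iota //.
by rewrite (nth_map 0%N) ?size_iota // nth_iota.
Qed.

(** The generators of L2 and L3: entries, or products of two of them. *)
Definition key2 : eqType := (key + key * key)%type.

Definition pair2 (k l : key) : key2 := inr (k, l).
Definition emb2 (k : key) : key2 := inl k.

Definition prod_forms (K L M : eqType) (pair : K -> L -> M)
    (f : form K) (g : form L) : form M :=
  foldr (fun t acc => add_form t.2 [seq (pair t.1 u.1, u.2) | u <- g] acc) [::] f.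

Definition drop_pairs (f : form key2) : form key :=
  pmap (fun t => if t.1 is inl k then Some (k, t.2) else None) f.

Section Products.

Variables (form1 form2 : key -> form key) (free1 free2 : seq key).

(** In weight 2, the factors of weight 1 are replaced by their expressions in the
free entries t_j. *)
Definition pr2 (k l : key) : form key2 := prod_forms pair2 (form1 k) (form1 l).

(** Products are indexed by ordered pairs, so their symmetry is an equation. *)
Definition swap_rows : seq (form key2) :=
  [seq [:: (pair2 p.1 p.2, Qmake (Zpos 1) 1%positive);
           (pair2 p.2 p.1, Qmake (Zneg 1) 1%positive)] |
   p <- [seq (k, l) | k <- free1, l <- free1]].

Definition rows2 : seq (form key2) :=
  basis_rows emb2 [:: 0%N] ++ sym_rows emb2 [:: 0%N] ++ swap_rows ++
  comm_rows emb2 pr2 linear_range linear_range ++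
  comm_rows emb2 pr2 quadric_range quadric_range.

(** In weight 3, one of the two factors has weight 1 and the other weight 2. *)
Definition pr3 (k l : key) : form key2 :=
  if deg k.1.2 == deg k.2 then prod_forms pair2 (form1 k) (form2 l)
  else prod_forms pair2 (form1 l) (form2 k).

Definition rows3 : seq (form key2) :=
  comm_rows emb2 pr3 linear_range [:: 0%N] ++
  comm_rows emb2 pr3 quadric_range linear_range.

(** The equations t_i (t_j v_l) = t_j (t_i v_l), where the products t_j v_l and
t_i v_l are replaced by their multiples of c; the unknown t_i stands for
t_i c. *)
Definition rows4 (s3 : seq (key2 * form key2)) : seq (form key) :=
  [seq [seq (t.1.1, u.2) | u <- image s3 (pair2 t.1.2 t.2)] ++
       [seq (t.1.2, Qopp u.2) | u <- image s3 (pair2 t.1.1 t.2)] |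
   t <- [seq (p, l) | p <- [seq (i, j) | i <- free1, j <- free1], l <- free2]].

End Products.

(** The expected shape of the four solutions: the generators of L1, L2 and L3 are
combinations of the t_j, of the v_l and of c respectively, and every t_j c
vanishes. *)
Definition checks (keys : nat -> seq key) (free1 free2 : seq key) (cube : key)
    (s1 : seq (key * form key)) (s2 s3 : seq (key2 * form key2))
    (s4 : seq (key * form key)) : bool :=
  [&& all (fun t => keys_in free1 (image s1 t)) (keys 1%N),
      all (fun t => keys_in (map emb2 free2) (image s2 (emb2 t))) (keys 2),
      all (fun t => all (fun u => keys_in (map emb2 free2) (image s2 (pair2 t u)))
        free1) free1,
      all (fun t => keys_in [:: emb2 cube] (image s3 (emb2 t))) (keys 3),
      all (fun t => all (fun u => keys_in [:: emb2 cube] (image s3 (pair2 t u)))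
        free2) free1,
      all (fun t => nilp (image s4 t)) free1,
      all (mem (keys 1%N)) free1
    & all (mem (keys 2)) free2].

(** The solutions are packed in a record whose only inhabitant in use is opaque:
what follows depends on the equations that define them and on the checks, and
never unfolds the computed systems. *)
Record certificate := Certificate {
  keys_of : nat -> seq key;
  free1 : seq key; free2 : seq key; cube : key;
  sol1 : seq (key * form key); tab1 : table (form key);
  sol2 : seq (key2 * form key2); tab2 : table (form key);
  sol3 : seq (key2 * form key2); sol4 : seq (key * form key);
  mem_keys_of : forall w i a b, ((i, a, b) \in keys_of w) =
    [&& (deg a).+1 == (deg b + w)%N, (i < 6)%N, (0 < a < 13)%N & (b < 13)%N];
  sol1E : sol1 = solve rows1;
  tab1E : tab1 = tabulate (image sol1);
  sol2E : sol2 = solve (rows2 (lookup [::] tab1) free1);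
  tab2E : tab2 = tabulate (fun t => drop_pairs (image sol2 (emb2 t)));
  sol3E : sol3 = solve (rows3 (lookup [::] tab1) (lookup [::] tab2));
  sol4E : sol4 = solve (rows4 free1 free2 sol3);
  certified : checks keys_of free1 free2 cube sol1 sol2 sol3 sol4
}.

Definition candidate1 : seq key := [seq (0, 7, b)%N | b <- quadric_range].
Definition candidate2 : seq key :=
  [:: (0, 7, 1); (0, 7, 2); (0, 7, 3); (0, 7, 5); (0, 7, 6); (5, 9, 5)]%N.
Definition candidate3 : key := (0, 7, 0)%N.

Definition solved1 := solve rows1.
Definition solved_tab1 := tabulate (image solved1).
Definition solved2 := solve (rows2 (lookup [::] solved_tab1) candidate1).
Definition solved_tab2 := tabulate (fun t => drop_pairs (image solved2 (emb2 t))).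
Definition solved3 :=
  solve (rows3 (lookup [::] solved_tab1) (lookup [::] solved_tab2)).
Definition solved4 := solve (rows4 candidate1 candidate2 solved3).

Lemma solved_checks :
  checks weight_keys candidate1 candidate2 candidate3 solved1 solved2 solved3 solved4.
Proof. by vm_compute. Qed.

(* Comparing the two sides of an equation must not run the elimination. *)
Opaque solve tabulate checks.

Lemma the_certificate : certificate.
Proof.
exact: (@Certificate weight_keys candidate1 candidate2 candidate3 solved1 solved_tab1
  solved2 solved_tab2 solved3 solved4 mem_weight_keys erefl erefl erefl erefl erefl erefl
  solved_checks).
Qed.

Transparent solve tabulate checks.

(** * Soundness of the elimination *)

Arguments Qplus : simpl never.
Arguments Qmult : simpl never.
Arguments Qopp : simpl never.

Section IntegerScalars.

Variable R : nzRingType.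

Definition Zscalar (z : Z) : R := (int_of_Z z)%:~R.

Lemma ZscalarD a b : Zscalar (Z.add a b) = Zscalar a + Zscalar b.
Proof. by rewrite /Zscalar -intrD -rmorphD. Qed.

Lemma ZscalarM a b : Zscalar (Z.mul a b) = Zscalar a * Zscalar b.
Proof. by rewrite /Zscalar -intrM -rmorphM. Qed.

Lemma ZscalarN a : Zscalar (Z.opp a) = - Zscalar a.
Proof. by rewrite /Zscalar -mulrNz -rmorphN. Qed.

End IntegerScalars.

Section RationalScalars.

Variable k : fieldType.
Hypothesis hk : [pchar k] =i pred0.

Local Notation Zscalar := (Zscalar k).

Lemma Zscalar_eq0 z : Zscalar z = 0 -> z = Z0.
Proof.
have nat0 n : n%:R = 0 :> k -> n = 0%N.
  by move/eqP; rewrite ((pcharf0P k).1 hk) => /eqP.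
rewrite /Zscalar => e; rewrite -(int_of_ZK z); move: (int_of_Z z) e => [n|n].
  by rewrite -pmulrn => /nat0->.
by rewrite NegzE mulrNz => /eqP; rewrite oppr_eq0 -pmulrn => /eqP/nat0.
Qed.

Lemma Zscalar_pos p : Zscalar (Zpos p) != 0.
Proof. by apply/eqP=> /Zscalar_eq0. Qed.

Definition scalar (q : Q) : k := Zscalar (Qnum q) / Zscalar (Zpos (Qden q)).

Lemma scalar_eq p q : Qeq p q -> scalar p = scalar q.
Proof.
rewrite /Qeq /scalar => /(congr1 Zscalar); rewrite !ZscalarM => e.
by apply/eqP; rewrite eqr_div ?Zscalar_pos // e.
Qed.

Lemma scalarD p q : scalar (Qplus p q) = scalar p + scalar q.
Proof.
rewrite /scalar /= ZscalarD !ZscalarM addf_div ?Zscalar_pos //.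
by rewrite -[Zscalar (Zpos (Qden p)) * _]ZscalarM.
Qed.

Lemma scalarM p q : scalar (Qmult p q) = scalar p * scalar q.
Proof.
rewrite /scalar /= ZscalarM mulf_div.
by rewrite -[Zscalar (Zpos (Qden p)) * _]ZscalarM.
Qed.

Lemma scalarN q : scalar (Qopp q) = - scalar q.
Proof. by rewrite /scalar /= ZscalarN mulNr. Qed.

Lemma scalar_red q : scalar (Qred q) = scalar q.
Proof. by apply: scalar_eq; apply: Qred_correct. Qed.

Lemma scalar_int z : scalar (Qmake z 1) = Zscalar z.
Proof. by rewrite /scalar /= divr1. Qed.

Lemma scalar_neq0 q : Qnum q <> Z0 -> scalar q != 0.
Proof.
move=> q0; apply/eqP => /eqP.
rewrite mulf_eq0 invr_eq0 (negbTE (Zscalar_pos _)) orbF.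
by move=> /eqP/Zscalar_eq0.
Qed.

Lemma scalarV q : Qnum q <> Z0 -> scalar (Qinv q) = (scalar q)^-1.
Proof.
move=> q0; have q_neq0 : ~ Qeq q (Qmake Z0 1) by rewrite /Qeq /= Z.mul_1_r.
apply: (mulfI (scalar_neq0 q0)).
by rewrite -scalarM (scalar_eq (Qmult_inv_r _ q_neq0)) scalar_int mulfV ?scalar_neq0.
Qed.

End RationalScalars.

Section Soundness.

Variables (k : fieldType) (hk : [pchar k] =i pred0).
Variable R : comAlgType k.

Definition subspace (P : R -> Prop) :=
  [/\ P 0, forall x y, P x -> P y -> P (x + y) & forall (c : k) x, P x -> P (c *: x)].

Section Solver.

Variables (P : R -> Prop) (subP : subspace P) (K : eqType) (x : K -> R).

Let P0 : P 0. Proof. by case: subP. Qed.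
Let PD a b : P a -> P b -> P (a + b). Proof. by case: subP => _ + _; apply. Qed.
Let PZ c a : P a -> P (c *: a). Proof. by case: subP => _ _; apply. Qed.

Definition value (f : form K) : R := \sum_(t <- f) scalar k t.2 *: x t.1.

Lemma value_nil : value [::] = 0. Proof. by rewrite /value big_nil. Qed.

Lemma value_cons t f : value (t :: f) = scalar k t.2 *: x t.1 + value f.
Proof. by rewrite /value big_cons. Qed.

Lemma value_cat f g : value (f ++ g) = value f + value g.
Proof. by rewrite /value big_cat. Qed.

Lemma value_opp f : value [seq (t.1, Qopp t.2) | t <- f] = - value f.
Proof.
rewrite /value big_map -sumrN; apply: eq_bigr => t _.
by rewrite scalarN scaleNr.
Qed.

Lemma value_add_term i c f : value (add_term i c f) = scalar k c *: x i + value f.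
Proof.
elim: f => [|[j d] f IHf] /=; first by rewrite value_cons.
case: eqP => [->|_]; last by rewrite !value_cons IHf addrCA.
have e : scalar k (Qred (Qplus c d)) = scalar k c + scalar k d.
  by rewrite scalar_red // scalarD.
case E: (Qnum _) => [|p|p]; rewrite !value_cons /= addrA -scalerDl -?e //.
by rewrite /scalar E /Zscalar mul0r scale0r add0r.
Qed.

Lemma value_add_form c f g : value (add_form c f g) = scalar k c *: value f + value g.
Proof.
elim: f => [|t f IHf] /=; first by rewrite value_nil scaler0 add0r.
by rewrite value_add_term IHf value_cons scalar_red // scalarM scalerDr scalerA addrA.
Qed.

Definition sound (s : seq (K * form K)) := forall i, P (x i - value (image s i)).

Lemma reduce_sound s f : sound s -> P (value f - value (reduce s f)).
Proof.
move=> ss; elim: f => [|t f IHf] /=; first by rewrite subrr.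
rewrite value_cons value_add_form opprD addrACA -scalerBr.
by apply: PD => //; apply: PZ.
Qed.

Lemma reduce_vanish s f : sound s -> P (value f) -> P (value (reduce s f)).
Proof.
move=> ss Pf; have := PD Pf (PZ (-1) (reduce_sound f ss)).
by rewrite scaleN1r opprB addrC subrK.
Qed.

Lemma image_cons i f (s : seq (K * form K)) j :
  image ((i, f) :: s) j = if j == i then f else image s j.
Proof. by []. Qed.

Lemma image_map (h : form K -> form K) (s : seq (K * form K)) j :
  image [seq (t.1, h t.2) | t <- s] j =
  if j \in unzip1 s then h (image s j) else [:: (j, Qmake (Zpos 1) 1)].
Proof.
elim: s => [|[i f] s IHs]; first by rewrite in_nil.
rewrite [map _ _]/= [unzip1 _]/= !image_cons inE.
by case: eqP => //= _; rewrite IHs.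
Qed.

Lemma image_out (s : seq (K * form K)) j :
  j \notin unzip1 s -> image s j = [:: (j, Qmake (Zpos 1) 1)].
Proof.
elim: s => [|[i f] s IHs] //; rewrite [unzip1 _]/= image_cons inE negb_or.
by move=> /andP[/negbTE-> /IHs].
Qed.

Lemma value_single j : value [:: (j, Qmake (Zpos 1) 1)] = x j.
Proof. by rewrite value_cons value_nil addr0 scalar_int scale1r. Qed.

Lemma eliminate_sound p h e :
  P (x p - value h) -> P (value e - value (eliminate p h e)).
Proof.
move=> ph; rewrite /eliminate; case: ifP => _; last by rewrite subrr.
apply: reduce_sound => i; rewrite image_cons.
by case: eqP => [->//|_]; rewrite image_out // value_single subrr.
Qed.

Lemma pivot_sound s f : sound s -> P (value f) -> sound (pivot s f).
Proof.
move=> ss Pf; have := reduce_vanish ss Pf; rewrite /pivot.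
case: (reduce s f) => [//|[p c] g] Pr.
have [c0|c0] : Qnum c = Z0 \/ Qnum c <> Z0.
- by case: (Qnum c); [left | right | right].
- by rewrite c0.
set h := add_form _ g [::].
have ph : P (x p - value h).
  have sc := scalar_neq0 hk c0.
  have -> : x p - value h = (scalar k c)^-1 *: value ((p, c) :: g).
    rewrite value_cons scalerDr scalerA mulVf // scale1r /h value_add_form.
    by rewrite value_nil addr0 scalarN // scalarV // scaleNr opprK.
  exact: PZ.
have sound' : sound ((p, h) :: [seq (t.1, eliminate p h t.2) | t <- s]).
  move=> i; rewrite image_cons; case: eqP => [->//|_].
  rewrite image_map; case: ifP => [si|_]; last by rewrite value_single subrr.
  by have := PD (ss i) (eliminate_sound (image s i) ph); rewrite addrA subrK.
by case: (Qnum c) c0.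
Qed.

Fixpoint vanish (rows : seq (form K)) : Prop :=
  if rows is f :: rows' then P (value f) /\ vanish rows' else True.

Lemma vanish_cat s t : vanish s -> vanish t -> vanish (s ++ t).
Proof. by elim: s => //= f s IHs [Pf /IHs st] /st. Qed.

Lemma vanish_map (T : eqType) (h : T -> form K) (s : seq T) :
  (forall i, i \in s -> P (value (h i))) -> vanish [seq h i | i <- s].
Proof.
elim: s => //= i s IHs Ps; split; first by apply: Ps; rewrite mem_head.
by apply: IHs => j js; apply: Ps; rewrite inE js orbT.
Qed.

Lemma solve_sound rows : vanish rows -> sound (solve rows).
Proof.
rewrite /solve; have : sound [::] by move=> i; rewrite value_single subrr.
elim: rows [::] => [|f rows IHr] s ss //= [Pf Prows].
by apply: IHr => //; apply: pivot_sound.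
Qed.

End Solver.

Lemma value_prod_forms (K L M : eqType) (pair : K -> L -> M) x y z f g :
  (forall i j, z (pair i j) = x i * y j) ->
  value z (prod_forms pair f g) = value x f * value y g.
Proof.
move=> zE; elim: f => [|t f IHf] /=; first by rewrite !value_nil mul0r.
rewrite value_add_form IHf value_cons mulrDl; congr (_ + _).
rewrite /value big_map -scalerAl mulr_sumr; congr (_ *: _).
by apply: eq_bigr => u _; rewrite zE scalerAr.
Qed.

End Soundness.

Opaque solve tabulate.

Local Notation keys := (keys_of the_certificate).
Local Notation mem_keys := (mem_keys_of the_certificate).

(** * Nakayama *)

Section Nakayama.

Variables (k : fieldType) (R : comAlgType k) (Rel : R -> Prop).
Hypothesis idRel : is_ideal Rel.
Variable ev : {rmorphism R -> k}.

(** The elements of Rel + m L, where m is the kernel of ev. *)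
Fixpoint mspan (L : seq R) (x : R) : Prop :=
  if L is g :: L' then exists2 c, ev c = 0 & mspan L' (x - c * g) else Rel x.

Lemma mspan_rel L x : Rel x -> mspan L x.
Proof.
elim: L => //= g L IHL Rx; exists 0; rewrite ?rmorph0 //.
by rewrite mul0r subr0; apply: IHL.
Qed.

Lemma mspanD L x y : mspan L x -> mspan L y -> mspan L (x + y).
Proof.
elim: L x y => [|g L IHL] x y /=; first exact: idealD.
move=> [c c0 Lx] [d d0 Ly]; exists (c + d); first by rewrite rmorphD c0 d0 addr0.
by rewrite mulrDl opprD addrACA; apply: IHL.
Qed.

Lemma mspanM L c x : mspan L x -> mspan L (c * x).
Proof.
elim: L x => [|g L IHL] x /=; first exact: idealM.
move=> [d d0 Lx]; exists (c * d); first by rewrite rmorphM d0 mulr0.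
by rewrite -mulrA -mulrBr; apply: IHL.
Qed.

Lemma mspan_gen L c g : ev c = 0 -> g \in L -> mspan L (c * g).
Proof.
move=> c0; elim: L => //= h L IHL; rewrite inE => /orP[/eqP->|gL].
  by exists c => //; rewrite subrr; apply: mspan_rel; apply: ideal0.
by exists 0; rewrite ?rmorph0 // mul0r subr0; apply: IHL.
Qed.

Lemma mspan_ind L (V : R -> Prop) : (forall x, Rel x -> V x) ->
  (forall x y, V x -> V y -> V (x + y)) ->
  (forall c g, ev c = 0 -> g \in L -> V (c * g)) ->
  forall x, mspan L x -> V x.
Proof.
move=> VR VD; elim: L => [|g L IHL] VL x //=; first exact: VR.
move=> [c c0 Lx]; rewrite -(subrK (c * g) x); apply: (VD); last first.
  by apply: VL; rewrite ?mem_head.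
by apply: IHL Lx => d h d0 hL; apply: VL => //; rewrite inE hL orbT.
Qed.

Lemma mspan_subspace L : subspace (mspan L).
Proof.
split=> [|x y|c x Lx]; [|exact: mspanD|]; last first.
  by rewrite -mulr_algl; apply: mspanM.
by apply: mspan_rel; apply: ideal0.
Qed.

Lemma mspan_mul L L' x y : mspan L x -> (forall g, g \in L -> g * y \in L') ->
  mspan L' (x * y).
Proof.
move=> Lx Ly; move: x Lx; apply: mspan_ind => [x Rx|x x' Lx Lx'|c g c0 gL].
- by apply: mspan_rel; apply: idealMl.
- by rewrite mulrDl; apply: mspanD.
- by rewrite -mulrA; apply: mspan_gen => //; apply: Ly.
Qed.

(** The first generator g satisfies (u - c) g = 0 modulo the others, with c in m;
multiplication by u - c, which is 1 modulo m, thus eliminates g. *)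
Lemma nakayama_step L u : ev u = 1 ->
  (forall g, g \in L -> mspan L (u * g)) ->
  exists h, ev h = 1 /\ forall g, g \in L -> Rel (h * g).
Proof.
elim: L u => [|g L IHL] u u1 Lu; first by exists 1; rewrite rmorph1.
have [c c0 Lg] := Lu g (mem_head _ _).
rewrite -mulrBl in Lg.
have gL y : y \in L -> mspan L ((u - c) * (u * y)).
  move=> yL; have [d d0 Ly] : mspan (g :: L) (u * y).
    by apply: Lu; rewrite inE yL orbT.
  rewrite -[u * y](subrK (d * g)) mulrDr; apply: mspanD; first exact: mspanM.
  by rewrite mulrCA; apply: mspanM.
have [|y yL|h [h1 hL]] := IHL ((u - c) * u).
- by rewrite rmorphM rmorphB u1 c0 subr0 mul1r.
- by rewrite -mulrA; apply: gL.
exists (h * (u - c)); split; first by rewrite rmorphM rmorphB h1 u1 c0 subr0 mul1r.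
have hspan : forall x, mspan L x -> Rel (h * x).
  apply: mspan_ind => [y Ry|y z Ry Rz|d y d0 yL]; first exact: idealM.
    by rewrite mulrDr; apply: idealD.
  by rewrite mulrCA; apply: idealM => //; apply: hL.
move=> y; rewrite inE => /orP[/eqP->|yL]; first by rewrite -mulrA; apply: hspan.
by rewrite mulrAC; apply: idealMl => //; apply: hL.
Qed.

Lemma nakayama L : (forall g, g \in L -> mspan L g) ->
  exists h, ev h = 1 /\ forall g, g \in L -> Rel (h * g).
Proof.
move=> LL; apply: (nakayama_step (rmorph1 ev)) => g gL.
by rewrite mul1r; apply: LL.
Qed.

End Nakayama.

Section Near.

Variables (k : fieldType) (R : comAlgType k).

(** The subspace P + k S, described as the smallest one that contains P and S. *)
Definition near (P : R -> Prop) (S : seq R) (y : R) : Prop :=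
  forall V, subspace V -> (forall x, P x -> V x) -> (forall s, s \in S -> V s) ->
  V y.

Lemma near_subspace P S : subspace (near P S).
Proof.
split=> [V [V0 _ _] //|x y Px Py V sV PV SV|c x Px V sV PV SV].
- by have [_ VD _] := sV; apply: VD; [apply: Px | apply: Py].
- by have [_ _ VZ] := sV; apply: VZ; apply: Px.
Qed.

Lemma near_sub (P : R -> Prop) S x : P x -> near P S x.
Proof. by move=> Px V _ PV _; apply: PV. Qed.

Lemma near_mem P S s : s \in S -> near P S s.
Proof. by move=> sS V _ _; apply. Qed.

Lemma subspace_value (P : R -> Prop) (K : eqType) (x : K -> R) (S : seq K)
    (f : form K) : subspace P -> (forall i, i \in S -> P (x i)) ->
  keys_in S f -> P (value x f).
Proof.
move=> [P0 PD PZ] Px; rewrite /keys_in; elim: f => [|t f IHf] /=.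
  by rewrite value_nil.
move=> /andP[tS fS]; rewrite value_cons; apply: PD; last exact: IHf.
exact/PZ/Px.
Qed.

Lemma near_form (P : R -> Prop) (K : eqType) (x : K -> R) (S : seq K)
    (f : form K) y : P (y - value x f) -> keys_in S f ->
  near P [seq x i | i <- S] y.
Proof.
move=> Py fS; rewrite -(subrK (value x f) y).
have [_ nD _] := near_subspace P [seq x i | i <- S].
apply: nD; first exact: near_sub.
apply: subspace_value fS; first exact: near_subspace.
by move=> i iS; apply: near_mem; apply: map_f.
Qed.

Lemma subspace_mul (P : R -> Prop) y : subspace P -> subspace (fun x => P (x * y)).
Proof.
move=> [P0 PD PZ]; split=> [|x z|c x Px]; first by rewrite mul0r.
  by rewrite mulrDl; apply: PD.
by rewrite -scalerAl; apply: PZ.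
Qed.

Lemma subspace_mulr (P : R -> Prop) x : subspace P -> subspace (fun y => P (x * y)).
Proof.
move=> [P0 PD PZ]; split=> [|y z|c y Py]; first by rewrite mulr0.
  by rewrite mulrDr; apply: PD.
by rewrite -scalerAr; apply: PZ.
Qed.

End Near.

Lemma deg_le2 a : (deg a <= 2)%N.
Proof. by rewrite /deg; case: ifP => // _; case: ifP. Qed.

Lemma deg_gt0 a : (0 < a)%N -> (deg a == 1)%N || (deg a == 2)%N.
Proof. by rewrite /deg lt0n => /negbTE->; case: ifP. Qed.

(** * The graded analysis of commuting multiplication matrices *)

Section Graded.

Variables (k : fieldType) (hk : [pchar k] =i pred0).
Variables (R : comAlgType k) (Rel : R -> Prop).
Hypothesis idRel : is_ideal Rel.
Variable ev : {rmorphism R -> k}.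
Hypothesis evZ : forall c : k, ev c%:A = c.

(* R stands for the polynomials in the entries of the matrices, Rel for those
   that vanish on the chart, and ev for the evaluation at the point I. *)
Variable X : nat -> nat -> nat -> R.
Hypothesis X_one : forall i b, (i < 6)%N -> (b < 13)%N ->
  Rel (X i 0 b - (b == i.+1)%:R).
Hypothesis X_sym : forall i j b, (i < 6)%N -> (j < 6)%N -> (b < 13)%N ->
  Rel (X i j.+1 b - X j i.+1 b).
Hypothesis X_basis : forall l b, (l < 6)%N -> (b < 13)%N ->
  Rel (X (factors l).1 (factors l).2.+1 b - (b == 7 + l)%N%:R).
Hypothesis X_trace : forall i, (i < 6)%N -> Rel (\sum_(a <- iota 0 13) X i a a).
Hypothesis X_comm : forall i j a b, (i < 6)%N -> (j < 6)%N -> (a < 13)%N ->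
  (b < 13)%N ->
  Rel (\sum_(m <- iota 0 13) (X i a m * X j m b - X j a m * X i m b)).
Hypothesis X_model : forall i a b, (i < 6)%N -> (a < 13)%N -> (b < 13)%N ->
  ev (X i a b) = Zscalar k (model i a b).

Definition Xk (t : key) : R := X t.1.1 t.1.2 t.2.

Section Rows.

Variables (w : nat) (P : R -> Prop) (subP : subspace P).
Hypothesis P_rel : forall x, Rel x -> P x.
Hypothesis P_gen : forall c t, ev c = 0 -> t \in keys w -> P (c * Xk t).
Variables (K : eqType) (emb : key -> K) (x : K -> R).
Hypothesis x_emb : forall t, x (emb t) = Xk t.
Variable pr : key -> key -> form K.
Hypothesis pr_sound : forall u v a m b, (u < 6)%N -> (v < 6)%N ->
  (0 < a < 13)%N -> (0 < m < 13)%N -> (b < 13)%N ->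
  (deg a).+2 = (deg b + w)%N -> deg m <> (deg a).+1 -> deg b <> (deg m).+1 ->
  P (Xk (u, a, m) * Xk (v, m, b) - value x (pr (u, a, m) (v, m, b))).

Lemma value_const_term c t :
  value x (const_term emb c t) = Zscalar k c *: Xk t.
Proof.
case: c => [|p|p] /=; rewrite ?value_cons value_nil /= ?addr0 ?scalar_int ?x_emb //.
by rewrite /Zscalar scale0r.
Qed.

Lemma prod_form_sound u v a m b : (u < 6)%N -> (v < 6)%N ->
  (0 < a < 13)%N -> (m < 13)%N -> (b < 13)%N -> (deg a).+2 = (deg b + w)%N ->
  P (X u a m * X v m b - value x (prod_form emb pr u v a m b)).
Proof.
move=> u6 v6 a13 m13 b13 degw; rewrite /prod_form.
have [m0|m0] := eqVneq m 0%N; last first.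
  have m13' : (0 < m < 13)%N by rewrite lt0n m0.
  have [_ a13'] := andP a13.
  case: eqP => [dm|dm].
    rewrite value_const_term -mulr_algl -mulrBl; apply: (@P_gen _ (v, m, b)).
      by rewrite rmorphB X_model // evZ subrr.
    by rewrite mem_keys v6 m13' b13 dm degw eqxx.
  case: eqP => [db|db]; last exact: pr_sound.
  rewrite value_const_term mulrC -mulr_algl -mulrBl; apply: (@P_gen _ (u, a, m)).
    by rewrite rmorphB X_model // evZ subrr.
  by rewrite mem_keys u6 a13 m13 /= andbT -eqSS degw db addSn.
rewrite m0; have Xv := X_one v6 b13; case: ifP => [b6|b6].
  rewrite value_const_term /= mulrC -mulr_algl -mulrBl; apply: P_rel.
  apply: idealMl => //; move: Xv; rewrite /model /=.
  by case: eqP => _; rewrite /Zscalar /= ?scale1r ?scale0r.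
rewrite value_nil subr0; apply: P_rel; apply: idealM => //.
move: Xv; case: eqP => [bv|_]; last by rewrite subr0.
by move: b6; rewrite bv ltnS v6.
Qed.

Lemma comm_row_sound i j a b : (i < 6)%N -> (j < 6)%N ->
  (0 < a < 13)%N -> (b < 13)%N -> (deg a).+2 = (deg b + w)%N ->
  P (value x (comm_row emb pr i j a b)).
Proof.
move=> i6 j6 a13 b13 degw; have [P0 PD PZ] := subP.
have PN y : P y -> P (- y) by move=> /(PZ (-1)); rewrite scaleN1r.
have PB y z : P (y - z) -> P y -> P z.
  by move=> Pyz Py; rewrite -[z](subKr y); apply/PD => //; apply/PN.
have [_ a13'] := andP a13.
apply: PB (P_rel (X_comm i6 j6 a13' b13)); rewrite /comm_row.
have : all (fun m => m < 13)%N (iota 0 13) by [].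
elim: (iota 0 13) => [_|m s IHs /= /andP[m13 s13]].
  by rewrite big_nil value_nil subrr.
rewrite big_cons !value_cat value_opp [value x _ + _]addrA opprD addrACA.
apply/PD; last exact: IHs.
have -> : forall x y p q : R, x - y - (p - q) = (x - p) - (y - q).
  by move=> *; rewrite !opprD !opprK addrACA.
by apply/PD; [|apply/PN]; apply: prod_form_sound.
Qed.

Lemma mem_index_pairs p :
  p \in [seq (i, j) | j <- variable_range, i <- iota 0 j] -> (p.1 < 6)%N && (p.2 < 6)%N.
Proof.
move=> /allpairsPdep[j [i [jI iI ->]]]; move: jI iI; rewrite !mem_iota /= => j6 ij.
by rewrite j6 (ltn_trans ij).
Qed.

Lemma comm_rows_vanish rA rB :
  all (fun a => (0 < a < 13)%N) rA -> all (fun b => (b < 13)%N) rB ->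
  all (fun a => all (fun b => (deg a).+2 == (deg b + w)%N) rB) rA ->
  vanish P x (comm_rows emb pr rA rB).
Proof.
move=> /allP hA /allP hB /allP hw; apply: vanish_map => -[[i j] [a b]].
rewrite !mem_pairs => /and3P[/mem_index_pairs/andP[i6 j6] aA bB].
apply: comm_row_sound => //; [exact: hA | exact: hB |].
by apply/eqP; have /allP := hw a aA; apply.
Qed.

Lemma sym_rows_vanish rB : all (fun b => (b < 13)%N) rB ->
  vanish P x (sym_rows emb rB).
Proof.
move=> /allP hB; apply: vanish_map => -[[i j] b].
rewrite mem_pairs => /andP[/mem_index_pairs/andP[i6 j6] bB].
rewrite !value_cons value_nil addr0 !scalar_int !x_emb /Zscalar /=.
by rewrite scaleN1r scale1r; apply/P_rel/X_sym => //; apply: hB.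
Qed.

Lemma basis_rows_vanish rB : all (fun b => (b < 7)%N) rB ->
  vanish P x (basis_rows emb rB).
Proof.
move=> /allP hB; apply: vanish_map => -[l b].
rewrite mem_pairs mem_iota /= => /andP[l6 bB].
rewrite !value_cons value_nil addr0 scalar_int x_emb /Zscalar /= scale1r.
have b7 := hB b bB; have := X_basis l6 (leq_trans b7 (isT : 7 <= 13)%N).
have /negbTE-> : b != (7 + l)%N by rewrite neq_ltn (leq_trans b7) ?leq_addr.
by rewrite subr0; apply: P_rel.
Qed.

End Rows.

Lemma unit_scalar : scalar k (Qmake (Zpos 1) 1) = 1.
Proof. by rewrite scalar_int. Qed.

Definition pairwise (L L' : seq R) : seq R := [seq y * z | y <- L, z <- L'].

Definition entries (w : nat) : seq R := [seq Xk t | t <- keys w].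

Definition L1 := entries 1.
Definition L2 := pairwise L1 L1 ++ entries 2.
Definition L3 := pairwise L1 L2 ++ entries 3.
Definition L4 := pairwise L1 L3.

Local Notation span := (mspan Rel ev).

Lemma mem_pairwise L L' y z : y \in L -> z \in L' -> y * z \in pairwise L L'.
Proof. by move=> yL zL; apply/allpairsP; exists (y, z). Qed.

Lemma mem_entries t w : t \in keys w -> Xk t \in entries w.
Proof. exact: map_f. Qed.

Lemma mul_L2 y z : y \in L1 -> z \in L1 -> y * z \in L2.
Proof. by move=> yL zL; rewrite mem_cat mem_pairwise. Qed.

Lemma mul_L3 y z : y \in L1 -> z \in L2 -> y * z \in L3.
Proof. by move=> yL zL; rewrite mem_cat mem_pairwise. Qed.

Lemma entries_L2 t : t \in keys 2 -> Xk t \in L2.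
Proof. by move=> tk; rewrite mem_cat mem_entries ?orbT. Qed.

Let sub_span L := mspan_subspace idRel ev L.

(** A product is replaced by the product of the expressions of its factors. *)
Lemma prod_cong (P P' P'' : R -> Prop) (S : seq key) y z f g : subspace P'' ->
  P (y - value Xk f) -> P' (z - value Xk g) -> keys_in S f ->
  (forall u, P u -> P'' (u * z)) ->
  (forall t u, t \in S -> P' u -> P'' (Xk t * u)) ->
  P'' (y * z - value Xk f * value Xk g).
Proof.
move=> subP'' Py Pz fS PP P'P.
have -> : y * z - value Xk f * value Xk g =
    (y - value Xk f) * z + value Xk f * (z - value Xk g).
  by rewrite mulrBl mulrBr addrA subrK.
have [_ PD _] := subP''; apply/PD; first exact: PP.
apply: (subspace_value (subspace_mul (z - value Xk g) subP'')) fS => t tS.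
exact: P'P.
Qed.

Local Notation C := the_certificate.
Local Notation F1 := (free1 C).
Local Notation F2 := (free2 C).
Local Notation cube := (cube C).

Lemma certifiedP :
  [/\ forall t, t \in keys 1 -> keys_in F1 (image (sol1 C) t),
      forall t, t \in keys 2 -> keys_in (map emb2 F2) (image (sol2 C) (emb2 t)),
      forall t u, t \in F1 -> u \in F1 ->
        keys_in (map emb2 F2) (image (sol2 C) (pair2 t u)),
      forall t, t \in keys 3 -> keys_in [:: emb2 cube] (image (sol3 C) (emb2 t))
    & forall t u, t \in F1 -> u \in F2 ->
        keys_in [:: emb2 cube] (image (sol3 C) (pair2 t u))] /\
  [/\ forall t, t \in F1 -> image (sol4 C) t = [::],
      {subset F1 <= keys 1} & {subset F2 <= keys 2}].
Proof.
have := certified C; rewrite /checks => /and4P[/allP c1 /allP c2 /allP c3].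
move=> /and5P[/allP c4 /allP c5 /allP c6 /allP c7 /allP c8].
split; split; [exact: c1 | exact: c2 | | exact: c4 | | | exact: c7 | exact: c8].
- by move=> t u t1 u1; have /allP := c3 t t1; apply.
- by move=> t u t1 u1; have /allP := c5 t t1; apply.
- by move=> t t1; apply/nilP/c6.
Qed.

Lemma free1_L1 t : t \in F1 -> Xk t \in L1.
Proof. by have [_ [_ c _]] := certifiedP; move=> /c/mem_entries. Qed.

Lemma span_rel L y : Rel y -> span L y.
Proof. exact: mspan_rel. Qed.

Lemma entries_gen w L c u : {subset entries w <= L} -> ev c = 0 ->
  u \in keys w -> span L (c * Xk u).
Proof. by move=> wL c0 uk; apply: mspan_gen => //; apply/wL/mem_entries. Qed.

Lemma sub_L2 : {subset entries 2 <= L2}.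
Proof. by move=> y y2; rewrite mem_cat y2 orbT. Qed.

Lemma sub_L3 : {subset entries 3 <= L3}.
Proof. by move=> y y2; rewrite mem_cat y2 orbT. Qed.

(** In a commutation relation of weight 1, one factor of each product has weight 0
or lies in the known row of the basis vector 1. *)
Lemma solution1 t : span L1 (Xk t - value Xk (image (sol1 C) t)).
Proof.
move: t; rewrite sol1E; apply: (solve_sound hk (sub_span L1)).
have relP := @span_rel L1.
have genP c u : ev c = 0 -> u \in keys 1 -> span L1 (c * Xk u).
  exact: entries_gen.
rewrite /rows1; apply: vanish_cat; first exact: basis_rows_vanish.
apply: vanish_cat; first exact: sym_rows_vanish.
apply: vanish_cat.
  apply: (@comm_rows_vanish 1 _ (sub_span L1)) => //.
  move=> u v a m b _ _ /andP[a0 _] /andP[m0 _] _; move: (deg_le2 b).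
  by case/orP: (deg_gt0 a0) => /eqP->; case/orP: (deg_gt0 m0) => /eqP->;
     case: (deg b) => [|[|[|]]].
apply: vanish_map => i; rewrite mem_iota => /andP[_ i6]; apply: relP.
have := X_trace i6.
rewrite (_ : iota 0 13 = 0%N :: linear_range ++ quadric_range) // big_cons.
have : Rel (X i 0 0) by have := X_one (b := 0%N) i6 isT; rewrite subr0.
move=> /(idealN idRel) r0 /(idealD idRel r0); rewrite addKr.
rewrite /value big_map; congr (Rel _); apply: eq_bigr => a _.
by rewrite unit_scalar scale1r.
Qed.

Lemma form1E t w : t \in keys w -> lookup [::] (tab1 C) t = image (sol1 C) t.
Proof.
case: t => [[i a] b]; rewrite mem_keys => /and4P[_ i6 /andP[_ a13] b13].
by rewrite tab1E lookup_tabulate.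
Qed.

Definition x2 (t : key2) : R :=
  match t with inl u => Xk u | inr (u, v) => Xk u * Xk v end.

(** In weight 2, the remaining products have two factors of weight 1, each a
combination of the t_j modulo m L1; this is enough modulo m L2, because L1 L1 is
contained in L2. *)
Lemma solution2 t : span L2 (x2 t - value x2 (image (sol2 C) t)).
Proof.
move: t; rewrite sol2E; apply: (solve_sound hk (sub_span L2)).
have relP := @span_rel L2.
have genP c u : ev c = 0 -> u \in keys 2 -> span L2 (c * Xk u).
  exact: entries_gen sub_L2.
have prP u v a m b : (u < 6)%N -> (v < 6)%N -> (0 < a < 13)%N ->
    (0 < m < 13)%N -> (b < 13)%N -> (deg a).+2 = (deg b + 2)%N ->
    deg m <> (deg a).+1 -> deg b <> (deg m).+1 ->
  span L2 (Xk (u, a, m) * Xk (v, m, b) -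
    value x2 (pr2 (lookup [::] (tab1 C)) (u, a, m) (v, m, b))).
  move=> u6 v6 a13 m13 b13 degw dm db.
  have [dam dmb] : deg a = deg m /\ deg m = deg b.
    have dab : deg a = deg b by move: degw; rewrite addn2 => -[].
    have [/andP[a0 _] /andP[m0 _]] := (a13, m13); rewrite -dab in db *.
    by case/orP: (deg_gt0 a0) dm db => /eqP->; case/orP: (deg_gt0 m0) => /eqP->.
  have a1 : (u, a, m) \in keys 1.
    by rewrite mem_keys dam addn1 eqxx u6 a13; case/andP: m13.
  have m1 : (v, m, b) \in keys 1 by rewrite mem_keys dmb addn1 eqxx v6 m13.
  rewrite (value_prod_forms _ _ (x := Xk) (y := Xk)) // !(form1E (w := 1)) //.
  have [[c _ _ _ _] [_ F1k _]] := certifiedP.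
  apply: (prod_cong (sub_span L2) (solution1 _) (solution1 _) (c _ a1)).
    move=> y y1; apply: mspan_mul y1 _ => // g g1; apply: mul_L2 => //.
    exact: mem_entries.
  move=> t y /free1_L1 t1 y1; rewrite mulrC; apply: mspan_mul y1 _ => // g g1.
  by rewrite mulrC; apply: mul_L2.
rewrite /rows2; apply: vanish_cat; first exact: basis_rows_vanish.
apply: vanish_cat; first exact: sym_rows_vanish.
apply: vanish_cat.
  apply: vanish_map => -[u v] _; rewrite !value_cons value_nil addr0.
  rewrite unit_scalar scalar_int /Zscalar /= scaleN1r scale1r mulrC subrr.
  by apply: relP; apply: ideal0.
by apply: vanish_cat; apply: (@comm_rows_vanish 2 _ (sub_span L2)).
Qed.

Lemma near1 y : y \in L1 -> near (span L1) [seq Xk t | t <- F1] y.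
Proof.
move=> /mapP[t t1 ->]; have [[c _ _ _ _] _] := certifiedP.
exact: near_form (solution1 t) (c t t1).
Qed.

Lemma near2_form t : keys_in (map emb2 F2) (image (sol2 C) t) ->
  near (span L2) [seq Xk v | v <- F2] (x2 t).
Proof.
by move=> /(near_form (solution2 t)); rewrite -map_comp.
Qed.

Lemma near2 y : y \in L2 -> near (span L2) [seq Xk v | v <- F2] y.
Proof.
have [[_ c2 c11 _ _] _] := certifiedP.
have nS := near_subspace (span L2) [seq Xk v | v <- F2].
rewrite mem_cat => /orP[|/mapP[t t2 ->]]; last exact: (near2_form (c2 t t2)).
move=> /allpairsP[[y1 z1] /= [y1L z1L ->]].
have yz1 u : span L1 u -> span L2 (u * z1).
  by move=> u1; apply: mspan_mul u1 _ => // g g1; apply: mul_L2.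
apply: (near1 y1L (subspace_mul z1 nS)) => [u /yz1|_ /mapP[t t1 ->]].
  exact: near_sub.
have tz u : span L1 u -> span L2 (Xk t * u).
  move=> u1; rewrite mulrC; apply: mspan_mul u1 _ => // g g1.
  by rewrite mulrC; apply: mul_L2 => //; apply: free1_L1.
apply: (near1 z1L (subspace_mulr (Xk t) nS)) => [u /tz|_ /mapP[u u1 ->]].
  exact: near_sub.
exact: (near2_form (t := pair2 t u) (c11 t u t1 u1)).
Qed.

Lemma value_drop_pairs f : keys_in (map emb2 F2) f ->
  value Xk (drop_pairs f) = value x2 f.
Proof.
elim: f => [|[t c] f IHf] /=; first by rewrite !value_nil.
move=> /andP[/mapP[u _ ->] /IHf e].
by rewrite [RHS]value_cons -e /drop_pairs /= value_cons.
Qed.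

Lemma form2E t : t \in keys 2 ->
  lookup [::] (tab2 C) t = drop_pairs (image (sol2 C) (emb2 t)).
Proof.
case: t => [[i a] b]; rewrite mem_keys => /and4P[_ i6 /andP[_ a13] b13].
by rewrite tab2E lookup_tabulate.
Qed.

Lemma solution3 t : span L3 (x2 t - value x2 (image (sol3 C) t)).
Proof.
move: t; rewrite sol3E; apply: (solve_sound hk (sub_span L3)).
have relP := @span_rel L3.
have genP c u : ev c = 0 -> u \in keys 3 -> span L3 (c * Xk u).
  exact: entries_gen sub_L3.
have pr12 t u : t \in keys 1 -> u \in keys 2 -> 
  span L3 (Xk t * Xk u - value x2 (prod_forms pair2
    (lookup [::] (tab1 C) t) (lookup [::] (tab2 C) u))).
  move=> t1 u2; have [[c c' _ _ _] [_ F1k _]] := certifiedP.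
  rewrite (value_prod_forms _ _ (x := Xk) (y := Xk)) //.
  rewrite (form1E t1) (form2E u2).
  have e : span L2 (Xk u - value Xk (drop_pairs (image (sol2 C) (emb2 u)))).
    by rewrite (value_drop_pairs (c' u u2)); apply: (solution2 (emb2 u)).
  apply: (prod_cong (sub_span L3) (solution1 t) e (c _ t1)).
    move=> y y1; apply: mspan_mul y1 _ => // g g1; apply: mul_L3 => //.
    exact: entries_L2.
  move=> v y /free1_L1 v1 y1; rewrite mulrC; apply: mspan_mul y1 _ => // g g1.
  by rewrite mulrC; apply: mul_L3.
have prP u v a m b : (u < 6)%N -> (v < 6)%N -> (0 < a < 13)%N ->
    (0 < m < 13)%N -> (b < 13)%N -> (deg a).+2 = (deg b + 3)%N ->
    deg m <> (deg a).+1 -> deg b <> (deg m).+1 ->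
  span L3 (Xk (u, a, m) * Xk (v, m, b) - value x2
    (pr3 (lookup [::] (tab1 C)) (lookup [::] (tab2 C)) (u, a, m) (v, m, b))).
  move=> u6 v6 a13 m13 b13 degw dm db; rewrite /pr3 /=.
  have dab : deg a = (deg b).+1 by move: degw; rewrite addn3 => -[].
  have [/andP[a0 _] /andP[m0 m13']] := (a13, m13).
  case: eqP => [dam|dam].
    apply: pr12; rewrite mem_keys ?u6 ?v6 ?a13 ?m13 ?m13' ?b13.
      by rewrite dam addn1 eqxx.
    by rewrite -dam dab addn2 eqxx.
  have dmb : deg m = deg b.
    move: dm db dab dam; case/orP: (deg_gt0 a0) => /eqP->.
      by case/orP: (deg_gt0 m0) => /eqP->.
    by case/orP: (deg_gt0 m0) => /eqP-> // _ _ [].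
  rewrite mulrC; apply: pr12; rewrite mem_keys ?u6 ?v6 ?a13 ?m13 ?m13' ?b13.
    by rewrite dmb addn1 eqxx.
  by rewrite dab dmb addn2 eqxx.
by rewrite /rows3; apply: vanish_cat; apply: (@comm_rows_vanish 3 _ (sub_span L3)).
Qed.

Lemma near3_form t : keys_in [:: emb2 cube] (image (sol3 C) t) ->
  near (span L3) [:: Xk cube] (x2 t).
Proof. exact: near_form (solution3 t). Qed.

Lemma near3 y : y \in L3 -> near (span L3) [:: Xk cube] y.
Proof.
have [[_ _ _ c3 c12] _] := certifiedP.
have nS := near_subspace (span L3) [:: Xk cube].
rewrite mem_cat => /orP[|/mapP[t t3 ->]]; last exact: (near3_form (c3 t t3)).
move=> /allpairsP[[y1 z2] /= [y1L z2L ->]].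
have yz u : span L1 u -> span L3 (u * z2).
  by move=> u1; apply: mspan_mul u1 _ => // g g1; apply: mul_L3.
apply: (near1 y1L (subspace_mul z2 nS)) => [u /yz|_ /mapP[t t1 ->]].
  exact: near_sub.
have tz u : span L2 u -> span L3 (Xk t * u).
  move=> u1; rewrite mulrC; apply: mspan_mul u1 _ => // g g1.
  by rewrite mulrC; apply: mul_L3 => //; apply: free1_L1.
apply: (near2 z2L (subspace_mulr (Xk t) nS)) => [u /tz|_ /mapP[u u2 ->]].
  exact: near_sub.
exact: (near3_form (t := pair2 t u) (c12 t u t1 u2)).
Qed.

Lemma value_cube t f : keys_in [:: emb2 cube] f ->
  value (fun u => Xk u * Xk cube) [seq (t, u.2) | u <- f] = Xk t * value x2 f.
Proof.
elim: f => [|[u c] f IHf] /=; first by rewrite !value_nil mulr0.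
rewrite mem_seq1 => /andP[/eqP-> /IHf e].
by rewrite !value_cons e mulrDr /= scalerAr.
Qed.

(** This is the step that uses the associativity of the products
t_i t_j v_l. *)
Lemma solution4 t : t \in F1 -> span L4 (Xk t * Xk cube).
Proof.
have [[_ _ _ _ c12] [c4 _ _]] := certifiedP.
move=> /c4 s4; have : sound (span L4) (fun u => Xk u * Xk cube) (sol4 C).
  rewrite sol4E; apply: (solve_sound hk (sub_span L4)); apply: vanish_map.
  move=> [[i j] l]; rewrite !mem_pairs => /andP[/andP[iF jF] lF].
  rewrite value_cat; set f := image _ (pair2 j l); set g := image _ (pair2 i l).
  have -> : [seq (j, Qopp u.2) | u <- g] =
            [seq (u.1, Qopp u.2) | u <- [seq (j, u.2) | u <- g]].
    by rewrite -map_comp.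
  rewrite value_opp !value_cube ?c12 //.
  have L4cong u v h : u \in F1 -> span L3 (x2 v - value x2 h) ->
      span L4 (Xk u * x2 v - Xk u * value x2 h).
    move=> /free1_L1 u1 hv; rewrite -mulrBr mulrC; apply: mspan_mul hv _ => // y yL.
    by rewrite mulrC; apply: mem_pairwise.
  have [_ LD LZ] := sub_span L4.
  have := LD _ _ (LZ (-1) _ (L4cong i _ _ iF (solution3 (pair2 j l))))
    (L4cong j _ _ jF (solution3 (pair2 i l))).
  by rewrite scaleN1r opprB /= [Xk j * (_ * _)]mulrCA addrA subrK.
by move=> /(_ t); rewrite s4 value_nil subr0.
Qed.

Lemma near4 y : y \in L4 -> span L4 y.
Proof.
move=> /allpairsP[[y1 z3] /= [y1L z3L ->]].
have yz u : span L1 u -> span L4 (u * z3).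
  by move=> u1; apply: mspan_mul u1 _ => // g g1; apply: mem_pairwise.
apply: (near1 y1L (subspace_mul z3 (sub_span L4)) yz) => _ /mapP[t t1 ->].
have tz u : span L3 u -> span L4 (Xk t * u).
  move=> u1; rewrite mulrC; apply: mspan_mul u1 _ => // g g1.
  by rewrite mulrC; apply: mem_pairwise => //; apply: free1_L1.
apply: (near3 z3L (subspace_mulr (Xk t) (sub_span L4)) tz) => u.
by rewrite mem_seq1 => /eqP->; apply: solution4.
Qed.

Lemma weight1_nilpotent : exists h, ev h = 1 /\
  forall t, t \in keys 1 -> Rel (h * Xk t ^+ 4).
Proof.
have [h [h1 hL]] := nakayama idRel near4.
exists h; split=> // t /mem_entries t1; apply: hL.
rewrite !exprS expr0 mulr1 /L4; apply: mem_pairwise => //; apply: mul_L3 => //.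
exact: mul_L2.
Qed.

End Graded.

(** * Multiplication matrices on a chart *)

Section MultiplicationMatrices.

Variables (n r : nat) (lam : 'I_r -> 'X_{1..n}) (A : comNzRingType).
Variable J : {mpoly A[n]} -> Prop.
Hypothesis chJ : chart lam J.

Lemma lcoordX a : lcoord lam J 'X_[lam a] = delta_mx 0 a.
Proof. by rewrite -lcomb_delta lcoord_lcomb. Qed.

(** Multiplication matrices act on row vectors, from the right. *)
Lemma lcoord_mulX i p : lcoord lam J ('X_i * p) = lcoord lam J p *m mult_mx lam J i.
Proof.
have idJ := chart_ideal chJ; have [h hE] := linear_of (lcoord_linear chJ).
have -> : lcoord lam J ('X_i * p) = lcoord lam J ('X_i * lcomb lam (lcoord lam J p)).
  apply: (lcoord_uniq chJ); set q := 'X_i * lcomb _ _.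
  have -> : 'X_i * p - lcomb lam (lcoord lam J q) =
      'X_i * (p - lcomb lam (lcoord lam J p)) + (q - lcomb lam (lcoord lam J q)).
    by rewrite mulrBr addrA subrK.
  by apply: idealD => //; [apply: idealM => //|]; exact: lcoordP.
set c := lcoord _ _ p; rewrite /lcomb mulr_sumr -hE linear_sum mulmx_sum_row.
apply: eq_bigr => a _; rewrite -scalerAr linearZ hE; congr (_ *: _).
by apply/rowP=> b; rewrite !mxE.
Qed.

Lemma mult_mx_comm i j :
  mult_mx lam J i *m mult_mx lam J j = mult_mx lam J j *m mult_mx lam J i.
Proof.
apply/row_matrixP => a; rewrite !row_mul !rowE -!lcoordX -!lcoord_mulX.
by rewrite mulrCA.
Qed.

End MultiplicationMatrices.

(** * Translation to trace zero *)

(** The monomials 1, x_i and q_l. *)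
Definition lam13 (a : 'I_13) : 'X_{1..6} :=
  if (a == 0 :> nat)%N then 0%MM else
  if (a <= 6)%N then U_(inord a.-1)%MM else
  (U_(inord (factors (a - 7)).1) + U_(inord (factors (a - 7)).2))%MM.

Section Translation.

Variables (k : fieldType) (hk : [pchar k] =i pred0).

Section Definitions.

Variables (A : comAlgType k) (C : 'I_6 -> 'M[A]_13).

Definition centered (i : nat) : 'M[A]_13 :=
  C (inord i) - ((13%:R^-1 : k) *: \tr (C (inord i)))%:M.

(** The coordinates of 1, y_i and of the products of the y_i that correspond to the
q_l, where y_i = x_i - tr(x_i) / 13 acts by the matrix centered i. *)
Definition frame_row (a : nat) : 'rV[A]_13 :=
  if (a == 0)%N then delta_mx 0 0 else
  if (a <= 6)%N then delta_mx 0 0 *m centered a.-1 else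
  delta_mx 0 0 *m centered (factors (a - 7)).2 *m centered (factors (a - 7)).1.

Definition frame : 'M[A]_13 := \matrix_a frame_row a.

(** The change of basis has determinant 1, so that its adjugate is its inverse. *)
Definition normalized (i : nat) : 'M[A]_13 :=
  frame *m centered i *m \adj frame.

Definition normalized_entry (i a b : nat) : A := normalized i (inord a) (inord b).

End Definitions.

Lemma map_normalized (A B : comAlgType k) (f : {rmorphism A -> B}) :
  (forall (c : k) x, f (c *: x) = c *: f x) -> forall (C : 'I_6 -> 'M[A]_13) i a b,
  f (normalized_entry C i a b) = normalized_entry (fun j => map_mx f (C j)) i a b.
Proof.
move=> fZ C i a b.
have cE j : map_mx f (centered C j) = centered (fun j => map_mx f (C j)) j.
  by rewrite /centered map_mxB map_scalar_mx fZ -trace_map_mx.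
have rE j : map_mx f (frame_row C j) = frame_row (fun j => map_mx f (C j)) j.
  rewrite /frame_row; case: ifP => _; first by rewrite map_delta_mx.
  by case: ifP => _; rewrite !map_mxM map_delta_mx !cE.
have fE : map_mx f (frame C) = frame (fun j => map_mx f (C j)).
  by apply/row_matrixP => j; rewrite -map_row !rowK.
by rewrite /normalized_entry /normalized -fE -cE -map_mx_adj -!map_mxM [RHS]mxE.
Qed.

Section Framed.

Variables (A : comAlgType k) (C : 'I_6 -> 'M[A]_13).

Local Notation e := (fun a => delta_mx 0 (inord a) : 'rV[A]_13).

(** The relations between matrices on which the normalisation relies. *)
Definition framed := [/\ forall i j, C i *m C j = C j *m C i,
  forall i, (i < 6)%N -> e 0%N *m C (inord i) = e i.+1
  & forall l, (l < 6)%N ->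
    e (factors l).2.+1 *m C (inord (factors l).1) = e (7 + l)%N].

Hypothesis framedC : framed.

Local Notation D := (centered C).
Local Notation s := (fun i => (13%:R^-1 : k) *: \tr (C (inord i))).

Lemma factors_lt l : ((factors l).1 < 6)%N && ((factors l).2 < 6)%N.
Proof. by rewrite /factors; do 7?[case: l => [|l] //]. Qed.

Lemma lt13 i : (i < 6)%N -> (i.+1 < 13)%N.
Proof. by move=> i6; rewrite ltnS (leq_trans i6). Qed.

Lemma centered_comm i j : D i *m D j = D j *m D i.
Proof.
have [comC _ _] := framedC.
apply: comm_mxB; last exact: comm_mx_scalar.
apply/comm_mx_sym/comm_mxB; last exact: comm_mx_scalar.
exact: comC.
Qed.

Lemma centered_one i : (i < 6)%N -> e 0%N *m D i = e i.+1 - s i *: e 0%N.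
Proof.
by have [_ oneC _] := framedC => i6; rewrite mulmxBr oneC // mul_mx_scalar.
Qed.

Lemma e_coef a (b : 'I_13) : (a < 13)%N -> e a 0 b = (b == a :> nat)%:R.
Proof. by move=> a13; rewrite mxE eqxx /= -val_eqE /= inordK. Qed.

(** Translation only adds monomials of smaller degree: the change of basis is
unitriangular. *)
Lemma frame_row_upper a (b : 'I_13) : (a < 13)%N -> (a <= b)%N ->
  frame_row C a 0 b = (b == a :> nat)%:R.
Proof.
have e0 : delta_mx 0 0 = e 0%N by congr (delta_mx 0 _); apply/val_inj; rewrite /= inordK.
have [_ _ basisC] := framedC.
rewrite /frame_row; have [->|a0] := eqVneq a 0%N => a13 ab.
  by rewrite e0 e_coef.
rewrite e0; case: ifP => a6.
  have i6 : (a.-1 < 6)%N by case: a a0 a6 {a13 ab}.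
  have b0 : (0 < b)%N by rewrite (leq_trans _ ab) // lt0n.
  rewrite centered_one // prednK ?lt0n // !mxE !eqxx /= -!val_eqE /= !inordK //.
  by rewrite (gtn_eqF b0) !mulr0n mulr0 subr0.
have a7 : (7 <= a)%N by rewrite ltnNge a6.
have l6 : (a - 7 < 6)%N by rewrite ltn_subLR.
have /andP[f1 f2] := factors_lt (a - 7).
have lt7 i : (i < 7)%N -> (i < b)%N by move=> i7; rewrite (leq_trans i7) ?(leq_trans a7).
rewrite centered_one // mulmxBl -scalemxAl centered_one //.
rewrite [e _ *m D _]mulmxBr basisC // subnKC // mul_mx_scalar.
rewrite !mxE eqxx /= -!val_eqE /= !inordK ?(lt13 f1) ?(lt13 f2) //.
rewrite (gtn_eqF (lt7 (factors (a - 7)).1.+1 f1)).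
rewrite (gtn_eqF (lt7 (factors (a - 7)).2.+1 f2)) (gtn_eqF (lt7 0%N _)) //.
by rewrite !mulr0n !mulr0 !subr0 mulr0 subr0.
Qed.

Lemma frame_det : \det (frame C) = 1.
Proof.
rewrite det_trig; last first.
  apply/is_trig_mxP => a b ab; rewrite mxE frame_row_upper ?(ltnW ab) //.
  by rewrite gtn_eqF.
by apply: big1 => a _; rewrite mxE frame_row_upper // eqxx.
Qed.

Lemma frameK : frame C *m \adj (frame C) = 1%:M.
Proof. by rewrite mul_mx_adj frame_det. Qed.

Lemma adj_frameK : \adj (frame C) *m frame C = 1%:M.
Proof. by rewrite mul_adj_mx frame_det. Qed.

Local Notation X := (normalized_entry C).

Lemma entry_row (M : 'M[A]_13) a b : M (inord a) (inord b) = (e a *m M) 0 (inord b).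
Proof. by rewrite -rowE mxE. Qed.

Lemma e_frame a : (a < 13)%N -> e a *m frame C = frame_row C a.
Proof. by move=> a13; rewrite -rowE rowK inordK. Qed.

Lemma frame_row_adj a : (a < 13)%N -> frame_row C a *m \adj (frame C) = e a.
Proof. by move=> a13; rewrite -e_frame // -mulmxA frameK mulmx1. Qed.

Lemma e_entry a b : (a < 13)%N -> (b < 13)%N -> e a 0 (inord b) = (b == a)%:R.
Proof.
by move=> a13 b13; rewrite mxE eqxx /= -val_eqE /= !inordK.
Qed.

Lemma normalized_one i b : (i < 6)%N -> (b < 13)%N -> X i 0 b = (b == i.+1)%:R.
Proof.
move=> i6 b13; have i13 := lt13 i6.
rewrite /normalized_entry entry_row !mulmxA e_frame // /frame_row /=.
have -> : delta_mx 0 0 *m D i = frame_row C i.+1 by rewrite /frame_row /= i6.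
by rewrite frame_row_adj // e_entry.
Qed.

Lemma normalized_sym i j b : (i < 6)%N -> (j < 6)%N -> (b < 13)%N ->
  X i j.+1 b = X j i.+1 b.
Proof.
move=> i6 j6 b13; rewrite /normalized_entry !entry_row !mulmxA.
rewrite !e_frame ?lt13 //.
rewrite /frame_row /= i6 j6 -!mulmxA; congr ((_ *m _) 0 _).
by rewrite !mulmxA centered_comm.
Qed.

Lemma normalized_basis l b : (l < 6)%N -> (b < 13)%N ->
  X (factors l).1 (factors l).2.+1 b = (b == 7 + l)%N%:R.
Proof.
move=> l6 b13; have /andP[f1 f2] := factors_lt l.
have l13 : (7 + l < 13)%N by rewrite (ltn_add2l 7 l 6).
rewrite /normalized_entry entry_row !mulmxA e_frame ?lt13 //.
have -> : frame_row C (factors l).2.+1 *m D (factors l).1 = frame_row C (7 + l).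
  by rewrite /frame_row addKn /= f2.
by rewrite frame_row_adj // e_entry.
Qed.

Lemma normalized_trace i : \tr (normalized C i) = 0.
Proof.
rewrite /normalized mxtrace_mulC mulmxA adj_frameK mul1mx /centered.
have c13 : 13%:R != 0 :> k.
  by have := Zscalar_pos hk 13; rewrite /Zscalar -[int_of_Z 13]/(13%:Z) -pmulrn.
rewrite raddfB /= mxtrace_scalar -scaler_nat scalerA mulfV // scale1r.
exact: subrr.
Qed.

Lemma normalized_comm i j : normalized C i *m normalized C j =
  normalized C j *m normalized C i.
Proof.
have mulE a b : normalized C a *m normalized C b =
    frame C *m (D a *m D b) *m \adj (frame C).
  rewrite /normalized -!mulmxA; congr (_ *m (_ *m _)).
  by rewrite !mulmxA adj_frameK mul1mx.
by rewrite !mulE centered_comm.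
Qed.

End Framed.

End Translation.

(** * Nilpotent functions on the chart *)

Lemma lam13_0 : lam13 (inord 0) = 0%MM.
Proof. by rewrite /lam13 inordK. Qed.

Lemma lam13_1 i : (i < 6)%N -> lam13 (inord i.+1) = U_(inord i)%MM.
Proof. by move=> i6; rewrite /lam13 inordK ?lt13 //= ifT. Qed.

Lemma lam13_2 l : (l < 6)%N ->
  lam13 (inord (7 + l)) = (U_(inord (factors l).1) + U_(inord (factors l).2))%MM.
Proof.
move=> l6; rewrite /lam13 inordK; last by rewrite (ltn_add2l 7 l 6).
by rewrite addnC addnK addnC.
Qed.

Lemma sum_iota (V : nmodType) n (F : nat -> V) :
  \sum_(a <- iota 0 n) F a = \sum_(a < n) F a.
Proof. by rewrite -(big_mkord xpredT) /index_iota subn0. Qed.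

Lemma comm_entries (A : nzRingType) n (M N : 'M[A]_n) : M *m N = N *m M ->
  forall a b, \sum_m (M a m * N m b - N a m * M m b) = 0.
Proof.
by move=> /matrixP MN a b; have := MN a b; rewrite !mxE sumrB => ->; rewrite subrr.
Qed.

Lemma rmorph_commutator (A B : nzRingType) (f : {rmorphism A -> B}) x y z t :
  f (x * y - z * t) = f x * f y - f z * f t.
Proof. by rewrite rmorphB !rmorphM. Qed.

Section UniversalEntries.

Variables (k : fieldType) (hk : [pchar k] =i pred0).

Lemma mult_mx_framed (A : comAlgType k) (J : {mpoly A[6]} -> Prop) :
  chart lam13 J -> @framed k A (mult_mx lam13 J).
Proof.
move=> chJ; have rowE a i : delta_mx 0 (inord a) *m mult_mx lam13 J i =
    lcoord lam13 J ('X_i * 'X_[lam13 (inord a)]).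
  by rewrite -rowE; apply/rowP=> b; rewrite !mxE.
split=> [i j|i i6|l l6]; first exact: mult_mx_comm.
  by rewrite rowE lam13_0 mpolyX0 mulr1 -lam13_1 // lcoordX.
have /andP[f1 f2] := factors_lt l.
by rewrite rowE lam13_1 // -mpolyXD -lam13_2 // lcoordX.
Qed.

Local Notation R0 := (entry_poly k 6 13).

(** Normalisation commutes with ring maps, so that the normalised entries are the
values of polynomials: those obtained from the generic matrices. *)
Lemma universal_entries : exists U : nat -> nat -> nat -> R0,
  forall (A : comAlgType k) (J : {mpoly A[6]} -> Prop) i a b,
    chart_eval lam13 J (U i a b) = normalized_entry (k := k) (mult_mx lam13 J) i a b.
Proof.
exists (normalized_entry (@entry_var k 6 13)) => A J i a b.
rewrite map_normalized; last first.
  by move=> c x; rewrite -[RHS]mulr_algl; apply: mmapZ.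
by congr (normalized_entry _ i a b); apply: funext => j; apply: chart_eval_entry.
Qed.

Definition vanishing (P : R0) := forall (A : comAlgType k) (J : {mpoly A[6]} -> Prop),
  chart lam13 J -> chart_eval lam13 J P = 0.

Lemma vanishing_ideal : is_ideal vanishing.
Proof.
split=> [A J _|P Q vP vQ A J chJ|P Q vQ A J chJ]; first by rewrite rmorph0.
  by rewrite rmorphD /= vP // vQ // addr0.
by rewrite rmorphM /= vQ // mulr0.
Qed.

Variable I : {mpoly k[6]} -> Prop.
Hypothesis chI : @chart 6 13 lam13 k^o I.
Hypothesis modelI : forall i a b, (i < 6)%N -> (a < 13)%N -> (b < 13)%N ->
  @mult_mx 6 13 lam13 k^o I (inord i) (inord a) (inord b) = Zscalar k (model i a b).

Lemma model_trace i : (i < 6)%N -> \tr (@mult_mx 6 13 lam13 k^o I (inord i)) = 0.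
Proof.
move=> i6; apply: big1 => a _.
rewrite -[a]inord_val modelI //; have := ltn_ord a.
have : all (fun a => if model i a a is Z0 then true else false) (iota 0 13).
  by do 6?[case: i i6 => [|i] //].
move=> /allP h a13; have := h a; rewrite mem_iota => /(_ a13).
by case: (model i a a).
Qed.

(** The matrices of I have trace 0, hence are their own normalisation. *)
Lemma normalized_model i a b : (i < 6)%N -> (a < 13)%N -> (b < 13)%N ->
  normalized_entry (k := k) (@mult_mx 6 13 lam13 k^o I) i a b =
  Zscalar k (model i a b).
Proof.
move=> i6 a13 b13; set C := mult_mx _ _.
have framedC : @framed k k^o C := mult_mx_framed chI.
have cE j : (j < 6)%N -> centered C j = C (inord j).
  by move=> j6; rewrite /centered model_trace // scaler0 raddf0 subr0.
have [_ oneC basisC] := framedC.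
have e0 : delta_mx 0 0 = delta_mx 0 (inord 0) :> 'rV[k^o]_13.
  by congr (delta_mx 0 _); apply/val_inj; rewrite /= inordK.
have frame1 : frame C = 1%:M.
  apply/row_matrixP => c; rewrite rowK row1 /frame_row e0.
  rewrite -[in RHS](inord_val c); case: eqP => [->//|/eqP c0].
  case: ifP => c6.
    have j6 : (c.-1 < 6)%N by move: c0 c6; case: (nat_of_ord c).
    by rewrite cE // oneC // prednK // lt0n.
  have l6 : (c - 7 < 6)%N by rewrite ltn_subLR ?ltn_ord // ltnNge c6.
  have /andP[f1 f2] := factors_lt (c - 7).
  by rewrite !cE // oneC // basisC // subnKC // ltnNge c6.
by rewrite /normalized_entry /normalized frame1 mul1mx adj1 mulmx1 cE // modelI.
Qed.

Lemma nilpotent_entry (U : nat -> nat -> nat -> R0) :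
  (forall (A : comAlgType k) (J : {mpoly A[6]} -> Prop) i a b,
    chart_eval lam13 J (U i a b) = normalized_entry (k := k) (mult_mx lam13 J) i a b) ->
  exists h : R0, chart_eval (k := k) (A := k^o) lam13 I h = 1 /\
  forall i a b, (i < 6)%N -> (0 < a < 13)%N -> (b < 13)%N -> deg a = deg b ->
  vanishing (h * U i a b ^+ 4).
Proof.
move=> UE; pose ev : {rmorphism R0 -> k} :=
  [the {rmorphism R0 -> k^o} of chart_eval (k := k) (A := k^o) lam13 I].
have evZ (c : k) : ev c%:A = c.
  by rewrite -[c%:A]mul_mpolyC mulr1 /ev /= chart_evalC [LHS]mulr1.
have [||||||h [h1 hk4]] := @weight1_nilpotent k hk R0 vanishing vanishing_ideal ev evZ U.
- move=> i b i6 b13 A J chJ; rewrite rmorphB rmorph_nat /= UE.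
  by rewrite (normalized_one (mult_mx_framed chJ)) // subrr.
- move=> i j b i6 j6 b13 A J chJ; rewrite rmorphB /= !UE.
  by rewrite (normalized_sym (mult_mx_framed chJ)) // subrr.
- move=> l b l6 b13 A J chJ; rewrite rmorphB rmorph_nat /= UE.
  by rewrite (normalized_basis (mult_mx_framed chJ)) // subrr.
- move=> i i6 A J chJ; rewrite sum_iota rmorph_sum /=.
  rewrite -[RHS](normalized_trace hk (mult_mx_framed chJ) i) /mxtrace.
  apply: eq_bigr => a _.
  by rewrite UE /normalized_entry inord_val.
- move=> i j a b i6 j6 a13 b13 A J chJ; rewrite sum_iota rmorph_sum /=.
  have := comm_entries (normalized_comm (mult_mx_framed chJ) i j) (inord a) (inord b).
  move=> e; rewrite -[RHS]e.
  apply: eq_bigr => m _.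
  rewrite rmorph_commutator /= !UE.
  by rewrite /normalized_entry inord_val.
- move=> i a b i6 a13 b13; rewrite /ev /= UE.
  exact: normalized_model.
exists h; split=> // i a b i6 a13 b13 dab.
by apply: (hk4 (i, a, b)); rewrite mem_keys_of dab addn1 eqxx i6 a13.
Qed.

End UniversalEntries.

(** * Points given by commuting matrices *)

Section MatrixPoint.

Variables (n r : nat) (lam : 'I_r.+1 -> 'X_{1..n}) (A : comNzRingType).
Variables (D : 'I_n -> 'M[A]_r.+1) (e0 : 'rV[A]_r.+1).
Hypothesis commD : forall i j, GRing.comm (D i) (D j).

(** The row vector obtained from e0 when the variables act through commuting
matrices D_i: the coordinates of the monomial m. *)
Definition word (m : 'X_{1..n}) : 'rV[A]_r.+1 := e0 *m \prod_i D i ^+ m i.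

Lemma word0 : word 0%MM = e0.
Proof. by rewrite /word big1 ?mulmx1 // => i _; rewrite mnm0E expr0. Qed.

Lemma word_addU m i : word (U_(i) + m)%MM = word m *m D i.
Proof.
rewrite /word -mulmxA; congr (_ *m _); rewrite mulmxE.
have comm_prod (s : seq 'I_n) : GRing.comm (D i) (\prod_(j <- s) D j ^+ m j).
  by apply: commr_prod => j _; apply/commrX/commD.
have main (s : seq 'I_n) : \prod_(j <- s) D j ^+ (U_(i) + m)%MM j =
    (\prod_(j <- s) D j ^+ m j) * D i ^+ count_mem i s.
  elim: s => [|j s IHs]; first by rewrite !big_nil mulr1.
  rewrite !big_cons IHs mnmDE mnm1E exprD /=; set P := \prod_(_ <- _) _.
  have [<-|_] := eqVneq i j; last by rewrite expr0 mul1r add0n mulrA.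
  rewrite expr1 add1n exprS !mulrA; congr (_ * _).
  by rewrite -exprS exprSr -!mulrA (comm_prod s).
by rewrite main count_uniq_mem ?index_enum_uniq // mem_index_enum expr1.
Qed.

Definition point_coord : {mpoly A[n]} -> 'rV[A]_r.+1 := mlin word.

HB.instance Definition _ := GRing.Linear.copy point_coord (mlin word).

Lemma point_coordX m : point_coord 'X_[m] = word m.
Proof. exact: mlinX. Qed.

Lemma point_coord_mulX i p : point_coord ('X_i * p) = point_coord p *m D i.
Proof.
rewrite [p]mpolyE mulr_sumr !linear_sum mulmx_suml; apply: eq_bigr => m _.
rewrite -scalerAr !linearZ -scalemxAl /=; congr (_ *: _).
by rewrite -mpolyXD !point_coordX word_addU.
Qed.

(** The annihilator of e0, when polynomials act through the D_i. *)
Definition matrix_ideal (p : {mpoly A[n]}) : Prop := point_coord p = 0.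

Lemma matrix_ideal_ideal : is_ideal matrix_ideal.
Proof.
split=> [|p q p0 q0|c p]; first exact: raddf0.
  by rewrite /matrix_ideal raddfD /= p0 q0 addr0.
elim/mpoly_ring_ind: c p => [c|i|c d IHc IHd|c d IHc IHd] p p0; rewrite /matrix_ideal.
- by rewrite mul_mpolyC linearZ /= p0 scaler0.
- by rewrite point_coord_mulX p0 mul0mx.
- by rewrite mulrDl raddfD /= IHc // IHd // addr0.
- by rewrite -mulrA; apply: IHc; apply: IHd.
Qed.

Hypothesis wordE : forall a, word (lam a) = delta_mx 0 a.

Lemma point_coord_lcomb c : point_coord (lcomb lam c) = c.
Proof.
rewrite /lcomb linear_sum [RHS]row_sum_delta; apply: eq_bigr => a _.
by rewrite linearZ /= point_coordX wordE.
Qed.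

Lemma matrix_chart : chart lam matrix_ideal.
Proof.
split=> [|p|c]; first exact: matrix_ideal_ideal.
  by exists (point_coord p); rewrite /matrix_ideal raddfB /= point_coord_lcomb subrr.
by rewrite /matrix_ideal point_coord_lcomb.
Qed.

Lemma matrix_lcoord p : lcoord lam matrix_ideal p = point_coord p.
Proof.
apply: (lcoord_uniq matrix_chart).
by rewrite /matrix_ideal raddfB /= point_coord_lcomb subrr.
Qed.

Lemma matrix_mult_mx i : mult_mx lam matrix_ideal i = D i.
Proof.
apply/row_matrixP => a; apply/rowP=> b; rewrite !mxE matrix_lcoord.
by rewrite point_coord_mulX point_coordX wordE -rowE mxE.
Qed.

End MatrixPoint.

(** Two complements of the same free module are equal as soon as one contains the
other. *)
Lemma chart_sub_eq (n r : nat) (lam : 'I_r -> 'X_{1..n}) (A : comNzRingType)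
    (J J' : {mpoly A[n]} -> Prop) :
  chart lam J -> chart lam J' -> (forall p, J p -> J' p) -> same_set J' J.
Proof.
move=> chJ chJ' JJ' p; split=> [J'p|/JJ' //].
have idJ := chart_ideal chJ; have idJ' := chart_ideal chJ'.
have [_ /(_ p)[c Jc] _] := chJ; have [_ _ indep] := chJ'.
suff c0 : c = 0 by move: Jc; rewrite c0 raddf0 subr0.
apply: indep; rewrite -[lcomb lam c](subKr p); apply: idealB => //.
exact: JJ'.
Qed.

(** Both sides are points of the chart, so that one inclusion is enough. *)
Lemma matrix_ideal_map (n r : nat) (lam : 'I_r.+1 -> 'X_{1..n})
    (A B : comNzRingType) (f : {rmorphism A -> B})
    (D : 'I_n -> 'M[A]_r.+1) (D' : 'I_n -> 'M[B]_r.+1) (e0 : 'rV[A]_r.+1)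
    (e0' : 'rV[B]_r.+1) :
  (forall i j, GRing.comm (D i) (D j)) -> (forall i j, GRing.comm (D' i) (D' j)) ->
  (forall a, word D e0 (lam a) = delta_mx 0 a) ->
  (forall a, word D' e0' (lam a) = delta_mx 0 a) ->
  (forall i, map_mx f (D i) = D' i) -> map_mx f e0 = e0' ->
  same_set (matrix_ideal D' e0') (ideal_ext (map_mpoly f) (matrix_ideal D e0)).
Proof.
move=> comD comD' wD wD' fD fe.
have chD := matrix_chart comD wD; have chD' := matrix_chart comD' wD'.
apply: (chart_sub_eq _ chD').
  by apply: (chart_base_change (f := f) _ chD) => p.
have fword m : map_mx f (word D e0 m) = word D' e0' m.
  rewrite /word map_mxM fe; congr (_ *m _).
  rewrite (rmorph_prod (map_mx f)); apply: eq_bigr => i _.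
  by rewrite rmorphXn /= fD.
apply: ideal_gen_min; first exact: matrix_ideal_ideal.
move=> _ [p p0 ->]; rewrite /matrix_ideal.
have -> : point_coord D' e0' (map_mpoly f p) = map_mx f (point_coord D e0 p).
  rewrite {1}[p]mpolyE (raddf_sum (map_mpoly f)) linear_sum.
  rewrite [in RHS]/point_coord /mlin raddf_sum /=; apply: eq_bigr => m _.
  by rewrite map_mpolyZ map_mpolyX linearZ /= point_coordX -fword map_mxZ.
by rewrite p0 raddf0.
Qed.

(** * A first-order deformation *)

(** Turns the finitely many cases of a statement about indices into one
computation. *)
Lemma ltn_index (P : nat -> bool) n i : (i < n)%N -> all P (iota 0 n) -> P i.
Proof. by move=> i_n /allP; apply; rewrite mem_iota. Qed.

Definition Zsum (F : nat -> Z) (s : seq nat) : Z :=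
  foldr (fun m acc => Z.add (F m) acc) Z0 s.

Lemma Zscalar_sum (R : nzRingType) F s :
  Zscalar R (Zsum F s) = \sum_(m <- s) Zscalar R (F m).
Proof.
elim: s => [|m s IHs]; first by rewrite big_nil.
by rewrite big_cons ZscalarD IHs.
Qed.

Section DeformedModel.

Variables (A : comNzRingType) (eps : A).

Local Notation Zr := (Zscalar A).
Local Notation e := (fun a => delta_mx 0 (inord a) : 'rV[A]_13).

Definition model_mx (i : 'I_6) : 'M[A]_13 := \matrix_(a, b) Zr (model i a b).

(** The extra term says that x_i q_i = eps q_0. *)
Definition deformed_mx (i : 'I_6) : 'M[A]_13 :=
  model_mx i + eps *: delta_mx (inord (7 + i)) (inord 7).

Lemma model_mx_comm (i j : 'I_6) : model_mx i *m model_mx j = model_mx j *m model_mx i.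
Proof.
apply/matrixP=> a b; rewrite !mxE.
pose s i j a b := Zsum (fun m => Z.mul (model i a m) (model j m b)) (iota 0 13).
have sE (i' j' : 'I_6) :
    \sum_(m < 13) model_mx i' a m * model_mx j' m b = Zr (s i' j' a b).
  rewrite Zscalar_sum sum_iota; apply: eq_bigr => m _.
  by rewrite !mxE ZscalarM.
rewrite !sE; congr (Zr _).
have := ltn_ord i; have := ltn_ord j; have := ltn_ord a; have := ltn_ord b.
move: (nat_of_ord i) (nat_of_ord j) (nat_of_ord a) (nat_of_ord b).
move=> i' j' a' b' hb ha hj hi; apply/Z.eqb_eq.
pose check i j a b := Z.eqb (s i j a b) (s j i a b).
apply: (ltn_index (P := check i' j' a') hb).
pose check2 i j := all (fun a => all (check i j a) (iota 0 13)) (iota 0 13).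
apply: (ltn_index (P := fun a => all (check i' j' a) (iota 0 13)) ha).
apply: (ltn_index (P := check2 i') hj).
apply: (ltn_index (P := fun i => all (check2 i) (iota 0 6)) hi).
by vm_compute.
Qed.

Lemma model_row (i : 'I_6) a : (a < 13)%N -> (7 <= a)%N -> e a *m model_mx i = 0.
Proof.
move=> a13 a7; rewrite -rowE; apply/rowP=> b; rewrite !mxE inordK //.
by rewrite /model; case: a a7 {a13} => // a a7; rewrite /= leqNgt a7.
Qed.

(** The symmetry of the third derivatives of F. *)
Lemma model_mx_eps (i j : 'I_6) :
  model_mx i *m delta_mx (inord (7 + j)) (inord 7) =
  model_mx j *m delta_mx (inord (7 + i)) (inord 7) :> 'M_13.
Proof.
have h (l : 'I_6) : (7 + l < 13)%N by rewrite (ltn_add2l 7 l 6) ltn_ord.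
have mul_delta (M : 'M[A]_13) c d a b : (M *m delta_mx c d) a b = M a c * (b == d)%:R.
  rewrite mxE (bigD1 c) //= mxE eqxx big1 ?addr0 // => m mc.
  by rewrite mxE (negbTE mc) mulr0.
apply/matrixP=> a b; rewrite !mul_delta !mxE !inordK //; congr (Zr _ * _).
have := ltn_ord i; have := ltn_ord j; have := ltn_ord a.
move: (nat_of_ord i) (nat_of_ord j) (nat_of_ord a) => i' j' a' ha hj hi.
apply/Z.eqb_eq; pose check i j a := Z.eqb (model i a (7 + j)) (model j a (7 + i)).
apply: (ltn_index (P := check i' j') ha).
pose check1 i j := all (check i j) (iota 0 13).
apply: (ltn_index (P := check1 i') hj).
apply: (ltn_index (P := fun i => all (check1 i) (iota 0 6)) hi).
by vm_compute.
Qed.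

Hypothesis eps2 : eps * eps = 0.

Lemma deformed_mx_comm (i j : 'I_6) : GRing.comm (deformed_mx i) (deformed_mx j).
Proof.
have h (l : 'I_6) : (7 + l < 13)%N by rewrite (ltn_add2l 7 l 6) ltn_ord.
have mulE (i' j' : 'I_6) : deformed_mx i' *m deformed_mx j' = model_mx i' *m model_mx j' +
    eps *: (model_mx i' *m delta_mx (inord (7 + j')) (inord 7)).
  have rowd (M : 'M[A]_13) (c d : 'I_13) :
      delta_mx c d *m M = delta_mx c (0 : 'I_1) *m (delta_mx 0 d *m M).
    by rewrite mulmxA mul_delta_mx.
  rewrite /deformed_mx mulmxDl !mulmxDr -!scalemxAl -!scalemxAr.
  rewrite [X in eps *: X]rowd model_row // mulmx0 scaler0 add0r.
  by rewrite scalerA eps2 scale0r addr0.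
by rewrite /GRing.comm -!mulmxE !mulE model_mx_comm model_mx_eps.
Qed.

Lemma e_deformed_mx a (i : 'I_6) : (a < 13)%N ->
  e a *m deformed_mx i =
  \row_b (Zr (model i a b) + eps * ((a == 7 + i)%N && (b == 7 :> nat)%N)%:R).
Proof.
move=> a13; rewrite -rowE; apply/rowP=> b.
have h : (7 + i < 13)%N by rewrite (ltn_add2l 7 i 6) ltn_ord.
by rewrite !mxE inordK // -!val_eqE /= !inordK.
Qed.

Lemma e_model_one i : (i < 6)%N -> e 0%N *m deformed_mx (inord i) = e i.+1.
Proof.
move=> i6; rewrite e_deformed_mx //; apply/rowP=> b; rewrite !mxE /= !inordK //.
rewrite mulr0 addr0 -val_eqE /= inordK ?lt13 // /model /=.
by case: eqP.
Qed.

Lemma e_model_basis l : (l < 6)%N ->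
  e (factors l).2.+1 *m deformed_mx (inord (factors l).1) = e (7 + l)%N.
Proof.
move=> l6; have /andP[f1 f2] := factors_lt l.
rewrite e_deformed_mx ?lt13 //; apply/rowP=> b; rewrite !mxE /= !inordK //.
have l13 : (7 + l < 13)%N by rewrite (ltn_add2l 7 l 6).
have -> : ((factors l).2.+1 == 7 + (factors l).1)%N = false.
  by rewrite ltn_eqF // (leq_trans _ (leq_addr _ _)).
rewrite mulr0 addr0 -val_eqE /= inordK //.
have : model (factors l).1 (factors l).2.+1 b =
    if (b == 7 + l :> nat)%N then Zpos 1 else Z0.
  apply/Z.eqb_eq; have := ltn_ord b; move: (nat_of_ord b) => b' hb.
  pose check l b := Z.eqb (model (factors l).1 (factors l).2.+1 b)
    (if (b == 7 + l)%N then Zpos 1 else Z0).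
  apply: (ltn_index (P := check l) hb).
  apply: (ltn_index (P := fun l => all (check l) (iota 0 13)) l6).
  by vm_compute.
by move=> ->; case: eqP.
Qed.

(** The deformed products only concern monomials of degree three. *)
Lemma model_word a : word deformed_mx (e 0%N) (lam13 a) = delta_mx 0 a.
Proof.
have wE m (i : 'I_6) : word deformed_mx (e 0%N) (U_(i) + m)%MM =
    word deformed_mx (e 0%N) m *m deformed_mx i.
  by apply: word_addU; apply: deformed_mx_comm.
have w1 i : (i < 6)%N -> word deformed_mx (e 0%N) U_(inord i)%MM = e i.+1.
  by move=> i6; rewrite -[U_(_)%MM]addm0 wE word0 e_model_one.
have := ltn_ord a; rewrite -[in RHS](inord_val a) -{2}(inord_val a).
move: (nat_of_ord a) => {}a a13.
have [->|a0] := eqVneq a 0%N; first by rewrite lam13_0 word0.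
have [a6|a6] := leqP a 6.
  have i6 : (a.-1 < 6)%N by case: a a0 a6 {a13}.
  by rewrite -(prednK (_ : 0 < a)%N) ?lt0n // lam13_1 // w1.
have l6 : (a - 7 < 6)%N by rewrite ltn_subLR.
have /andP[f1 f2] := factors_lt (a - 7).
by rewrite -(subnKC a6) lam13_2 // wE w1 // e_model_basis.
Qed.

End DeformedModel.

(** * Derivatives of the cubic *)

Lemma mdeg_succ n (m : 'X_{1..n}) d : mdeg m = d.+1 ->
  exists i m', m = (U_(i) + m')%MM /\ mdeg m' = d.
Proof.
move=> md; have : m != 0%MM by rewrite -mdeg_eq0 md.
have [/forallP m0|/forallPn[i mi] _] := boolP [forall i, m i == 0%N].
  by case/eqP; apply/mnmP=> i; rewrite mnm0E; apply/eqP.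
have mE : m = (U_(i) + (m - U_(i)))%MM by rewrite addmC submK // lep1mP.
exists i, (m - U_(i))%MM; split=> //.
by move: md; rewrite {1}mE mdegD mdeg1 add1n => -[].
Qed.

Section CubicPartials.

Variable k : fieldType.

Local Notation S := {mpoly k[6]}.
Local Notation F := (cubicF k).
Local Notation x i := ('X_(inord i) : S).
Local Notation d i := (@mderiv 6 k (inord i)).

Lemma mderiv_var n (R : nzRingType) (i j : 'I_n) :
  mderiv i ('X_j : {mpoly R[n]}) = (i == j)%:R.
Proof.
rewrite mderivX mnm1E eq_sym; case: eqP => [->|_]; last by rewrite scale0r.
by rewrite scale1r -{1}[U_(j)%MM]add0m addmK mpolyX0.
Qed.

Lemma mderiv_x i j : (i < 6)%N -> (j < 6)%N -> d i (x j) = (i == j)%:R.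
Proof. by move=> i6 j6; rewrite mderiv_var -val_eqE /= !inordK. Qed.

Definition partial (i : nat) : S :=
  nth 0 [:: x 1 * x 3 - x 4 * x 4; x 0 * x 3 + x 2 * x 2;
            x 1 * x 2 *+ 2 + x 4 * x 5; x 0 * x 1 + x 5 * x 5;
            x 2 * x 5 - x 0 * x 4 *+ 2; x 2 * x 4 + x 3 * x 5 *+ 2] i.

Lemma mderiv_cubic i : (i < 6)%N -> d i F = partial i.
Proof.
move=> i6; rewrite /cubicF /= !expr2 !(mderivD, mderivN, mderivM) !mderiv_x //.
by do 6?[case: i i6 => [|i] i6 //]; rewrite /partial /=; ring.
Qed.

Lemma mderiv2_cubic i j : (i < 6)%N -> (j < 6)%N ->
  d i (d j F) = \sum_(l < 6) Zscalar k (cubic_tensor i j l) *: x l.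
Proof.
move=> i6 j6; rewrite mderiv_cubic // !big_ord_recl big_ord0 /bump.
have z0 (p : S) : Zscalar k Z0 *: p = 0 by exact: scale0r.
have z1 (p : S) : Zscalar k (Zpos 1) *: p = p by exact: scale1r.
have z2 (p : S) : Zscalar k (Zpos 2) *: p = p *+ 2 by exact: scaler_nat.
have z3 (p : S) : Zscalar k (Zneg 2) *: p = - (p *+ 2).
  by rewrite -scaler_nat -scaleNr.
by do 6?[case: j j6 => [|j] j6 //]; rewrite /partial /=;
  rewrite !(mderivD, mderivN, mderivMn, mderivM) !mderiv_x //;
  do 6?[case: i i6 => [|i] i6 //];
  rewrite /cubic_tensor /= ?(z0, z1, z2, z3); ring.
Qed.

End CubicPartials.

(** * The inverse system of the ideal *)

Lemma diff_act_ext n (R : comNzRingType) (F f : {mpoly R[n]}) :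
  diff_act f F = mlin (fun m => mderivm m F) f.
Proof. by []. Qed.

Lemma diff_actD n (R : comNzRingType) (F p q : {mpoly R[n]}) :
  diff_act (p + q) F = diff_act p F + diff_act q F.
Proof. exact: (raddfD (mlin (fun m => mderivm m F))). Qed.

Lemma diff_actZ n (R : comNzRingType) (F p : {mpoly R[n]}) c :
  diff_act (c *: p) F = c *: diff_act p F.
Proof. exact: (linearZZ (mlin (fun m => mderivm m F))). Qed.

Lemma diff_act1 n (R : comNzRingType) (F : {mpoly R[n]}) : diff_act 1 F = F.
Proof. by rewrite diff_act_ext -mpolyX0 mlinX mderivm0m. Qed.

Lemma diff_act_mulX n (R : comNzRingType) (F p : {mpoly R[n]}) i :
  diff_act ('X_i * p) F = mderiv i (diff_act p F).
Proof.
rewrite !diff_act_ext [p]mpolyE mulr_sumr linear_sum.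
rewrite [X in mderiv i X]linear_sum linear_sum; apply: eq_bigr => m _.
rewrite -scalerAr !linearZ /=; congr (_ *: _).
by rewrite -mpolyXD !mlinX addmC mderivmDm mderivmU1m.
Qed.

Section InverseSystem.

Variable k : fieldType.

Local Notation S := {mpoly k[6]}.
Local Notation F := (cubicF k).
Local Notation x i := ('X_(inord i) : S).
Local Notation D := (deformed_mx (0 : k)).
Local Notation e0 := (delta_mx 0 (inord 0) : 'rV[k]_13).

(** The images of the basis 1, x_i, q_l under p |-> p . F. *)
Definition derivative (a : nat) : S :=
  if (a == 0)%N then F else
  if (a <= 6)%N then mderiv (inord a.-1) F else x (a - 7).

Definition pairing (c : 'rV[k]_13) : S := \sum_(a < 13) c 0 a *: derivative a.

Lemma pairing_linear : linear pairing.
Proof.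
move=> a c d; rewrite /pairing scaler_sumr -big_split; apply: eq_bigr => i _.
by rewrite !mxE scalerDl scalerA.
Qed.

HB.instance Definition _ :=
  GRing.isLinear.Build k 'rV[k]_13 S *:%R pairing pairing_linear.

Lemma deformed_mx0 (i : 'I_6) a b : D i a b = Zscalar k (model i a b).
Proof. by rewrite /deformed_mx scale0r addr0 mxE. Qed.

Lemma mul_model (c : 'rV[k]_13) (i : 'I_6) b :
  (c *m D i) 0 b = \sum_(a < 13) c 0 a * Zscalar k (model i a b).
Proof. by rewrite mxE; apply: eq_bigr => a _; rewrite deformed_mx0. Qed.

Lemma sum13 (V : nmodType) (f : nat -> V) : \sum_(b < 13) f b =
  f 0%N + \sum_(j < 6) f j.+1 + \sum_(l < 6) f (7 + l)%N.
Proof.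
by rewrite !big_ord_recl !big_ord0 /bump /= !addr0 !addrA.
Qed.

(** Differentiation has the matrices of the model, up to the constants
d x_l / d x_i. *)
Lemma mderiv_derivative (i : 'I_6) a : (a < 13)%N ->
  mderiv i (derivative a) = \sum_(b < 13) Zscalar k (model i a b) *: derivative b
    + (a == 7 + i)%N%:R.
Proof.
move=> a13; rewrite (sum13 (fun b => Zscalar k (model i a b) *: derivative b)).
have s0 p : Zscalar k Z0 *: p = 0 :> S by exact: scale0r.
have s1 p : Zscalar k (Zpos 1) *: p = p :> S by exact: scale1r.
rewrite /model /derivative; have [->|a0] := eqVneq a 0%N.
  rewrite /= s0 add0r addr0 [X in _ + X]big1 => [|l _]; last first.
    by rewrite gtn_eqF ?s0 // (leq_trans _ (leq_addr l 7)) // ltnS.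
  rewrite addr0 (bigD1 i) //= eqxx s1 ltn_ord inord_val big1 ?addr0 // => j ji.
  by rewrite eqSS val_eqE (negbTE ji) s0.
rewrite /= andbF s0 add0r.
rewrite big1 ?add0r => [|j _]; last first.
  by rewrite [(7 <= j.+1)%N]leqNgt ltnS ltn_ord andbF s0.
have [a6|a7] := leqP a 6.
  rewrite ltn_eqF ?addr0 ?(leq_trans _ (leq_addr _ _)) //.
  have j6 : (a.-1 < 6)%N by case: a a0 a6 {a13}.
  rewrite -[i in LHS]inord_val mderiv2_cubic //; apply: eq_bigr => l _.
  by rewrite leq_addr addKn.
rewrite big1 => [|l _]; last by rewrite s0.
rewrite add0r -[i in LHS]inord_val mderiv_x //.
  by rewrite -(eqn_add2l 7) subnKC // eq_sym.
by rewrite ltn_subLR.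
Qed.

Lemma mderiv_pairing (i : 'I_6) c :
  mderiv i (pairing c) = pairing (c *m D i) + (c 0 (inord (7 + i)))%:MP.
Proof.
have h : (7 + i < 13)%N by rewrite (ltn_add2l 7 i 6) ltn_ord.
rewrite /pairing linear_sum.
under eq_bigr => a _ do rewrite linearZ /= mderiv_derivative // scalerDr.
rewrite big_split /=; congr (_ + _).
  under [RHS]eq_bigr => b _ do rewrite mul_model scaler_suml.
  rewrite exchange_big /=; apply: eq_bigr => a _.
  by rewrite scaler_sumr; apply: eq_bigr => b _; rewrite scalerA.
rewrite (bigD1 (inord (7 + i))) //= inordK // eqxx big1 ?addr0 => [|a ai].
  by rewrite -mul_mpolyC mulr1.
case: (a =P 7 + i :> nat)%N ai => [<-|_ _]; last by rewrite scaler0.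
by rewrite inord_val eqxx.
Qed.

Lemma D_comm (i j : 'I_6) : GRing.comm (D i) (D j).
Proof. by apply: deformed_mx_comm; rewrite mulr0. Qed.

Local Notation coord := (point_coord D e0).

(** Modulo constants, p . F only depends on the coordinates of p in the model. *)
Lemma diff_act_pairing p : exists c, diff_act p F = pairing (coord p) + c%:MP.
Proof.
pose V p := exists c, diff_act p F = pairing (coord p) + c%:MP.
have VZ c q : V q -> V (c *: q).
  move=> [d dE]; exists (c * d); rewrite diff_actZ.
  rewrite (linearZZ (point_coord D e0)) linearZZ /=.
  by rewrite dE scalerDr mpolyCM mul_mpolyC.
have VD q r : V q -> V r -> V (q + r).
  move=> [c cE] [d dE]; exists (c + d); rewrite diff_actD.
  by rewrite cE dE raddfD /= raddfD mpolyCD addrACA.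
have V1 : V 1.
  exists 0; rewrite diff_act1 -mpolyX0 point_coordX word0.
  rewrite /pairing mpolyC0 addr0 (bigD1 (inord 0)) //= mxE !eqxx scale1r inordK //.
  by rewrite big1 ?addr0 // => a a0; rewrite mxE (negbTE a0) andbF scale0r.
suff main q : V q -> V (p * q) by have := main 1 V1; rewrite mulr1.
elim/mpoly_ring_ind: p q => [c|i|p p' IHp IHp'|p p' IHp IHp'] q Vq.
- by rewrite mul_mpolyC; apply: VZ.
- have [c cE] := Vq; exists (coord q 0 (inord (7 + i))).
  rewrite diff_act_mulX cE mderivD mderivC addr0 mderiv_pairing.
  by rewrite (point_coord_mulX _ D_comm).
- by rewrite mulrDl; apply: VD; [apply: IHp | apply: IHp'].
- by rewrite -mulrA; apply: IHp; apply: IHp'.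
Qed.

Lemma derivative_at0 a : (a < 13)%N -> (derivative a).@[fun=> 0] = 0.
Proof.
move=> a13; rewrite /derivative; case: eqP => [_|/eqP a0].
  by rewrite /cubicF /= !expr2 !(mevalD, mevalN, mevalM, mevalXU); ring.
case: ifP => a6; last by rewrite mevalXU.
have: (a.-1 < 6)%N by case: a a0 a6 {a13}.
move: a.-1 => i i6; rewrite mderiv_cubic //.
by do 6?[case: i i6 => [|i] i6 //];
  rewrite /partial /= !(mevalD, mevalM, mevalN, mevalMn, mevalXU); ring.
Qed.

Lemma pairing_const c d : pairing c + d%:MP = 0 -> d = 0.
Proof.
move=> /(congr1 (meval (fun=> 0))); rewrite mevalD mevalC meval0 => <-.
rewrite /pairing raddf_sum /= big1 ?add0r // => a _.
by rewrite mevalZ derivative_at0 // mulr0.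
Qed.

(** Differentiating a vanishing combination yields another one, and its constant
term shows that the coefficients of the linear forms vanish.  Applied to the
derivatives, this gives the other coefficients: for the factors i and l of q_j,
T_ijl = 1 is the only nonzero T_iul. *)
Lemma pairing_inj c : pairing c = 0 -> c = 0.
Proof.
have step c' : pairing c' = 0 -> forall i : 'I_6,
    c' 0 (inord (7 + i)) = 0 /\ pairing (c' *m D i) = 0.
  move=> c'0 i; have := mderiv_pairing i c'; rewrite c'0 raddf0 => /esym e.
  have d0 := pairing_const e; split=> //.
  by move: e; rewrite d0 addr0.
have top c' : pairing c' = 0 -> forall l, (l < 6)%N -> c' 0 (inord (7 + l)) = 0.
  by move=> c'0 l l6; have [] := step _ c'0 (inord l); rewrite inordK.
have middle c' : pairing c' = 0 -> forall j, (j < 6)%N -> c' 0 (inord j.+1) = 0.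
  move=> c'0 j j6; have /andP[f1 f2] := factors_lt j.
  have [_ /top/(_ (factors j).2 f2)] := step _ c'0 (inord (factors j).1).
  have f13 : (7 + (factors j).2 < 13)%N by rewrite (ltn_add2l 7 _ 6).
  rewrite mul_model inordK // inordK // (bigD1 (inord j.+1)) //=.
  rewrite inordK ?lt13 // big1 => [|a aj].
    rewrite addr0 => <-; have -> : model (factors j).1 j.+1 (7 + (factors j).2) = Zpos 1.
      by move: (j) j6 => l; do 6?[case: l => [|l] //].
    by rewrite [RHS]mulr1.
  have -> : model (factors j).1 a (7 + (factors j).2) = Z0.
    have {aj} : (a != j.+1 :> nat)%N.
      by apply: contraNneq aj => e; rewrite -val_eqE /= inordK ?lt13 // e.
    have := ltn_ord a; move: (nat_of_ord a) (j) j6 => b l.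
    by do 6?[case: l => [|l] //] => _; do 13?[case: b => [|b] //].
  exact: mulr0.
move=> c0; apply/rowP=> a; rewrite [RHS]mxE -[a]inord_val; have := ltn_ord a.
move: (nat_of_ord a) => b b13.
have [->|b0] := eqVneq b 0%N; last first.
  have [b6|b7] := leqP b 6.
    rewrite -(prednK (_ : 0 < b)%N) ?lt0n //; apply: middle => //.
    by case: b b0 b6 {b13}.
  by rewrite -(subnKC b7); apply: top; rewrite // ltn_subLR.
have [_ /middle/(_ 0%N isT)] := step _ c0 (inord 0).
rewrite mul_model !inordK // (bigD1 (inord 0)) //= big1 => [|a0 aj].
  by rewrite addr0 inordK // [LHS]mulr1.
rewrite /model ifN_eq; last by apply: contraNneq aj => e; rewrite -val_eqE /= inordK // e.
by rewrite andbF [LHS]mulr0.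
Qed.

(** Each variable raises the degree: the support moves from the indices >= 0 to
those >= 1, then >= 7, then >= 13. *)
Definition starts_at (s : nat) (c : 'rV[k]_13) :=
  forall b : 'I_13, (b < s)%N -> c 0 b = 0.

Lemma starts_at_mul (s t : nat) c (i : 'I_6) :
  (forall b a, (b < t)%N -> (s <= a < 13)%N -> model i a b = Z0) ->
  starts_at s c -> starts_at t (c *m D i).
Proof.
move=> st sc b bt; rewrite mul_model big1 // => a _.
have [as_|sa] := ltnP a s; first by rewrite sc // mul0r.
by rewrite st // ?sa ?ltn_ord // [LHS]mulr0.
Qed.

Lemma word_degree3 m : (3 <= mdeg m)%N -> word D e0 m = 0.
Proof.
case E: (mdeg m) => [|[|[|d]]] // _.
have [i [m1 [-> /mdeg_succ[j [m2 [-> /mdeg_succ[l [m3 [-> _]]]]]]]]] := mdeg_succ E.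
rewrite !(word_addU _ D_comm); apply/rowP=> b; rewrite [RHS]mxE.
apply: (@starts_at_mul 7 13) (ltn_ord b) => [{}b a _ /andP[a7 _]|].
  by rewrite /model [(a <= 6)%N]leqNgt a7; case: a a7.
apply: (@starts_at_mul 1 7) => [{}b a b7 /andP[a0 _]|].
  by rewrite /model [(7 <= b)%N]leqNgt b7 andbF; case: a a0.
apply: (@starts_at_mul 0 1) => [[|//] a _ _|//].
by rewrite /model andbF; case: ifP.
Qed.

(** A polynomial with zero coordinates acts on F by a constant; subtracting that
multiple of x_0 x_1 x_3, which acts on F by 1, makes it apolar to F. *)
Lemma idealI_model p : idealI p <-> matrix_ideal D e0 p.
Proof.
have deg3 q : degree_ge 3 q -> coord q = 0.
  move=> q3; rewrite [q]mpolyE linear_sum big_seq big1 // => m mq.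
  by rewrite linearZ /= point_coordX word_degree3 ?scaler0 // q3.
split=> [[q [h [q0 h3 ->]]]|p0].
  rewrite /matrix_ideal raddfD /= (deg3 h) // addr0; apply: pairing_inj.
  have [c] := diff_act_pairing q; rewrite q0 => /esym e.
  by move: e (pairing_const e) => /[swap] ->; rewrite addr0.
have [c] := diff_act_pairing p; rewrite p0 raddf0 add0r => pc.
pose m := (U_(inord 0) + (U_(inord 1) + (U_(inord 3) + 0)))%MM : 'X_{1..6}.
exists (p - c *: 'X_[m]), (c *: 'X_[m]); split; last by rewrite subrK.
  rewrite /apolar -scaleNr diff_actD diff_actZ pc.
  rewrite !mpolyXD !diff_act_mulX mpolyX0 diff_act1.
  rewrite mderiv_cubic // /partial /= mderivD !mderivM !mderiv_x //=.
  rewrite !(mulr0, mul0r, addr0, add0r, mulr1, mul1r) mderiv_x //=.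
  by rewrite scaleNr -mul_mpolyC mulr1 subrr.
move=> m' /msuppZ_le; rewrite msuppX inE => /eqP ->.
by rewrite !mdegD !mdeg1 mdeg0.
Qed.

End InverseSystem.

(** * The point over the dual numbers *)

Section DualNumbers.

Variable k : fieldType.

(** The pair (a, b) stands for a + b eps. *)
Definition dual : Type := (k^o * k^o)%type.

HB.instance Definition _ := GRing.Lmodule.on dual.

Definition dual_mul (x y : dual) : dual := (x.1 * y.1, x.1 * y.2 + x.2 * y.1).

Fact dual_mulA : associative dual_mul.
Proof. by move=> [a b] [c d] [e f]; rewrite /dual_mul /=; congr pair; ring. Qed.

Fact dual_mulC : commutative dual_mul.
Proof. by move=> [a b] [c d]; rewrite /dual_mul /=; congr pair; ring. Qed.

Fact dual_mul1 : left_id (1, 0) dual_mul.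
Proof. by move=> [a b]; rewrite /dual_mul /=; congr pair; ring. Qed.

Fact dual_mulD : left_distributive dual_mul +%R.
Proof.
move=> [a b] [c d] [e f]; congr pair; first exact: mulrDl.
have e1 : (a + c) * f + (b + d) * e = a * f + b * e + (c * f + d * e) by ring.
exact: e1.
Qed.

Fact dual_neq0 : (1, 0) != 0 :> dual.
Proof. by rewrite xpair_eqE oner_eq0. Qed.

HB.instance Definition _ := GRing.Zmodule_isComNzRing.Build dual
  dual_mulA dual_mulC dual_mul1 dual_mulD dual_neq0.

Fact dual_scaleAl (c : k) (x y : dual) : c *: (x * y) = (c *: x : dual) * y.
Proof.
case: x y => [a b] [e f]; congr pair; first exact: mulrA.
have e1 : c * (a * f + b * e) = c * a * f + c * b * e by ring.
exact: e1.
Qed.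

HB.instance Definition _ := GRing.Lmodule_isLalgebra.Build k dual dual_scaleAl.
HB.instance Definition _ := GRing.Lalgebra_isComAlgebra.Build k dual.

Definition dual_red (x : dual) : k^o := x.1.

Fact dual_red_linear : linear dual_red. Proof. by []. Qed.
Fact dual_red_multiplicative : monoid_morphism dual_red. Proof. by []. Qed.

HB.instance Definition _ := GRing.isLinear.Build k dual k^o *:%R dual_red
  dual_red_linear.
HB.instance Definition _ := GRing.isMonoidMorphism.Build dual k^o dual_red
  dual_red_multiplicative.

Lemma dual_red_nilpotent x : dual_red x = 0 -> x ^+ 2 = 0.
Proof.
by case: x => a b; rewrite /dual_red /= => ->; congr pair; rewrite /=; ring.
Qed.

Definition dual_eps : dual := (0, 1).

Lemma dual_eps_neq0 : dual_eps != 0.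
Proof. by rewrite xpair_eqE oner_eq0 andbF. Qed.

End DualNumbers.

Section TangentVector.

Variables (k : fieldType) (A : comAlgType k) (eps : A).
Hypothesis eps2 : eps * eps = 0.

Local Notation e := (fun a => delta_mx 0 (inord a) : 'rV[A]_13).

Definition deformed_ideal : {mpoly A[6]} -> Prop :=
  matrix_ideal (deformed_mx eps) (e 0%N).

Lemma deformed_chart : chart lam13 deformed_ideal.
Proof. by apply: matrix_chart; [exact: deformed_mx_comm | exact: model_word]. Qed.

Lemma deformed_mult_mx i : mult_mx lam13 deformed_ideal i = deformed_mx eps i.
Proof. by apply: matrix_mult_mx; [exact: deformed_mx_comm | exact: model_word]. Qed.

Lemma deformed_mx_trace (i : 'I_6) : (0 < i)%N -> \tr (deformed_mx eps i) = 0.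
Proof.
move=> i0; apply: big1 => a _; rewrite !mxE.
have -> : model i a a = Z0.
  have := ltn_ord a; move: (nat_of_ord a) (nat_of_ord i) (ltn_ord i) => b j.
  by do 6?[case: j => [|j] //] => _; do 13?[case: b => [|b] //].
case: (a =P inord (7 + i)) => [->|_]; last by rewrite mulr0 addr0.
rewrite -val_eqE /= !inordK ?(ltn_add2l 7 i 6) //.
have -> : (7 + i == 7)%N = false.
  by have := eqn_add2l 7 i 0; rewrite addn0 (gtn_eqF i0).
by rewrite mulr0 addr0.
Qed.

(** The matrices of x_1, .., x_5 have trace 0, and q_0 and q_2 are products of these
variables only, so that normalisation does not change the rows involved. *)
Lemma deformed_entry :
  normalized_entry (k := k) (mult_mx lam13 deformed_ideal) 2 9 7 = eps.
Proof.
have framedC := mult_mx_framed deformed_chart; have [_ oneC basisC] := framedC.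
set C := mult_mx lam13 deformed_ideal in framedC oneC basisC *.
have cE i : (0 < i < 6)%N -> @centered k A C i = C (inord i).
  move=> /andP[i0 i6]; rewrite /centered {2}/C deformed_mult_mx.
  by rewrite deformed_mx_trace ?inordK // scaler0 raddf0 subr0.
have rowE l : (l < 6)%N -> (0 < (factors l).1)%N -> (0 < (factors l).2)%N ->
    @frame_row k A C (7 + l) = e (7 + l)%N.
  move=> l6 f1 f2; have /andP[g1 g2] := factors_lt l.
  rewrite /frame_row addKn /= !cE ?f1 ?f2 //.
  have -> : delta_mx 0 0 = e 0%N.
    by congr (delta_mx 0 _); apply/val_inj; rewrite /= inordK.
  by rewrite oneC // basisC.
rewrite /normalized_entry /normalized entry_row !mulmxA e_frame //.
rewrite (rowE 2%N) // cE // {1}/C deformed_mult_mx e_deformed_mx //.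
have -> : \row_b (Zscalar A (model (inord 2 : 'I_6) 9 b) +
    eps * ((9 == 7 + (inord 2 : 'I_6))%N && (b == 7 :> nat)%N)%:R) = eps *: e 7 :> 'rV_13.
  apply/rowP=> b; rewrite !mxE !inordK // eqxx -val_eqE /= inordK //.
  by rewrite /model [LHS]add0r.
rewrite -scalemxAl -[e 7](rowE 0%N) // frame_row_adj //.
by rewrite mxE e_entry // mulr1.
Qed.

End TangentVector.

Lemma idealI_deformed (k : fieldType) :
  same_set (@idealI k) (base_change (@dual_red k) (deformed_ideal (@dual_eps k))).
Proof.
have eps2 : dual_eps k * dual_eps k = 0 by exact: (@dual_red_nilpotent k).
have fZ z : dual_red (Zscalar (dual k) z) = Zscalar k z by rewrite /Zscalar rmorph_int.
have zero2 : (0 : k) * 0 = 0 by rewrite mulr0.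
have mapD i : map_mx (@dual_red k) (deformed_mx (dual_eps k) i) = deformed_mx (0 : k^o) i.
  rewrite /deformed_mx map_mxD map_mxZ [_ (dual_eps k)]/(0 : k^o) !scale0r; congr (_ + _).
  by apply/matrixP=> a b; rewrite !mxE; exact: fZ.
have mape : map_mx (@dual_red k) (delta_mx 0 (inord 0)) = delta_mx 0 (inord 0) :> 'rV_13.
  exact: map_delta_mx.
have main := @matrix_ideal_map 6 12 lam13 (dual k) k^o (@dual_red k) _ _ _ _
  (deformed_mx_comm eps2) (deformed_mx_comm (eps := 0 : k^o) zero2)
  (model_word eps2) (model_word (eps := 0 : k^o) zero2) mapD mape.
move=> p; exact: (iff_trans (idealI_model p) (main p)).
Qed.

Theorem corollary3p17 (k : closedFieldType) (hk : [pchar k] =i pred0) :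
  @nonreduced_point k 6 13 (@idealI k).
Proof.
have eps2 : dual_eps k * dual_eps k = 0 by exact: (@dual_red_nilpotent k).
have chI : @chart 6 13 lam13 k^o (@idealI k).
  exact: (chart_base_change (@idealI_deformed k) (deformed_chart eps2)).
have modelI i a b : (i < 6)%N -> (a < 13)%N -> (b < 13)%N ->
    @mult_mx 6 13 lam13 k^o (@idealI k) (inord i) (inord a) (inord b) =
    Zscalar k (model i a b).
  have zero2 : (0 : k) * 0 = 0 by rewrite mulr0.
  have -> : @idealI k = matrix_ideal (deformed_mx (0 : k)) (delta_mx 0 (inord 0)).
    by apply: funext => p; apply: propext; apply: idealI_model.
  move=> i6 a13 b13.
  have -> := @matrix_mult_mx 6 12 lam13 k^o _ _ (deformed_mx_comm zero2)
    (model_word zero2) (inord i).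
  by rewrite deformed_mx0 !inordK.
have [U UE] := universal_entries k.
have [h [h1 hU]] := nilpotent_entry hk chI modelI UE.
apply: (@nonreduced_criterion k 6 13 lam13 (@idealI k) (dual k) (@dual_red k) _
  (deformed_ideal (dual_eps k)) (deformed_chart eps2) (@idealI_deformed k)
  (U 2 9 7) h 4) => //.
- by move=> x x0; exists 2; apply: dual_red_nilpotent.
- by rewrite UE deformed_entry // dual_eps_neq0.
- by apply: hU.
Qed.
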